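(* Let $X$ be a proper CAT$(-1)$ space, let $\Gamma\le\operatorname{Isom}(X)$ be finitely generated, non-elementary and discrete with $0<\delta_X(\Gamma)<\infty$, and let $x\in X$. Let $T_{\mathrm{JSJ}}$ be any chosen JSJ tree for $\Gamma$ with finite quotient, and form the weighted non-backtracking matrix associated to the Bass–Serre normal form of the resulting finite graph-of-groups decomposition of $\Gamma$ from the orbit length $g\mapsto d(x,gx)$. For every strongly connected block $C$ whose support contains a directed closed walk, every entry of the corresponding matrix $K_{C,x}(\delta_X(\Gamma))$ is finite and its spectral radius is at most one. Every finite choice of hyperbolic representatives gives a comparison matrix whose critical parameter is at most $\delta_X(\Gamma)$. If $\delta_X(\Gamma)<1$, or if the action is convex-cobounded, each such critical parameter is a lower bound for $\dim_H(\Lambda_\Gamma,\rho_x)$.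
   Context: $\delta_X(\Gamma)=\inf\{s>0:\sum_{g\in\Gamma}e^{-sd(x,gx)}<\infty\}$; $\Lambda_\Gamma$ is the limit set; $\rho_x(\xi,\eta)=e^{-(\xi\mid\eta)_x}$ is the Bourdon metric on $\partial X$. The action is convex-cobounded if there is $R<\infty$ with $\bigcup_{g,h\in\Gamma}[gx,hx]\subseteq\bigcup_{g\in\Gamma}gB_X(x,R)$. JSJ tree (Guirardel–Levitt): fix a family of allowed edge groups (subgroups of $\Gamma$ closed under conjugation and passing to subgroups) and possibly a peripheral family of subgroups required to be elliptic. Consider simplicial $\Gamma$-trees without inversions with allowed edge stabilizers (and elliptic peripheral subgroups). A tree is universally elliptic if its edge stabilizers are elliptic in every such tree; a JSJ tree is a universally elliptic tree that dominates every universally elliptic tree (every subgroup elliptic in it is elliptic in every universally elliptic tree). Only the finite graph-of-groups decomposition $Y=\Gamma\backslash T_{\mathrm{JSJ}}$ matters here. Weighted matrix. Write $T=T_{\mathrm{JSJ}}$, $H=\Gamma$. For an oriented edge $f$ of $Y$: origin $\iota(f)$, terminus $t(f)$, reverse $\bar f$. Fix a base vertex $v_*$ of $Y$, a lift $\tilde v\in T$ of each vertex $v$, a lift $\tilde f$ of each oriented edge $f$ with origin $\widetilde{\iota(f)}$, and $\tau_f\in H$ with $t(\tilde f)=\tau_f\widetilde{t(f)}$, chosen so that $\widetilde{\bar f}=\tau_f^{-1}\overline{\tilde f}$ and $\tau_{\bar f}=\tau_f^{-1}$. Put $G_v=\operatorname{Stab}_H(\tilde v)$, $G_f=\operatorname{Stab}_H(\tilde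 f)\le G_{\iota(f)}$. For $c=rG_f\in G_{\iota(f)}/G_f$ let $L_{f,x}(c)=\min_{h\in G_f}d(x,rh\tau_fx)$. An allowed transition is a triple $(e,f,c)$ of oriented edges $e,f$ with $t(e)=\iota(f)$ and $c\in G_{\iota(f)}/G_f$, where $c\ne G_f$ is required if $f=\bar e$. Let $K_{ef,x}(s)=\sum_{c:(e,f,c)\text{ allowed}}e^{-sL_{f,x}(c)}$. A reduced coset-labelled loop based at $v_*$ is a sequence $(f_1,c_1;\dots;f_n,c_n)$, $c_j\in G_{\iota(f_j)}/G_{f_j}$, with $\iota(f_1)=v_*=t(f_n)$ and all $(f_j,f_{j+1},c_{j+1})$ allowed. The state set $E_*$ is the set of oriented edges occurring in some such loop. Blocks $C$ are strongly connected components of the support digraph of $K_x$ restricted to $E_*$ that contain a directed closed walk of positive length; $K_{C,x}(s)$ is the corresponding diagonal block. Comparison matrices. An isometry $g$ is hyperbolic if $\tau_X(g)=\inf_zd(z,gz)$ is positive and attained; it has a unique axis $\operatorname{Ax}(g)$, and $a_x(g)=\tau_X(g)+2d(x,\operatorname{Ax}(g))$. A finite choice $\mathcal F$ of hyperbolic representatives in $C$ consists, for each $e,f\in C$, of a finite set $\mathcal F_{ef}$ of distinct cosets $c$ with $(e,f,c)$ allowed and, for each $c=rG_f\in\mathcal F_{ef}$, one hyperbolic element $g_{ef,c}=rh\tau_f$ with $h\in G_f$. The comparison matrix is $A^{\mathcal F}_{C,x}(s)_{ef}=\sum_{c\in\mathcal F_{ef}}e^{-sa_x(g_{ef,c})}$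 and its critical parameter is $\inf\{s>0:\rho(A^{\mathcal F}_{C,x}(s))<1\}$, $\rho$ denoting spectral radius. *)

(* Defs.v *)
From HB Require Import structures.
From mathcomp Require Import all_boot all_order all_algebra finmap.
From mathcomp Require Import all_classical all_reals all_analysis.
From mathcomp Require Import complex.

Set Implicit Arguments.
Unset Strict Implicit.
Unset Printing Implicit Defensive.

Import Order.TTheory GRing.Theory Num.Theory.
Import numFieldTopology.Exports.

Local Open Scope classical_set_scope.
Local Open Scope ring_scope.

Section MetricGeometry.
Context {R : realType} {X : metricType R}.
Implicit Types (x y z p q r : X) (c : R -> X).

Definition is_geodesic p q c : Prop :=
  [/\ c 0 = p, c (mdist p q) = q &
      forall s t, 0 <= s <= mdist p q -> 0 <= t <= mdist p q ->
        mdist (c s) (c t) = `|s - t|].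

(* The union of all geodesic segments from p to q (a single segment when X is
   uniquely geodesic). *)
Definition segment p q : set X :=
  [set y | exists2 c, is_geodesic p q c &
           exists2 t, 0 <= t <= mdist p q & y = c t].

Definition geodesic_space : Prop :=
  forall p q, exists c, is_geodesic p q c.

Definition proper_space : Prop :=
  forall x (r : R), compact [set y | mdist x y <= r].

(* The hyperbolic plane of curvature -1 in the upper half-plane model. *)
Definition arcosh (u : R) : R := ln (u + Num.sqrt (u ^+ 2 - 1)).

Definition half_plane : set (R * R) := [set z | 0 < z.2].

Definition hyp_dist (z w : R * R) : R :=
  arcosh (1 + ((z.1 - w.1) ^+ 2 + (z.2 - w.2) ^+ 2) / (2 * z.2 * w.2)).

(* p', q', r' form a comparison triangle; y', z' are the comparison points of
   y on the side pq and z on the side pr.  Any two distinct sides of a triangle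
   share a vertex, and for two points on one side the inequality is an
   equality. *)
Definition cat_minus_one : Prop :=
  geodesic_space /\
  forall p q r y z (p' q' r' y' z' : R * R),
    segment p q y -> segment p r z ->
    half_plane p' -> half_plane q' -> half_plane r' ->
    half_plane y' -> half_plane z' ->
    hyp_dist p' q' = mdist p q ->
    hyp_dist p' r' = mdist p r ->
    hyp_dist q' r' = mdist q r ->
    hyp_dist p' y' = mdist p y -> hyp_dist y' q' = mdist y q ->
    hyp_dist p' z' = mdist p z -> hyp_dist z' r' = mdist z r ->
    mdist y z <= hyp_dist y' z'.

(* The boundary at infinity: classes of asymptotic geodesic rays.  A ray is a
   function on R of which only the values on [0, +oo[ matter. *)
Definition is_ray c : Prop :=
  forall s t, 0 <= s -> 0 <= t -> mdist (c s) (c t) = `|s - t|.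

Definition asymptotic c c' : Prop :=
  exists M, forall t, 0 <= t -> mdist (c t) (c' t) <= M.

Definition ray_class c : set (R -> X) :=
  [set c' | is_ray c' /\ asymptotic c c'].

Definition boundary : Type :=
  {xi : set (R -> X) | exists2 c, is_ray c & xi = ray_class c}.

Definition ray_of (xi : boundary) : R -> X := projT1 (cid2 (projT2 xi)).

Definition gromov_product x y z : R :=
  (mdist x y + mdist x z - mdist y z) / 2.

(* (xi | eta)_x, equal to +oo if xi = eta.  In a CAT(-1) space the limit exists
   and does not depend on the representatives. *)
Definition boundary_product x (xi eta : boundary) : \bar R :=
  lim ((gromov_product x (ray_of xi t) (ray_of eta t))%:E @[t --> +oo]).

Definition bourdon x (xi eta : boundary) : R :=
  fine (expeR (- boundary_product x xi eta)%E).

(* Convergence of a sequence of points of X to a boundary point: the Gromov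
   products of y_n with the points of a ray in the class tend to infinity. *)
Definition cvg_boundary x (y : nat -> X) (xi : boundary) : Prop :=
  forall c, projT1 xi c ->
    gromov_product x (y p.1) (c p.2) @[p --> (\oo, +oo)] --> +oo.

Definition displacement (g : X -> X) : R := inf [set mdist z (g z) | z in setT].

Definition hyperbolic (g : X -> X) : Prop :=
  0 < displacement g /\ exists z, mdist z (g z) = displacement g.

(* The union of the geodesic lines translated by g; for a hyperbolic isometry of
   a CAT(-1) space there is exactly one. *)
Definition axis (g : X -> X) : set X :=
  [set y | exists2 c : R -> X,
     (forall s t, mdist (c s) (c t) = `|s - t|) /\
     (forall t, g (c t) = c (t + displacement g)) &
     exists t, y = c t].

Definition dist_to x (A : set X) : R := inf [set mdist x y | y in A].

Definition axis_length x (g : X -> X) : R :=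
  displacement g + 2 * dist_to x (axis g).

End MetricGeometry.

Arguments geodesic_space {R} X.
Arguments proper_space {R} X.
Arguments cat_minus_one {R} X.
Arguments boundary {R} X.

Section HausdorffDimension.
Context {R : realType} {B : Type} (rho : B -> B -> R).
Local Open Scope ereal_scope.

Definition diameter (U : set B) : \bar R :=
  ereal_sup (0 |` [set (rho p.1 p.2)%:E | p in U `*` U]).

Definition hausdorff_premeasure (s eps : R) (A : set B) : \bar R :=
  ereal_inf [set \sum_(i <oo) poweR (diameter (U i)) s | U in
    [set U : nat -> set B |
      A `<=` \bigcup_i U i /\ forall i, diameter (U i) <= eps%:E]].

Definition hausdorff_measure (s : R) (A : set B) : \bar R :=
  ereal_sup [set hausdorff_premeasure s eps A | eps in [set e : R | (0 < e)%R]].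

(* Restricting to s > 0 does not change the infimum and avoids 0 ^ 0. *)
Definition hausdorff_dim (A : set B) : \bar R :=
  ereal_inf [set s%:E | s in
    [set s : R | (0 < s)%R /\ hausdorff_measure s A = 0]].

End HausdorffDimension.

Section Groups.
Context {G : groupType}.
Implicit Types (H K : set G).

Definition is_subgroup H : Prop :=
  [/\ H 1%g, forall g h, H g -> H h -> H (g * h)%g & forall g, H g -> H g^-1%g].

Definition finitely_generated : Prop :=
  exists2 S : set G, finite_set S &
    forall H, is_subgroup H -> S `<=` H -> H = setT.

Definition is_action (Z : Type) (a : G -> Z -> Z) : Prop :=
  (forall z, a 1%g z = z) /\ (forall g h z, a (g * h)%g z = a g (a h z)).

Definition stabilizer (Z : Type) (a : G -> Z -> Z) (z : Z) : set G :=
  [set g | a g z = z].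

Definition left_coset (r : G) H : set G := [set (r * h)%g | h in H].

End Groups.

Arguments finitely_generated : clear implicits.

Section IsometricAction.
Context {R : realType} {X : metricType R} {G : groupType}.
Variable act : G -> X -> X.

(* G as a subgroup of Isom(X): the homomorphism to Isom(X) given by the action
   is injective. *)
Definition isometry_group : Prop :=
  [/\ is_action act,
      forall g y z, mdist (act g y) (act g z) = mdist y z
    & injective act].

(* Discreteness in Isom(X) for the compact-open topology. *)
Definition discrete_group : Prop :=
  forall g : G, isolated (range act : set {compact-open, X -> X}) (act g).

Variable x : X.

Definition critical_exponent : \bar R :=
  ereal_inf [set s%:E | s in [set s : R | 0 < s /\
    (\esum_(g in [set: G]) (expR (- s * mdist x (act g x)))%:E < +oo)%E]].

Definition limit_set : set (boundary X) :=
  [set xi | exists g : nat -> G, cvg_boundary x (fun n => act (g n) x) xi].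

(* Elementary groups are those with at most two limit points. *)
Definition non_elementary : Prop :=
  forall xi eta, ~ (limit_set `<=` [set xi; eta]).

Definition convex_cobounded : Prop :=
  exists r : R, \bigcup_g \bigcup_h segment (act g x) (act h x) `<=`
                \bigcup_g (act g @` ball x r).

End IsometricAction.

(* A graph in the sense of Serre: oriented edges with a fixed-point free
   reversal. *)

Record graph := Graph {
  vert : Type;
  edge : Type;
  orig : edge -> vert;
  ebar : edge -> edge;
  ebarK : involutive ebar;
  ebar_neq : forall e, ebar e <> e }.

Section Trees.
Variable Y : graph.
Implicit Types (u w : vert Y) (p : seq (edge Y)).

Definition term (e : edge Y) : vert Y := orig (ebar e).

Fixpoint edge_path u p w : Prop :=
  if p is e :: p' then orig e = u /\ edge_path (term e) p' w else u = w.

Fixpoint reduced p : Prop :=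
  if p is e :: p' then
    (if p' is f :: _ then f <> ebar e else True) /\ reduced p'
  else True.

Definition is_tree : Prop :=
  [/\ exists u : vert Y, True,
      forall u w, exists p, edge_path u p w
    & forall u p, edge_path u p u -> reduced p -> p = [::]].

End Trees.

Record gtree (G : groupType) := GTree {
  tgraph :> graph;
  tgraph_tree : is_tree tgraph;
  vact : G -> vert tgraph -> vert tgraph;
  eact : G -> edge tgraph -> edge tgraph;
  vactP : is_action vact;
  eactP : is_action eact;
  orig_act : forall g e, orig (eact g e) = vact g (orig e);
  ebar_act : forall g e, ebar (eact g e) = eact g (ebar e);
  no_inversion : forall g e, eact g e <> ebar e }.

Section JSJ.
Context {G : groupType}.
Implicit Types (H K : set G) (T : gtree G).

Definition elliptic T H : Prop :=
  exists v, forall h, H h -> vact h v = v :> vert T.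

Definition edge_group_family (A : set (set G)) : Prop :=
  [/\ forall H, A H -> is_subgroup H,
      forall H g, A H -> A [set (h ^ g)%g | h in H]
    & forall H K, A H -> is_subgroup K -> K `<=` H -> A K].

Variables A P : set (set G).

Definition admissible_tree T : Prop :=
  (forall e : edge T, A (stabilizer (@eact G T) e)) /\
  (forall H, P H -> elliptic T H).

Definition universally_elliptic T : Prop :=
  admissible_tree T /\
  forall T', admissible_tree T' ->
    forall e : edge T, elliptic T' (stabilizer (@eact G T) e).

Definition dominates T T' : Prop :=
  forall H, is_subgroup H -> elliptic T H -> elliptic T' H.

Definition jsj_tree T : Prop :=
  universally_elliptic T /\
  forall T', universally_elliptic T' -> dominates T T'.

End JSJ.

(* A finite graph together with a projection identifying it with G \ T *)
Record finite_quotient (G : groupType) (T : gtree G) := FiniteQuotient {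
  qvert : finType;
  qedge : finType;
  qorig : qedge -> qvert;
  qbar : qedge -> qedge;
  pvert : vert T -> qvert;
  pedge : edge T -> qedge;
  pvert_surj : forall v, exists u, pvert u = v;
  pedge_surj : forall f, exists e, pedge e = f;
  pvert_orbit : forall u w, pvert u = pvert w <-> exists g, w = vact g u;
  pedge_orbit : forall e e', pedge e = pedge e' <-> exists g, e' = eact g e;
  qorig_pedge : forall e, qorig (pedge e) = pvert (orig e);
  qbar_pedge : forall e, qbar (pedge e) = pedge (ebar e) }.

Definition qterm (G : groupType) (T : gtree G) (Y : finite_quotient T)
  (f : qedge Y) : qvert Y := qorig (qbar f).

Record lifts (G : groupType) (T : gtree G) (Y : finite_quotient T) := Lifts {
  vbase : qvert Y;
  vlift : qvert Y -> vert T;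
  elift : qedge Y -> edge T;
  tau : qedge Y -> G;
  vliftK : forall v, pvert Y (vlift v) = v;
  eliftK : forall f, pedge Y (elift f) = f;
  orig_elift : forall f, orig (elift f) = vlift (qorig f);
  term_elift : forall f, term (elift f) = vact (tau f) (vlift (qterm f));
  elift_bar : forall f, elift (qbar f) = eact (tau f)^-1%g (ebar (elift f));
  tau_bar : forall f, tau (qbar f) = (tau f)^-1%g }.

(* The spectral radius of a real matrix, computed from its complex
   eigenvalues; it is 0 for the empty matrix. *)
Definition spectral_radius (R : realType) (n : nat) (M : 'M[R]_n) : R :=
  sup [set ComplexField.Normc.normc l | l in
    [set l : R[i] | eigenvalue (map_mx (real_complex R) M) l]].

Section WeightedMatrix.
Context {R : realType} {X : metricType R} {G : groupType}.
Variables (act : G -> X -> X) (x : X).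
Context {T : gtree G} {Y : finite_quotient T}.
Variable D : lifts Y.
Implicit Types (e f : qedge Y) (c : set G) (s : R) (C : {set qedge Y}).

Definition vgroup (v : qvert Y) : set G := stabilizer (@vact G T) (vlift D v).
Definition egroup f : set G := stabilizer (@eact G T) (elift D f).

Definition edge_coset f c : Prop :=
  exists2 r, vgroup (qorig f) r & c = left_coset r (egroup f).

(* For c = r G_f, the elements of c are the r h with h in G_f; the infimum is
   attained when the group is discrete and X is proper. *)
Definition coset_length f c : R :=
  inf [set mdist x (act (g * tau D f)%g x) | g in c].

Definition allowed e f c : Prop :=
  [/\ qterm e = qorig f, edge_coset f c & f = qbar e -> c <> egroup f].

Definition Kweight s e f : \bar R :=
  \esum_(c in [set c | allowed e f c]) (expR (- s * coset_length f c))%:E.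

Definition reduced_loop (l : seq (qedge Y * set G)) : Prop :=
  if l is a :: l' then
    [/\ qorig a.1 = vbase D, edge_coset a.1 a.2,
        path (fun a b => `[< allowed a.1 b.1 b.2 >]) a l'
      & qterm (last a l').1 = vbase D]
  else False.

Definition state e : bool :=
  `[< exists2 l, reduced_loop l & e \in [seq a.1 | a <- l] >].

(* The support does not depend on s, since all summands are positive. *)
Definition support_rel : rel (qedge Y) := fun e f =>
  [&& state e, state f & `[< forall s, 0 < s -> Kweight s e f != 0%E >]].

Definition is_block C : Prop :=
  (exists2 e, state e &
     forall f, (f \in C) = connect support_rel e f && connect support_rel f e)
  /\
  (exists e, exists2 w : seq (qedge Y), w != [::] &
     [/\ e \in C, {subset w <= C}, path support_rel e w & last e w = e]).

Definition Kblock C s : 'M[R]_#|C| :=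
  \matrix_(i, j) fine (Kweight s (enum_val i) (enum_val j)).

Record hyperbolic_choice C := HyperbolicChoice {
  hfam : qedge Y -> qedge Y -> {fset set G};
  helt : qedge Y -> qedge Y -> set G -> G;
  hfam_allowed : forall e f c, e \in C -> f \in C ->
    c \in hfam e f -> allowed e f c;
  helt_coset : forall e f c, e \in C -> f \in C -> c \in hfam e f ->
    exists2 g, c g & helt e f c = (g * tau D f)%g;
  helt_hyperbolic : forall e f c, e \in C -> f \in C -> c \in hfam e f ->
    hyperbolic (act (helt e f c)) }.

Definition comparison_matrix C (F : hyperbolic_choice C) s : 'M[R]_#|C| :=
  \matrix_(i, j) let e := enum_val i in let f := enum_val j in
    \sum_(c <- hfam F e f) expR (- s * axis_length x (act (helt F e f c))).

Definition critical_parameter C (F : hyperbolic_choice C) : \bar R :=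
  ereal_inf [set s%:E | s in
    [set s : R | 0 < s /\ spectral_radius (comparison_matrix F s) < 1]].

End WeightedMatrix.

(* Main.v *)
Require Import Defs.
From HB Require Import structures.
From mathcomp Require Import all_boot all_order all_algebra finmap.
From mathcomp Require Import all_classical all_reals all_analysis.
From mathcomp Require Import complex ring lra.

Set Implicit Arguments.
Unset Strict Implicit.
Unset Printing Implicit Defensive.

Import Order.TTheory GRing.Theory Num.Theory.
Import numFieldTopology.Exports.

Local Open Scope classical_set_scope.
Local Open Scope ring_scope.

(** Write |g| for the orbit length d (x, g x) and P (s) for the Poincare
   series.

   Matrices and words. Choosing in every coset of a transition an element of
   nearly minimal orbit length turns an allowed sequence of transitions into a
   product of group elements, and |.| of the product is at most the sum of the
   coset lengths. In the Bass-Serre tree such a sequence draws a reduced edge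
   path, and a tree has only one reduced path between two vertices; hence
   sequences with the same ends and the same product are equal
   (chain_prod_inj). So every entry of every power of a matrix built from
   finitely many transitions is at most P (s), for each s at which P converges
   (pathsum_le_poincare). A diagonal entry of a power is then at most 1, since
   going round a closed walk k times takes it to its k-th power; this survives
   the limit s -> delta because only finitely many transitions are involved
   (family_diag). Closing up a transition inside a block bounds its entry at
   delta and all powers of the block at delta, and bounded powers mean
   spectral radius at most 1 (block_entry_fin, block_radius).

   Comparison matrices. A hyperbolic isometry of a CAT(-1) space has an axis
   (axis_nonempty), so that its axis length bounds |g| from above. The same
   count bounds the powers of a comparison matrix whenever P (s') converges,
   and the spectral radius at any s > s' is smaller than 1 because axis
   lengths are positive (critical_parameter_le).

   Dimension. It remains to see that delta is at most the Hausdorff dimension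
   of the limit set, by an argument of Bishop and Jones; the geometry enters
   through Gromov's four-point inequality. Non-elementarity provides bounded
   connecting elements h making the Gromov product of a and h b bounded, for
   all a and b (connecting_elements). For s < delta some annulus contains a
   separated finite set S of elements whose weights exp (- s (|g| + M)) add up
   to at least 1 (letters). Words in S, with connecting elements inserted
   between the letters, follow broken geodesics with long sides and bounded
   turns; these are quasi-geodesics, they determine the word (word_inj), and
   infinite words converge to limit points. Given a cover of the limit set by
   sets U_i, cut every infinite word at the depth prescribed by the diameter
   of the set that contains its limit. The words cut by one U_i end within
   bounded distance of each other, so there are boundedly many of them, each
   of weight at most about the s-th power of the diameter; on the other hand
   the words at the cuts have total weight at least 1 (bar_weight). Hence the
   s-dimensional Hausdorff measure of the limit set is not zero. *)

(** * Hyperbolic functions *)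

Section Hyperbolic.
Context {R : realType}.
Implicit Types a b s t u : R.

Definition cosh u : R := (expR u + expR (- u)) / 2.
Definition sinh u : R := (expR u - expR (- u)) / 2.

Lemma cosh0 : cosh 0 = 1.
Proof. by rewrite /cosh oppr0 expR0; lra. Qed.

Lemma sinh0 : sinh 0 = 0.
Proof. by rewrite /sinh oppr0 expR0; lra. Qed.

Lemma coshN u : cosh (- u) = cosh u.
Proof. by rewrite /cosh opprK addrC. Qed.

Lemma cosh_abs u : cosh `|u| = cosh u.
Proof.
by case: (lerP 0 u) => u0; [rewrite ger0_norm|rewrite ltr0_norm// coshN].
Qed.

Lemma cosh2 u : cosh u ^+ 2 = 1 + sinh u ^+ 2.
Proof.
rewrite /cosh /sinh expRN.
by have := expR_gt0 u; move: (expR u) => E E0; field; rewrite gt_eqF.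
Qed.

Lemma coshB a b : cosh (a - b) = cosh a * cosh b - sinh a * sinh b.
Proof.
rewrite /cosh /sinh opprB !expRD !expRN.
have := expR_gt0 a; have := expR_gt0 b.
by move: (expR a) (expR b) => A B B0 A0; field; rewrite !gt_eqF.
Qed.

Lemma coshD a b : cosh (a + b) = cosh a * cosh b + sinh a * sinh b.
Proof.
rewrite /cosh /sinh opprD !expRD !expRN.
have := expR_gt0 a; have := expR_gt0 b.
by move: (expR a) (expR b) => A B B0 A0; field; rewrite !gt_eqF.
Qed.

Lemma cosh_sub a b m :
  cosh (a + b - m *+ 2) - cosh (a - b) = 2 * (sinh (a - m) * sinh (b - m)).
Proof.
rewrite /cosh /sinh mulr2n !opprD !opprK !expRD !expRN.
have := expR_gt0 a; have := expR_gt0 b; have := expR_gt0 m.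
by move: (expR a) (expR b) (expR m) => A B M M0 B0 A0; field; rewrite !gt_eqF.
Qed.

Lemma sinh_double u : sinh u = 2 * (sinh (u / 2) * cosh (u / 2)).
Proof.
rewrite /cosh /sinh {1 2}(_ : u = u / 2 + u / 2); last by field.
rewrite opprD !expRD !expRN.
have := expR_gt0 (u / 2).
by move: (expR (u / 2)) => E E0; field; rewrite !gt_eqF.
Qed.

Lemma sinh_mono a b : (sinh a <= sinh b) = (a <= b).
Proof.
have H : {homo sinh : x y / x < y}.
  move=> x y xy; rewrite /sinh.
  have : expR x < expR y by rewrite ltr_expR.
  have : expR (- y) < expR (- x) by rewrite ltr_expR ltrN2.
  by lra.
exact: (le_mono H).
Qed.

Lemma sinh_ge0 u : (0 <= sinh u) = (0 <= u).
Proof. by rewrite -{1}sinh0 sinh_mono. Qed.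

Lemma sinh_gt0 u : (0 < sinh u) = (0 < u).
Proof. by rewrite -{1}sinh0 !ltNge sinh_mono. Qed.

Lemma cosh_ge1 u : 1 <= cosh u.
Proof.
rewrite /cosh expRN; have := expR_gt0 u; move: (expR u) => E E0.
rewrite ler_pdivlMr// -(ler_pM2r E0) mulrDl mulVf ?gt_eqF//.
by have := sqr_ge0 (E - 1); rewrite !expr2; lra.
Qed.

Lemma cosh_le a b : 0 <= a -> a <= b -> cosh a <= cosh b.
Proof.
move=> a0 ab; have a1 := cosh_ge1 a; have b1 := cosh_ge1 b.
rewrite -ler_sqr ?nnegrE; [|lra|lra].
by rewrite !cosh2 lerD2l ler_sqr ?nnegrE ?sinh_ge0 ?sinh_mono// (le_trans a0).
Qed.

Lemma arcosh_cosh u : 0 <= u -> arcosh (cosh u) = u.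
Proof.
move=> u0; rewrite /arcosh cosh2 addrAC subrr add0r sqrtr_sqr ger0_norm ?sinh_ge0//.
rewrite [X in ln X](_ : _ = expR u) ?expRK//.
by rewrite /cosh /sinh; lra.
Qed.

Lemma arcosh_ge v : 1 <= v -> forall d, 0 <= d -> d <= arcosh v -> cosh d <= v.
Proof.
move=> v1 d d0 dv; apply: le_trans (cosh_le d0 dv) _.
have D0 : 0 <= v ^+ 2 - 1 by nra.
rewrite /arcosh /cosh expRN.
have := sqrtr_ge0 (v ^+ 2 - 1); have := sqr_sqrtr D0.
move: (Num.sqrt _) => w w2 w0.
rewrite lnK; last by rewrite posrE; lra.
rewrite (_ : (v + w)^-1 = v - w); first by lra.
have vw0 : v + w != 0 by rewrite gt_eqF//; lra.
apply: (mulfI vw0); rewrite mulfV//; nra.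
Qed.

(** This is the point with polar coordinates (t, (a, b)) on the hyperboloid, carried
   to the upper half-plane with i as origin: the hyperbolic cosine of the distance
   of two such points is a Lorentz product, which hyp_dist_polar evaluates. *)
Definition polar t a b : R * R :=
  (sinh t * a / (cosh t - sinh t * b), (cosh t - sinh t * b)^-1).

Lemma polar_den_gt0 t a b : a ^+ 2 + b ^+ 2 = 1 -> 0 < cosh t - sinh t * b.
Proof.
move=> ab; have := cosh2 t; have := cosh_ge1 t; move: (cosh t) (sinh t) => c s.
move=> c1 cs.
have : 0 < (c - s * b) * (c + s * b).
  rewrite -subr_sqr cs (_ : _ - _ = 1 + (s * a) ^+ 2).
    by have := sqr_ge0 (s * a); lra.
  by rewrite !exprMn (_ : a ^+ 2 = 1 - b ^+ 2); [ring|lra].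
case: (ltrP 0 (c - s * b)) => // H0 H; exfalso.
have H1 : c + s * b <= 0 by move: H; rewrite nmulr_rgt0; nra.
by lra.
Qed.

Lemma polar_half_plane t a b : a ^+ 2 + b ^+ 2 = 1 -> half_plane (polar t a b).
Proof. by move=> ab; rewrite /half_plane /polar /= invr_gt0; exact: (polar_den_gt0 t ab). Qed.

Lemma hyp_dist_polar t a b s c d :
  a ^+ 2 + b ^+ 2 = 1 -> c ^+ 2 + d ^+ 2 = 1 ->
  hyp_dist (polar t a b) (polar s c d) =
  arcosh (cosh t * cosh s - sinh t * sinh s * (a * c + b * d)).
Proof.
move=> ab cd; rewrite /hyp_dist /=; congr arcosh.
have := polar_den_gt0 t ab; have := polar_den_gt0 s cd.
have := cosh2 t; have := cosh2 s.
move: (cosh t) (sinh t) (cosh s) (sinh s) => C S C' S' eC' eC D'0 D0.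
set D := C - S * b in D0 *; set D' := C' - S' * d in D'0 *.
have HD : (S * a) ^+ 2 + 1 = D * (C + S * b).
  rewrite /D exprMn (_ : a ^+ 2 = 1 - b ^+ 2); last by lra.
  by rewrite mulrC -subr_sqr eC; ring.
have HD' : (S' * c) ^+ 2 + 1 = D' * (C' + S' * d).
  rewrite /D' exprMn (_ : c ^+ 2 = 1 - d ^+ 2); last by lra.
  by rewrite mulrC -subr_sqr eC'; ring.
have nD : D != 0 by rewrite gt_eqF.
have nD' : D' != 0 by rewrite gt_eqF.
have -> : (S * a / D - S' * c / D') ^+ 2 + (D^-1 - D'^-1) ^+ 2 =
   (((S * a) ^+ 2 + 1) * D' ^+ 2 + ((S' * c) ^+ 2 + 1) * D ^+ 2
     - 2 * D * D' * (1 + S * a * (S' * c))) / (D ^+ 2 * D' ^+ 2).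
  by field; rewrite nD nD'.
rewrite HD HD'.
have -> : 1 + (D * (C + S * b) * D' ^+ 2 + D' * (C' + S' * d) * D ^+ 2 -
      2 * D * D' * (1 + S * a * (S' * c))) / (D ^+ 2 * D' ^+ 2) /
   (2 * D^-1 * D'^-1) =
   ((C + S * b) * D' + (C' + S' * d) * D) / 2 - S * a * (S' * c).
  by field; rewrite nD nD'.
by rewrite /D /D'; field.
Qed.

End Hyperbolic.

(** * The comparison inequality in polar coordinates *)

Section Comparison.
Context {R : realType} {X : metricType R}.
Implicit Types (x y z p q r : X) (c : R -> X).

Lemma geo_dist0 p q c t : is_geodesic p q c -> 0 <= t <= mdist p q ->
  mdist p (c t) = t.
Proof.
move=> [c0 _ H] tq; rewrite -c0 H ?lexx ?mdist_ge0//.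
by rewrite sub0r normrN ger0_norm//; case/andP: tq.
Qed.

Lemma geo_dist1 p q c t : is_geodesic p q c -> 0 <= t <= mdist p q ->
  mdist (c t) q = mdist p q - t.
Proof.
move=> [_ c1 H] tq; rewrite -{1}c1 H ?lexx ?mdist_ge0//.
by rewrite distrC ger0_norm// subr_ge0; case/andP: tq.
Qed.

Hypothesis cat : cat_minus_one X.

(** By the hyperbolic law of cosines, k is the cosine of the angle at the comparison
   point of p, and the right-hand side is the hyperbolic cosine of the distance
   between the comparison points. *)
Lemma cat_cosine p q r c c' (s t k : R) :
  is_geodesic p q c -> is_geodesic p r c' ->
  0 < mdist p q -> 0 < mdist p r ->
  0 <= s <= mdist p q -> 0 <= t <= mdist p r ->
  k = (cosh (mdist p q) * cosh (mdist p r) - cosh (mdist q r)) /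
      (sinh (mdist p q) * sinh (mdist p r)) ->
  cosh (mdist (c s) (c' t)) <= cosh s * cosh t - sinh s * sinh t * k.
Proof.
move=> gc gc' a0 b0 sa tb kE.
have cS := geo_dist0 gc sa; have cS' := geo_dist1 gc sa.
have cT := geo_dist0 gc' tb; have cT' := geo_dist1 gc' tb.
have sega : segment p q (c s) by exists c => //; exists s.
have segb : segment p r (c' t) by exists c' => //; exists t.
have e1 := metric_triangle q p r; have e2 := metric_triangle p q r.
have e3 := metric_triangle p r q.
rewrite (metric_sym q p) in e1; rewrite (metric_sym r q) in e3.
have e0 := mdist_ge0 q r.
set a := mdist p q in a0 sa kE cS cS' e1 e2 e3 *.
set b := mdist p r in b0 tb kE cT cT' e1 e2 e3 *.
set e := mdist q r in kE e0 e1 e2 e3 *.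
have [s0 sa'] := andP sa; have [t0 tb'] := andP tb.
have Sa : 0 < sinh a by rewrite sinh_gt0.
have Sb : 0 < sinh b by rewrite sinh_gt0.
have kE' : sinh a * sinh b * k = cosh a * cosh b - cosh e.
  by rewrite kE; field; rewrite !gt_eqF.
have Sab : 0 < sinh a * sinh b by rewrite mulr_gt0.
have k1 : k <= 1.
  have : cosh (a - b) <= cosh e.
    by rewrite -cosh_abs; apply: cosh_le => //; rewrite ler_norml; lra.
  rewrite coshB; nra.
have k2 : -1 <= k.
  have : cosh e <= cosh (a + b) by apply: cosh_le => //; lra.
  rewrite coshD; nra.
have k3 : 0 <= 1 - k ^+ 2 by nra.
pose w := Num.sqrt (1 - k ^+ 2).
have w1 : k ^+ 2 + w ^+ 2 = 1 by rewrite /w sqr_sqrtr//; lra.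
have o1 : (1 : R) ^+ 2 + 0 ^+ 2 = 1 by rewrite expr1n expr0n addr0.
have V : forall u v : R, cosh u * cosh v - sinh u * sinh v * (1 * 1 + 0 * 0) =
    cosh `|u - v| by move=> u v; rewrite cosh_abs coshB; ring.
have V' : forall u v : R, cosh u * cosh v - sinh u * sinh v * (k * k + w * w) =
    cosh `|u - v| by move=> u v; rewrite cosh_abs coshB; move: w1; rewrite !expr2 => ->; ring.
have V1 : 1 <= cosh s * cosh t - sinh s * sinh t * k.
  have : 0 <= sinh s * sinh t by rewrite mulr_ge0// sinh_ge0.
  have := cosh_ge1 (s - t); rewrite coshB; nra.
apply: (arcosh_ge V1); first exact: mdist_ge0.
have hu := fun u => polar_half_plane u o1.
have hw := fun u => polar_half_plane u w1.
have e1k : 1 * k + 0 * w = k by ring.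
have d1 (u v : R) : hyp_dist (polar u 1 0) (polar v 1 0) = `|u - v|.
  by rewrite (hyp_dist_polar u v o1 o1) V arcosh_cosh.
have d2 (u v : R) : hyp_dist (polar u k w) (polar v k w) = `|u - v|.
  by rewrite (hyp_dist_polar u v w1 w1) V' arcosh_cosh.
have d0 (u : R) : 0 <= u -> hyp_dist (polar 0 1 0) (polar u k w) = u.
  by move=> u0; rewrite (hyp_dist_polar 0 u o1 w1) sinh0 !mul0r subr0 cosh0 mul1r arcosh_cosh.
have := cat.2 p q r (c s) (c' t) _ _ _ _ _ sega segb
  (hu 0) (hu a) (hw b) (hu s) (hw t).
rewrite !d1 d2 (d0 b (ltW b0)) (d0 t t0) cS cS' cT cT' (hyp_dist_polar s t o1 w1) e1k.
rewrite (hyp_dist_polar a b o1 w1) e1k mulrC [sinh a * _]mulrC.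
apply => //.
- by rewrite sub0r normrN ger0_norm// ltW.
- have -> : cosh b * cosh a - sinh b * sinh a * k = cosh e.
    by rewrite [sinh b * _]mulrC kE'; ring.
  by rewrite arcosh_cosh.
- by rewrite sub0r normrN ger0_norm.
- by rewrite distrC ger0_norm// subr_ge0.
- by rewrite distrC ger0_norm// subr_ge0.
Qed.

End Comparison.

(** * Thin triangles *)

Section ThinTriangles.
Context {R : realType} {X : metricType R}.
Implicit Types (o x y z p q r : X) (c : R -> X).
Hypothesis cat : cat_minus_one X.

Lemma gp_ge0 o p q : 0 <= gromov_product o p q.
Proof.
rewrite /gromov_product; have := metric_triangle p o q.
by rewrite (metric_sym p o); lra.
Qed.

Lemma gp_lel o p q : gromov_product o p q <= mdist o p.
Proof. by rewrite /gromov_product; have := metric_triangle o p q; lra. Qed.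

Lemma gpC o p q : gromov_product o p q = gromov_product o q p.
Proof. by rewrite /gromov_product (metric_sym p q) (addrC (mdist o p)). Qed.

Lemma gp_ler o p q : gromov_product o p q <= mdist o q.
Proof. by rewrite gpC gp_lel. Qed.

Lemma sinhB_le (a m : R) : 0 <= m -> sinh (a - m) <= sinh a * expR (- m).
Proof.
move=> m0; rewrite /sinh opprB !expRD !expRN.
have := expR_gt0 a; have : 1 <= expR m by rewrite -expR0 ler_expR.
move: (expR a) (expR m) => A M M1 A0.
have M0 : 0 < M by lra.
have -> : (A - A^-1) / 2 / M = (A / M - A^-1 / M) / 2 by field; rewrite !gt_eqF.
have : A^-1 / M <= M / A.
  rewrite [leRHS]mulrC ler_wpM2l ?invr_ge0 ?(ltW A0)//.
  by rewrite (le_trans _ M1)// invf_le1.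
by lra.
Qed.

(** With m the Gromov product, the angle of the comparison triangle at p satisfies
   1 - cos <= 2 exp (- 2 m), so that the distance d at time t satisfies
   cosh d <= 1 + exp (2 (t - m)) / 2, which is at most 3 / 2 for t <= m. *)
Lemma fellow_travel p q r c c' (t : R) :
  is_geodesic p q c -> is_geodesic p r c' ->
  0 <= t -> t <= gromov_product p q r -> mdist (c t) (c' t) <= 2.
Proof.
move=> gc gc' t0 tm.
have ta := le_trans tm (gp_lel p q r); have tb := le_trans tm (gp_ler p q r).
move: t0; rewrite le_eqVlt => /orP[/eqP <-|t0].
  by case: gc => -> _ _; case: gc' => -> _ _; rewrite mdistxx.
have a0 := lt_le_trans t0 ta; have b0 := lt_le_trans t0 tb.
have tA : 0 <= t <= mdist p q by rewrite ta ltW.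
have tB : 0 <= t <= mdist p r by rewrite tb ltW.
have := cat_cosine cat gc gc' a0 b0 tA tB erefl.
set d := mdist (c t) (c' t); set k := _ / _ => H.
set m := gromov_product p q r in tm.
have eE : mdist q r = mdist p q + mdist p r - m *+ 2.
  by rewrite /m /gromov_product mulr2n; lra.
have m0 : 0 <= m by apply: gp_ge0.
have sa0 : 0 < sinh (mdist p q) by rewrite sinh_gt0.
have sb0 : 0 < sinh (mdist p r) by rewrite sinh_gt0.
have k1 : 1 - k = 2 * (sinh (mdist p q - m) * sinh (mdist p r - m)) /
    (sinh (mdist p q) * sinh (mdist p r)).
  by rewrite -cosh_sub -eE coshB /k; field; rewrite !gt_eqF.
have k2 : 1 - k <= 2 * (expR (- m) * expR (- m)).
  rewrite k1 ler_pdivrMr; last by rewrite mulr_gt0.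
  have : sinh (mdist p q - m) * sinh (mdist p r - m) <=
      (sinh (mdist p q) * expR (- m)) * (sinh (mdist p r) * expR (- m)).
    by apply: ler_pM; rewrite ?sinhB_le// sinh_ge0 subr_ge0 ?gp_lel ?gp_ler.
  by lra.
have st : 0 <= sinh t <= expR m / 2.
  rewrite sinh_ge0 (ltW t0) /= /sinh.
  have : expR t <= expR m by rewrite ler_expR.
  by have := expR_gt0 (- t); lra.
have {}H : cosh d <= 1 + (sinh t * sinh t) * (1 - k).
  by apply: le_trans H _; rewrite -!expr2 cosh2; lra.
have {}H : cosh d <= 3 / 2.
  apply: le_trans H _.
  have E : expR m * expR (- m) = 1 by rewrite -expRD subrr expR0.
  have u0 : 0 <= sinh t * expR (- m) by rewrite mulr_ge0 ?expR_ge0//; case/andP: st.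
  have u1 : sinh t * expR (- m) <= 1 / 2.
    have : sinh t * expR (- m) <= expR m / 2 * expR (- m).
      by rewrite ler_wpM2r ?expR_ge0//; case/andP: st.
    by lra.
  have h : sinh t * sinh t * (1 - k) <= sinh t * sinh t * (2 * (expR (- m) * expR (- m))).
    by rewrite ler_wpM2l// -expr2 sqr_ge0.
  have : sinh t * sinh t * (2 * (expR (- m) * expR (- m))) =
     2 * ((sinh t * expR (- m)) * (sinh t * expR (- m))) by ring.
  move: (sinh t * expR (- m)) u0 u1 => u u0 u1; nra.
have : expR d <= 3 by move: H; rewrite /cosh; have := expR_gt0 (- d); lra.
by have := expR_ge1Dx d; lra.
Qed.

(** Gromov's inequality: at time m the three geodesics from o are pairwise close by
   fellow_travel, which shortcuts the way from p to r. *)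
Lemma four_point o p q r (m : R) :
  m <= gromov_product o p q -> m <= gromov_product o q r ->
  m - 2 <= gromov_product o p r.
Proof.
move=> h1 h2; case: (lerP 0 m) => m0; last by have := gp_ge0 o p r; lra.
have [cp gcp] := cat.1 o p; have [cq gcq] := cat.1 o q; have [cr gcr] := cat.1 o r.
have d1 := fellow_travel gcp gcq m0 h1; have d2 := fellow_travel gcq gcr m0 h2.
have mp : 0 <= m <= mdist o p by rewrite m0 (le_trans h1)// gp_lel.
have mr : 0 <= m <= mdist o r by rewrite m0 (le_trans h2)// gp_ler.
have e1 := geo_dist1 gcp mp; have e2 := geo_dist1 gcr mr.
have t1 := metric_triangle p (cp m) r; have t2 := metric_triangle (cp m) (cq m) r.
have t3 := metric_triangle (cq m) (cr m) r.
by move: t1; rewrite (metric_sym p (cp m)) /gromov_product; lra.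
Qed.

End ThinTriangles.

(** * Axes of hyperbolic isometries *)

Section Axes.
Context {R : realType} {X : metricType R}.
Implicit Types (x y z p q r : X) (c : R -> X).
Hypothesis cat : cat_minus_one X.

(** Compare the midpoints m and g m of [y, g y] and [g y, g (g y)]: in the
   hyperbolic plane, sinh (d (m, g m) / 2) <= sinh (e / 2) / (2 cosh (a / 2)),
   where a = d (y, g y) and e = d (y, g (g y)). *)
Lemma displacement_square (g : X -> X) (l : R) :
  (forall y z, mdist (g y) (g z) = mdist y z) -> 0 <= l ->
  (forall y, l <= mdist y (g y)) -> forall y, l * 2 <= mdist y (g (g y)).
Proof.
move=> giso l0 lg y; have := lg y; set a := mdist y (g y) => la.
have [a0|a0] := lerP a 0.
  by rewrite (_ : l = 0) ?mul0r ?mdist_ge0//; lra.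
have [c0 [c00 c01 c0d]] := cat.1 y (g y).
have gc : is_geodesic (g y) y (fun t => c0 (a - t)).
  split=> /=; [by rewrite subr0|by rewrite metric_sym subrr|].
  move=> s t; rewrite (metric_sym (g y)) -/a => sa ta.
  rewrite c0d -/a; [|lra|lra].
  by rewrite opprD opprK addrACA subrr add0r addrC distrC.
have gc' : is_geodesic (g y) (g (g y)) (fun t => g (c0 t)).
  split=> /=; [by rewrite c00|by rewrite giso c01|].
  by move=> s t; rewrite !giso -/a => sa ta; rewrite c0d.
have ag : mdist (g y) y = a by rewrite metric_sym.
have agg : mdist (g y) (g (g y)) = a by rewrite giso.
have a2 : 0 <= a / 2 <= a by lra.
have := cat_cosine cat gc gc' (s := a / 2) (t := a / 2).
rewrite ag agg => /(_ _ a0 a0 a2 a2 erefl).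
rewrite (_ : a - a / 2 = a / 2); last by field.
have := lg (c0 (a / 2)); set d := mdist _ (g (c0 _)); set e := mdist y _ => ld.
have d0 : 0 <= d by apply: mdist_ge0.
have e0 : 0 <= e by apply: mdist_ge0.
have ch2 (u : R) : cosh u = 1 + 2 * sinh (u / 2) ^+ 2.
  rewrite {1}(_ : u = u / 2 + u / 2); last by field.
  by rewrite coshD -!expr2 cosh2; ring.
have sa : 0 < sinh a by rewrite sinh_gt0.
have sa2 : 0 < sinh (a / 2) by rewrite sinh_gt0; lra.
have ca2 : 0 < cosh (a / 2) by have := cosh_ge1 (a / 2); lra.
have sd : 0 <= sinh (d / 2) by rewrite sinh_ge0; lra.
have se : 0 <= sinh (e / 2) by rewrite sinh_ge0; lra.
move=> H.
have {}H : 2 * sinh (d / 2) ^+ 2 <=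
    sinh (a / 2) ^+ 2 * (2 * sinh (e / 2) ^+ 2) / sinh a ^+ 2.
  have E : sinh (a / 2) ^+ 2 * (2 * sinh (e / 2) ^+ 2) / sinh a ^+ 2 =
    cosh (a / 2) * cosh (a / 2) - sinh (a / 2) * sinh (a / 2) *
      ((cosh a * cosh a - cosh e) / (sinh a * sinh a)) - 1.
    rewrite -!expr2 !cosh2 (ch2 e); field.
    by rewrite gt_eqF.
  by rewrite E; move: H; rewrite (ch2 d); lra.
have {}H : (2 * (cosh (a / 2) * sinh (d / 2))) ^+ 2 <= sinh (e / 2) ^+ 2.
  rewrite (sinh_double a) in H.
  have E : sinh (a / 2) ^+ 2 * (2 * sinh (e / 2) ^+ 2) /
      (2 * (sinh (a / 2) * cosh (a / 2))) ^+ 2 =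
      sinh (e / 2) ^+ 2 / (2 * cosh (a / 2) ^+ 2).
    by field; rewrite !gt_eqF.
  rewrite E ler_pdivlMr in H; last by rewrite mulr_gt0// exprn_gt0.
  by apply: le_trans H; rewrite le_eqVlt; apply/orP; left; apply/eqP; ring.
have {}H : 2 * (cosh (a / 2) * sinh (d / 2)) <= sinh (e / 2).
  by move: H; rewrite ler_sqr ?nnegrE//; nra.
suff : l <= e / 2 by lra.
rewrite -sinh_mono; apply: le_trans H.
rewrite sinh_double ler_pM2l// mulrC ler_pM//.
- by have := cosh_ge1 (l / 2); lra.
- by rewrite sinh_ge0; lra.
- by apply: cosh_le; lra.
- by rewrite sinh_mono; lra.
Qed.

(** Only powers of two are reached by squaring, which is enough to exclude
   shortcuts along the axis. *)
Lemma displacement_iter (g : X -> X) (l : R) k :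
  (forall y z, mdist (g y) (g z) = mdist y z) -> 0 <= l ->
  (forall y, l <= mdist y (g y)) ->
  forall y, (2 ^ k)%:R * l <= mdist y (iter (2 ^ k) g y).
Proof.
elim: k g l => [|k IH] g l giso l0 lg y; first by rewrite expn0 mul1r.
have -> : (2 ^ k.+1)%:R * l = (2 ^ k)%:R * (l * 2) :> R.
  by rewrite expnSr natrM; ring.
rewrite expnSr iterM; apply: (IH (fun z => iter 2 g z)) => /=.
- by move=> u v; rewrite !giso.
- by rewrite mulr_ge0.
- exact: displacement_square.
Qed.

Section Axis.
Variables (G : groupType) (act : G -> X -> X) (x : X) (g : G).
Hypothesis act_isom : isometry_group act.

Let actM a b z : act (a * b)%g z = act a (act b z).
Proof. by case: act_isom => -[_ ->]. Qed.

Let act1 z : act 1%g z = z.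
Proof. by case: act_isom => -[]. Qed.

Let actd a y z : mdist (act a y) (act a z) = mdist y z.
Proof. by case: act_isom. Qed.

(** The n-th power of g, for n an integer. *)
Definition zact (n : int) (z : X) : X :=
  match n with
  | Posz m => iter m (act g) z
  | Negz m => iter m.+1 (act g^-1%g) z
  end.

Lemma zactS n z : act g (zact n z) = zact (n + 1) z.
Proof.
case: n => [m|[|m]] /=; first by rewrite addn1.
- by rewrite -actM mulgV act1.
- by rewrite -actM mulgV act1 /= subn1.
Qed.

Lemma zactSr n z : zact n (act g z) = zact (n + 1) z.
Proof.
case: n => m; first by rewrite /= -iterSr addn1.
rewrite [LHS]/= -iterS iterSr -actM mulVg act1.
by case: m => //= m; rewrite subn1.
Qed.

Lemma zact_dist n y z : mdist (zact n y) (zact n z) = mdist y z.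
Proof.
have it a m : mdist (iter m (act a) y) (iter m (act a) z) = mdist y z.
  by elim: m => //= m IH; rewrite actd.
by case: n => m; rewrite /zact it.
Qed.

(** Translating the segment [z, g z] by the powers of g gives a line: by
   displacement_iter the points z and g^n z are n l apart when n is a power of
   two, which leaves no room for a shortcut in between. *)
Lemma axis_nonempty : hyperbolic (act g) -> exists y, axis (act g) y.
Proof.
move=> [l0 [z zl]]; set l := displacement (act g) in l0 zl.
have lg y : l <= mdist y (act g y).
  apply: ge_inf; first by exists 0 => _ [w _ <-]; rewrite mdist_ge0.
  by exists y.
have [c0 [c00 c01 c0d]] := cat.1 z (act g z); rewrite zl in c01 c0d.
pose fl (t : R) : int := Num.floor (t / l).
have flP t : (fl t)%:~R * l <= t < ((fl t)%:~R + 1) * l.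
  have := floor_itv (t / l); rewrite intrD => /andP[h1 h2].
  by rewrite -ler_pdivlMr// h1 -ltr_pdivrMr.
have flu (t : R) (n : int) : n%:~R * l <= t < (n%:~R + 1) * l -> fl t = n.
  move=> /andP[h1 h2]; apply: floor_def.
  by rewrite ler_pdivlMr// h1 /= intrD ltr_pdivrMr.
pose c t := zact (fl t) (c0 (t - (fl t)%:~R * l)).
have flS t : fl (t + l) = fl t + 1.
  by apply: flu; rewrite intrD; have := flP t; lra.
have cS t : act g (c t) = c (t + l).
  rewrite /c zactS flS; congr (zact _ (c0 _)).
  by rewrite intrD; ring.
have cSn t n : iter n (act g) (c t) = c (t + n%:R * l).
  elim: n => [|n IH]; first by rewrite mul0r addr0.
  by rewrite iterS IH cS -natr1; congr (c _); ring.
have itd n y w : mdist (iter n (act g) y) (iter n (act g) w) = mdist y w.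
  by elim: n => //= n IH; rewrite actd.
pose zn n := zact n z.
have znS n : zn (n + 1) = zact n (act g z).
  by rewrite /zn zactSr.
have zd (n : int) k : mdist (zn n) (zn (n + k%:Z)) <= k%:R * l.
  elim: k => [|k IH]; first by rewrite addr0 mdistxx mul0r.
  apply: le_trans (metric_triangle _ (zn (n + k%:Z)) _) _.
  rewrite -natr1 mulrDl mul1r lerD// intS [1 + _]addrC addrA znS.
  by rewrite zact_dist zl.
have cz1 t : mdist (zn (fl t)) (c t) = t - (fl t)%:~R * l.
  rewrite /zn zact_dist -c00 c0d ?sub0r ?normrN; have := flP t; try lra.
  by move=> ?; rewrite ger0_norm; lra.
have cz2 t : mdist (c t) (zn (fl t + 1)) = ((fl t)%:~R + 1) * l - t.
  rewrite znS zact_dist -c01 c0d; have := flP t; try lra.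
  by move=> ?; rewrite distrC ger0_norm; lra.
have up s t : s <= t -> mdist (c s) (c t) <= t - s.
  move=> st; have [e|ne] := eqVneq (fl s) (fl t).
    rewrite /c e zact_dist c0d; have := flP t; have := flP s; rewrite e; try lra.
    by move=> ? ?; rewrite distrC ger0_norm; lra.
  have le : fl s + 1 <= fl t.
    rewrite lezD1 lt_neqAle ne /=; apply: le_floor.
    by rewrite ler_pM2r// invr_gt0.
  have [k ek] : exists k : nat, fl t = (fl s + 1) + k%:Z.
    exists (absz (fl t - (fl s + 1))%R); rewrite gez0_abs ?subr_ge0//.
    by rewrite addrC subrK.
  have := zd (fl s + 1) k; rewrite -ek => zdk.
  have := metric_triangle (c s) (zn (fl s + 1)) (c t).
  have := metric_triangle (zn (fl s + 1)) (zn (fl t)) (c t).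
  have ekr : (fl t)%:~R = (fl s)%:~R + 1 + k%:R :> R by rewrite ek !intrD.
  by rewrite cz1 cz2 ekr; lra.
(* On [0, 2^k l] the broken line is as long as the distance of its ends. *)
have low s t : 0 <= s -> s <= t -> t - s <= mdist (c s) (c t).
  move=> s0 st.
  have [k kt] : exists k, t <= (2 ^ k)%:R * l.
    exists (Num.truncn (t / l)).+1.
    rewrite -ler_pdivrMr//.
    apply: le_trans (ltW (truncnS_gt _)) _; rewrite ler_nat.
    exact/ltnW/ltn_expl.
  set N := (2 ^ k)%N in kt.
  have e0 : c 0 = z by rewrite /c (_ : fl 0 = 0) /= ?mul0r ?subr0// /fl mul0r floor0.
  have := displacement_iter k (fun y w => actd g y w) (ltW l0) lg z.
  rewrite -/N -{1}e0 -{1}e0 cSn add0r => H.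
  have h1 := up 0 s s0; have h2 := up t _ kt.
  have h3 := metric_triangle (c 0) (c s) (c (N%:R * l)).
  have h4 := metric_triangle (c s) (c t) (c (N%:R * l)).
  lra.
(* Negative parameters are shifted to positive ones by a power of g. *)
have cd s t : s <= t -> mdist (c s) (c t) = t - s.
  move=> st; apply/eqP; rewrite eq_le up//=.
  pose n := (Num.truncn (`|s| / l)).+1.
  have sn : 0 <= s + n%:R * l.
    have : `|s| <= n%:R * l by rewrite -ler_pdivrMr// ltW// truncnS_gt.
    by have := ler_norm (- s); rewrite normrN; lra.
  rewrite -(itd n) !cSn.
  have := low (s + n%:R * l) (t + n%:R * l) sn; rewrite lerD2r => /(_ st).
  by lra.
exists (c 0); exists c; last by exists 0.
split=> // s t; case/orP: (le_total s t) => st.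
  by rewrite cd// distrC ger0_norm// subr_ge0.
by rewrite metric_sym cd// ger0_norm// subr_ge0.
Qed.

Lemma axis_length_ge : hyperbolic (act g) -> mdist x (act g x) <= axis_length x (act g).
Proof.
move=> hg; have [l0 _] := hg; have [y0 ay0] := axis_nonempty hg.
rewrite /axis_length /dist_to; set l := displacement _ in l0 *.
suff : (mdist x (act g x) - l) / 2 <= inf [set mdist x y | y in axis (act g)] by lra.
apply: lb_le_inf; first by exists (mdist x y0), y0.
move=> _ [y [c [cd cg] [t ->]] <-].
have h1 := metric_triangle x (c t) (act g x).
have h2 := metric_triangle (c t) (act g (c t)) (act g x).
have : mdist (c t) (act g (c t)) = l.
  by rewrite cg cd opprD addrA subrr sub0r normrN gtr0_norm.
move: h2; rewrite actd (metric_sym (c t) x) -/l; lra.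
Qed.

Lemma axis_length_gt0 : hyperbolic (act g) -> 0 < axis_length x (act g).
Proof.
move=> hg; have [l0 _] := hg; have [y0 ay0] := axis_nonempty hg.
rewrite /axis_length ltr_pwDl// mulr_ge0//.
apply: lb_le_inf; first by exists (mdist x y0), y0.
by move=> _ [y _ <-]; exact: mdist_ge0.
Qed.

End Axis.
End Axes.

(** * Finite partial sums *)

Section PartialSums.
Context {R : realType} {I : choiceType}.
Implicit Types (S : set I) (f : I -> R) (r : seq I).

Lemma esum_ub S f (B : R) :
  (forall r, uniq r -> (forall i, i \in r -> S i) -> \sum_(i <- r) f i <= B) ->
  (\esum_(i in S) (f i)%:E <= B%:E)%E.
Proof.
move=> H; apply: ge_ereal_sup => _ [F [finF FS] <-].
rewrite fsbig_finite// sumEFin lee_fin; apply: H => // i.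
by rewrite in_fset_set// inE => /FS.
Qed.

Lemma esum_lb S f r : uniq r -> (forall i, i \in r -> S i) ->
  ((\sum_(i <- r) f i)%:E <= \esum_(i in S) (f i)%:E)%E.
Proof.
move=> ur rS; apply: esum_ge; exists [set` r].
  by split; [exact: finite_seq|move=> i /=; exact: rS].
by rewrite -fsbig_seq// sumEFin.
Qed.

End PartialSums.

(** * Normal forms in Bass-Serre trees *)

Section TreePaths.
Variable Y : graph.
Hypothesis Y_tree : is_tree Y.
Implicit Types (u v w : vert Y) (e f : edge Y) (p q : seq (edge Y)).

Definition rev_path p : seq (edge Y) := rev (map (@ebar Y) p).

Lemma edge_path_cat u v w p q :
  edge_path u p v -> edge_path v q w -> edge_path u (p ++ q) w.
Proof. by elim: p u => [u <-//|e p IH u /= [<- /IH h] /h]. Qed.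

Lemma edge_path_rev u v p : edge_path u p v -> edge_path v (rev_path p) u.
Proof.
elim: p u => [u <-//|e p IH u /= [<- /IH h]].
rewrite /rev_path /= rev_cons -cats1; apply: edge_path_cat h _.
by split => //=; rewrite /term ?ebarK.
Qed.

Lemma reduced_cat e p f q : reduced (rcons p e) -> reduced (f :: q) ->
  f <> ebar e -> reduced (rcons p e ++ f :: q).
Proof.
elim: p => [|a p IH] //= [h1 h2] h3 h4.
by split; [case: (p) h1|apply: IH].
Qed.

Lemma reduced_rev p : reduced p -> reduced (rev_path p).
Proof.
elim: p => [|e p IH] // [h1 h2].
rewrite /rev_path /= rev_cons; move: h1 (IH h2) => {IH h2}.
case: p => [|f p] // h1 h2.
rewrite -cats1 /= rev_cons; apply: reduced_cat => //; first by rewrite -rev_cons.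
by rewrite ebarK => h; apply: h1.
Qed.

(** Otherwise, after their common beginning, the first path run backwards and
   then the second one would form a reduced closed path. *)
Lemma reduced_path_unique u w p q : edge_path u p w -> edge_path u q w ->
  reduced p -> reduced q -> p = q.
Proof.
have [_ _ H] := Y_tree.
elim: p u q => [u q /= <- hq _ rq|e p IH u q hp hq rp rq].
  by rewrite (H _ _ hq rq).
case: q hq rq => [|f q] hq rq.
  by rewrite -hq in hp; have := H _ _ hp rp.
have [ef|nef] := pselect (e = f).
  subst f; congr cons; move: hp hq rp rq => [_ hp] [_ hq] [_ rp] [_ rq].
  exact: IH hp hq rp rq.
have rE : rev_path (e :: p) = rcons (rev_path p) (ebar e).
  by rewrite /rev_path /= rev_cons.
suff /(congr1 size) : rev_path (e :: p) ++ f :: q = [::] by rewrite size_cat addnS.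
apply: (H w); first exact: edge_path_cat (edge_path_rev hp) hq.
rewrite rE; apply: reduced_cat => //; first by rewrite -rE; exact: reduced_rev.
by rewrite ebarK => h; apply: nef.
Qed.

End TreePaths.

Section NormalForm.
Context {G : groupType} {T : gtree G} {Y : finite_quotient T} (D : lifts Y).
Implicit Types (e f : qedge Y) (c : set G) (l : seq (qedge Y * set G)).

(** The element rep e f c stands for the transition (e, f, c): it is a product
   k tau f with k in the coset c. *)
Variable rep : qedge Y -> qedge Y -> set G -> G.

Definition transition e f c : Prop :=
  allowed D e f c /\ c (rep e f c * (tau D f)^-1)%g.

Fixpoint chain e l : Prop :=
  if l is (f, c) :: l' then transition e f c /\ chain f l' else True.

Fixpoint chain_end e l : qedge Y := if l is (f, _) :: l' then chain_end f l' else e.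

Fixpoint chain_prod e l : G :=
  if l is (f, c) :: l' then (rep e f c * chain_prod f l')%g else 1%g.

Fixpoint chain_path (g : G) e l : seq (edge T) :=
  if l is (f, c) :: l' then
    eact (g * (rep e f c * (tau D f)^-1))%g (elift D f)
      :: chain_path (g * rep e f c)%g f l'
  else [::].

Lemma vactM (g h : G) (v : vert T) : vact (g * h)%g v = vact g (vact h v).
Proof. by have [_ ->] := vactP T. Qed.

Lemma eactM (g h : G) (e : edge T) : eact (g * h)%g e = eact g (eact h e).
Proof. by have [_ ->] := eactP T. Qed.

Lemma eact1 (e : edge T) : eact 1%g e = e.
Proof. by have [->] := eactP T. Qed.

Lemma eactI (g : G) : injective (@eact G T g).
Proof. by move=> e e' h; rewrite -(eact1 e) -(mulVg g) eactM h -eactM mulVg eact1. Qed.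

Lemma egroup_sub f g : egroup D f g -> vgroup D (qorig f) g.
Proof.
by rewrite /egroup /vgroup /stabilizer /= => h; rewrite -orig_elift -orig_act h.
Qed.

Lemma coset_vgroup f c k : edge_coset D f c -> c k -> vgroup D (qorig f) k.
Proof.
move=> [r hr ->] [h hh <-]; have := egroup_sub hh; move: hr.
by rewrite /vgroup /stabilizer /= => hr hh'; rewrite vactM hh' hr.
Qed.

Lemma coset_eq f c k : edge_coset D f c -> c k -> c = left_coset k (egroup D f).
Proof.
move=> [r hr ->] [h hh <-]; rewrite /egroup /stabilizer /= in hh *.
apply/seteqP; split=> _ [h' hh' <-]; rewrite /stabilizer /= in hh'.
  exists (h^-1 * h')%g; last by rewrite mulgA mulgK.
  by rewrite /stabilizer /= eactM hh'; apply: (@eactI h); rewrite -eactM mulgV eact1 hh.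
by exists (h * h')%g; rewrite ?mulgA// /stabilizer /= eactM hh' hh.
Qed.

Lemma chain_edge_path g e l : chain e l ->
  edge_path (vact g (vlift D (qterm e))) (chain_path g e l)
    (vact (g * chain_prod e l)%g (vlift D (qterm (chain_end e l)))).
Proof.
elim: l g e => [|[f c] l IH] g e /=; first by rewrite mulg1.
move=> [[[ef cc _] ck] hl]; split.
  rewrite orig_act orig_elift vactM -ef; congr (vact _ _).
  by have := coset_vgroup cc ck; rewrite -ef.
rewrite /term ebar_act orig_act -/(term (elift D f)) term_elift -vactM.
by rewrite -!mulgA mulVg mulg1 mulgA; exact: IH.
Qed.

Lemma pedge_act (g : G) (e : edge T) : pedge Y (eact g e) = pedge Y e.
Proof. by apply/esym/pedge_orbit; exists g. Qed.

(** The path could only fold back at a transition from f to its reverse with the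
   trivial coset, which is not allowed. *)
Lemma chain_reduced g e l : chain e l -> reduced (chain_path g e l).
Proof.
elim: l g e => [//|[f c] l IH] g e [[_ ck] hl]; split; last exact: IH hl.
case: l hl {IH} => [//|[f' c'] l] [[[ff' cc' nb] ck'] _] /=.
rewrite ebar_act; set k := (rep e f c * _)%g in ck *; set k' := (rep f f' c' * _)%g in ck' *.
have -> : (g * rep e f c)%g = (g * k * tau D f)%g.
  by rewrite /k -!mulgA mulVg mulg1.
clearbody k k'; rewrite -mulgA !eactM => /eactI/eactI h.
have {}h : eact k' (elift D f') = elift D (qbar f).
  by rewrite elift_bar -h -(eactM (tau D f)^-1%g) mulVg eact1.
have e1 : f' = qbar f by have := congr1 (@pedge _ _ Y) h; rewrite pedge_act !eliftK.
subst f'; apply: (nb erefl); rewrite (coset_eq cc' ck').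
apply/seteqP; split => [_ [j hj <-]|j hj]; rewrite /egroup /stabilizer /= in hj *.
  by rewrite eactM hj.
exists (k'^-1 * j)%g; last by rewrite mulgA mulgV mul1g.
by rewrite /egroup /stabilizer /= eactM hj -{1}h -eactM mulVg eact1.
Qed.

Lemma chain_path_inj g e l l' : chain e l -> chain e l' ->
  chain_path g e l = chain_path g e l' -> l = l'.
Proof.
elim: l g e l' => [|[f c] l IH] g e [|[f' c'] l'] //= [[[ef cc _] ck] hl].
move=> [[[ef' cc' _] ck'] hl'] [].
rewrite !eactM => /eactI; rewrite -!eactM => h.
have e1 : f' = f by have := congr1 (@pedge _ _ Y) h; rewrite !pedge_act !eliftK.
subst f'.
have -> : c' = c.
  rewrite (coset_eq cc ck) (coset_eq cc' ck'); move: h.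
  move: (rep e f c * _)%g (rep e f c' * _)%g => k k' h.
  suff E (a b : G) : eact a (elift D f) = eact b (elift D f) ->
      left_coset a (egroup D f) `<=` left_coset b (egroup D f).
    by apply/seteqP; split; apply: E.
  move=> ab _ [j hj <-]; exists (b^-1 * (a * j))%g; last first.
    by rewrite mulgA mulgV mul1g.
  rewrite /egroup /stabilizer /= in hj *.
  by rewrite !eactM hj ab -eactM mulVg eact1.
by move=> /(IH _ _ _ hl hl') ->.
Qed.

(** Chains from e with the same end and the same product give reduced paths with
   the same endpoints. *)
Lemma chain_prod_inj e l l' : chain e l -> chain e l' ->
  chain_end e l = chain_end e l' -> chain_prod e l = chain_prod e l' -> l = l'.
Proof.
move=> hl hl' ee pp; apply: (@chain_path_inj 1%g e) => //.
have := chain_edge_path 1%g hl; rewrite ee pp => h.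
exact: (reduced_path_unique (tgraph_tree T) h (chain_edge_path 1%g hl')
  (chain_reduced 1%g hl) (chain_reduced 1%g hl')).
Qed.

End NormalForm.

(** * Path sums of nonnegative matrices *)

Section PathSums.
Context {R : realType} {I : finType}.
Implicit Types (a b : I -> I -> R) (e f k : I).

(** The entries of the n-th power of the matrix a. *)
Fixpoint pathsum a n e f : R :=
  if n is n'.+1 then \sum_k a e k * pathsum a n' k f else (e == f)%:R.

Definition nonneg a : Prop := forall e f, 0 <= a e f.

Lemma pathsum_ge0 a n e f : nonneg a -> 0 <= pathsum a n e f.
Proof.
move=> a0; elim: n e => [|n IH] e /=; first exact: ler0n.
by apply: sumr_ge0 => k _; rewrite mulr_ge0.
Qed.

Lemma pathsumD a m n e f :
  pathsum a (m + n) e f = \sum_k pathsum a m e k * pathsum a n k f.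
Proof.
elim: m e => [|m IH] e /=.
  rewrite (bigD1 e)//= eqxx mul1r big1 ?addr0// => k ke.
  by rewrite eq_sym (negbTE ke) mul0r.
under eq_bigr => k _ do rewrite IH mulr_sumr.
rewrite exchange_big /=; apply: eq_bigr => k _; rewrite mulr_suml.
by apply: eq_bigr => j _; rewrite mulrA.
Qed.

Lemma pathsum_concat a m n e k f : nonneg a ->
  pathsum a m e k * pathsum a n k f <= pathsum a (m + n) e f.
Proof.
move=> a0; rewrite pathsumD (bigD1 k)//= lerDl.
by apply: sumr_ge0 => j _; rewrite mulr_ge0// pathsum_ge0.
Qed.

Lemma pathsum1 a e f : pathsum a 1 e f = a e f.
Proof.
rewrite /= (bigD1 f)//= eqxx mulr1 big1 ?addr0// => k kf.
by rewrite (negbTE kf) mulr0.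
Qed.

Lemma pathsumSr a n e f : pathsum a n.+1 e f = \sum_k pathsum a n e k * a k f.
Proof. by rewrite -addn1 pathsumD; apply: eq_bigr => k _; rewrite pathsum1. Qed.

Lemma le_pathsum a b n e f : nonneg a -> (forall e f, a e f <= b e f) ->
  pathsum a n e f <= pathsum b n e f.
Proof.
move=> a0 ab; elim: n e => //= n IH e; apply: ler_sum => k _.
by rewrite ler_pM// pathsum_ge0.
Qed.

Lemma pathsumZ (t : R) a n e f :
  pathsum (fun e f => t * a e f) n e f = t ^+ n * pathsum a n e f.
Proof.
elim: n e => [|n IH] e /=; first by rewrite mul1r.
rewrite mulr_sumr; apply: eq_bigr => k _; rewrite IH exprS; ring.
Qed.

(** By Bernoulli's inequality. *)
Lemma expr_bounded (q B : R) : 0 <= q -> (forall n, q ^+ n <= B) -> q <= 1.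
Proof.
move=> q0 H; case: (lerP q 1) => // q1; exfalso.
have bern n : 1 + n%:R * (q - 1) <= q ^+ n.
  elim: n => [|n IH]; first by rewrite mul0r addr0.
  rewrite exprS -natr1.
  have : q * (1 + n%:R * (q - 1)) <= q * q ^+ n by rewrite ler_wpM2l.
  have : 0 <= n%:R * ((q - 1) * (q - 1)) by rewrite mulr_ge0// -expr2 sqr_ge0.
  by lra.
have := bern (Num.truncn (B / (q - 1))).+1; have := H (Num.truncn (B / (q - 1))).+1.
have : B < (Num.truncn (B / (q - 1))).+1%:R * (q - 1).
  by rewrite -ltr_pdivrMr ?subr_gt0// truncnS_gt.
by lra.
Qed.

(** Repeating a closed walk k times shows that the k-th power of this entry is
   bounded by B. *)
Lemma pathsum_diag a e (B : R) n : nonneg a ->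
  (forall n, pathsum a n e e <= B) -> pathsum a n e e <= 1.
Proof.
move=> a0 H; apply: (@expr_bounded _ B) => [|k]; first exact: pathsum_ge0.
apply: le_trans (H (k * n)%N); elim: k => [|k IH]; first by rewrite /= eqxx.
rewrite exprS mulSn; apply: le_trans (pathsum_concat n (k * n) e e e a0).
by rewrite ler_wpM2l// pathsum_ge0.
Qed.

(** A diagonal entry above 1 would remain above 1 after multiplying a by a factor
   t close to 1, which changes it by t ^+ n. *)
Lemma pathsum_approx a e n : nonneg a ->
  (forall t, 0 < t < 1 -> exists b,
     (forall e f, t * a e f <= b e f) /\ pathsum b n e e <= 1) ->
  pathsum a n e e <= 1.
Proof.
move=> a0 H; case: (lerP (pathsum a n e e) 1) => // q1; exfalso.
set q := pathsum a n e e in q1.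
have Ht t : 0 < t < 1 -> t ^+ n * q <= 1.
  move=> t01; have [b [ab b1]] := H _ t01; have [t0 t1] := andP t01.
  rewrite -pathsumZ; apply: le_trans b1; apply: le_pathsum => // e' f'.
  by rewrite mulr_ge0// ltW.
have q0 : 0 < q by lra.
case: n @q q1 Ht q0 {H} => [|n] q q1 Ht q0.
  by have := Ht (1 / 2) ltac:(lra); rewrite expr0; lra.
(* Here t ^+ n >= (1 + q^-1) / 2 by Bernoulli's inequality, so t ^+ n * q > 1. *)
pose d := (1 - q^-1) / (2 * n.+1%:R); pose t := 1 - d.
have n1 : 0 < 2 * n.+1%:R :> R by rewrite mulr_gt0// ltr0Sn.
have qi : 0 < q^-1 < 1 by rewrite invr_gt0 q0 invf_lt1.
have d0 : 0 < d by rewrite divr_gt0//; lra.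
have d1 : d < 1.
  rewrite /d ltr_pdivrMr// mul1r.
  have : 1 <= n.+1%:R :> R by rewrite ler1n.
  by lra.
have t01 : 0 < t < 1 by rewrite /t; move: (d) d0 d1 => *; lra.
have [t0 t1] := andP t01.
have bern m : 1 - m%:R * (1 - t) <= t ^+ m.
  elim: m => [|m IH]; first by rewrite mul0r subr0.
  rewrite exprS -natr1.
  have : t * (1 - m%:R * (1 - t)) <= t * t ^+ m by rewrite ler_wpM2l// ltW.
  have : 0 <= m%:R * ((1 - t) * (1 - t)) by rewrite mulr_ge0// -expr2 sqr_ge0.
  by lra.
have := Ht t t01; have := bern n.+1.
have -> : n.+1%:R * (1 - t) = (1 - q^-1) / 2.
  have : n.+1%:R != 0 :> R by rewrite pnatr_eq0.
  by rewrite /t /d; move: (n.+1%:R : R) => N N0; field; rewrite N0 gt_eqF.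
rewrite -ler_pdivlMr// mul1r => h1 h2; lra.
Qed.

End PathSums.

Section Eigenvalues.
Context {R : realType}.
Local Notation normc := ComplexField.Normc.normc.

Lemma normc_ge0 (z : R[i]) : 0 <= normc z.
Proof. by case: z => u v; exact: sqrtr_ge0. Qed.

Lemma normc_sum (I : finType) (F : I -> R[i]) : normc (\sum_i F i) <= \sum_i normc (F i).
Proof.
elim/big_ind2 : _ => //; first by rewrite ComplexField.Normc.normc0.
by move=> u x v y h1 h2; apply: le_trans (le_normcD _ _) _; exact: lerD.
Qed.

Lemma normc_real (u : R) : 0 <= u -> normc (real_complex R u) = u.
Proof. by move=> u0; rewrite /= expr0n /= addr0 sqrtr_sqr ger0_norm. Qed.

(** The absolute values w of the entries of a left eigenvector satisfy
   |l| w <= w M, hence |l| ^+ m w <= w M ^+ m for all m. *)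
Lemma eigenvalue_le1 n (M : 'M[R]_n) (B : R) (l : R[i]) :
  nonneg M -> (forall m i j, pathsum M m i j <= B) ->
  eigenvalue (map_mx (real_complex R) M) l -> normc l <= 1.
Proof.
move=> M0 MB /eigenvalueP[v vM v0].
pose w i := normc (v 0 i).
have w0 i : 0 <= w i by exact: normc_ge0.
have step j : normc l * w j <= \sum_i w i * M i j.
  have /(congr1 (fun u : 'rV[R[i]]_n => normc (u 0 j))) := vM.
  rewrite !mxE ComplexField.Normc.normcM => <-.
  apply: le_trans (normc_sum _) _; apply: ler_sum => i _.
  by rewrite mxE ComplexField.Normc.normcM normc_real.
have iter m j : normc l ^+ m * w j <= \sum_i w i * pathsum M m i j.
  elim: m j => [|m IH] j.
    rewrite expr0 mul1r (bigD1 j)//= eqxx mulr1 lerDl.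
    by apply: sumr_ge0 => i _; rewrite mulr_ge0.
  rewrite exprSr -mulrA.
  apply: le_trans (ler_wpM2l (exprn_ge0 m (normc_ge0 l)) (step j)) _.
  rewrite mulr_sumr.
  apply: (@le_trans _ _ (\sum_i (\sum_k w k * pathsum M m k i) * M i j)).
    by apply: ler_sum => i _; rewrite mulrA ler_wpM2r.
  under eq_bigr do rewrite mulr_suml.
  rewrite exchange_big le_eqVlt; apply/orP; left; apply/eqP.
  apply: eq_bigr => k _; rewrite pathsumSr mulr_sumr.
  by apply: eq_bigr => i _; rewrite mulrA.
have [j vj] : exists j, v 0 j != 0.
  apply/existsP; move: v0; apply: contraR; rewrite negb_exists => /forallP h.
  by apply/eqP/rowP => j; rewrite mxE; apply/eqP; have := h j; rewrite negbK.
have wj : 0 < w j.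
  rewrite lt_neqAle w0 andbT eq_sym; apply: contra vj => /eqP/ComplexField.Normc.eq0_normc ->.
  by [].
apply: (@expr_bounded _ _ ((\sum_i w i * B) / w j)) => [|m]; first exact: normc_ge0.
rewrite ler_pdivlMr//; apply: le_trans (iter m j) _.
by apply: ler_sum => i _; rewrite ler_wpM2l.
Qed.

Lemma spectral_radius_le n (M : 'M[R]_n) (q : R) : 0 <= q ->
  (forall l, eigenvalue (map_mx (real_complex R) M) l -> normc l <= q) ->
  spectral_radius M <= q.
Proof.
move=> q0 H; rewrite /spectral_radius; set S := [set _ | _ in _].
have [->|/set0P S0] := eqVneq S set0; first by rewrite sup0.
by apply: ge_sup => // _ [l hl <-]; exact: H.
Qed.

Lemma pathsum_enum (I : finType) (C : {set I}) (a : I -> I -> R) m (i j : 'I_#|C|) :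
  nonneg a ->
  pathsum (fun i j => a (enum_val i) (enum_val j)) m i j <=
  pathsum a m (enum_val i) (enum_val j).
Proof.
move=> a0; elim: m i => [|m IH] i /=; first by rewrite (inj_eq enum_val_inj).
rewrite (bigID (mem C))/= [X in _ <= X + _](_ : _ =
  \sum_(k < #|C|) a (enum_val i) (enum_val k) * pathsum a m (enum_val k) (enum_val j)).
  rewrite -[leLHS]addr0 lerD//.
    by apply: ler_sum => k _; rewrite ler_wpM2l.
  by apply: sumr_ge0 => k _; rewrite mulr_ge0// pathsum_ge0.
by rewrite [LHS]big_enum_val.
Qed.

End Eigenvalues.

(** * Counting words by the orbit length *)

Section Words.
Context {R : realType} {G : groupType} {T : gtree G} {Y : finite_quotient T}.
Variables (D : lifts Y) (len : G -> R).
Hypothesis len1 : len 1%g = 0.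
Hypothesis lenM : forall g h, len (g * h)%g <= len g + len h.
Implicit Types (e f : qedge Y) (c : set G) (w : seq (qedge Y * set G)).

Variables (rep : qedge Y -> qedge Y -> set G -> G)
          (ell : qedge Y -> qedge Y -> set G -> R)
          (Phi : qedge Y -> qedge Y -> seq (set G)).
Hypothesis Phi_uniq : forall e f, uniq (Phi e f).
Hypothesis Phi_trans : forall e f c, c \in Phi e f -> transition D rep e f c.
Hypothesis Phi_len : forall e f c, c \in Phi e f -> len (rep e f c) <= ell e f c.

Fixpoint words n e f : seq (seq (qedge Y * set G)) :=
  if n is n'.+1 then
    flatten [seq [seq (k, c) :: w | c <- Phi e k, w <- words n' k f] | k <- enum (qedge Y)]
  else if e == f then [:: [::]] else [::].

Fixpoint weight (s : R) e w : R :=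
  if w is (k, c) :: w' then expR (- s * ell e k c) * weight s k w' else 1.

Lemma mem_words n e f k c w :
  ((k, c) :: w \in words n.+1 e f) = (c \in Phi e k) && (w \in words n k f).
Proof.
apply/flatten_mapP/andP => [[k' _ /allpairsP[[c' w'] /= [hc hw [-> -> ->]]]]//|[hc hw]].
by exists k; [rewrite mem_enum|apply/allpairsP; exists (c, w)].
Qed.

Lemma words_nil n e f : [::] \notin words n.+1 e f.
Proof. by apply/flatten_mapP => -[k _ /allpairsP[[c w] /= [_ _]]]. Qed.

Lemma words_uniq n e f : uniq (words n e f).
Proof.
elim: n e => [|n IH] e /=; first by case: eqP.
elim: (enum (qedge Y)) (enum_uniq (qedge Y)) => //= k s IHs /andP[ks us].
rewrite cat_uniq IHs// andbT; apply/andP; split.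
  by apply: allpairs_uniq => // -[c w] [c' w'] _ _ /= [-> ->].
apply/hasPn => w /flatten_mapP[k' k's /allpairsP[[c' w'] /= [_ _ ->]]].
apply/negP => /allpairsP[[c'' w''] /= [_ _ [kk _ _]]].
by move: ks; rewrite -kk k's.
Qed.

Lemma words_chain n e f w : w \in words n e f -> chain D rep e w /\ chain_end e w = f.
Proof.
elim: n e w => [|n IH] e w; first by rewrite /=; case: eqP => // ->; rewrite inE => /eqP ->.
case: w => [|[k c] w]; first by rewrite (negbTE (words_nil _ _ _)).
by rewrite mem_words => /andP[/Phi_trans hc /IH[hw hf]].
Qed.

Lemma pathsum_words s n e f :
  pathsum (fun e f => \sum_(c <- Phi e f) expR (- s * ell e f c)) n e f =
  \sum_(w <- words n e f) weight s e w.
Proof.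
elim: n e => [|n IH] e /=; first by case: eqP; rewrite ?big_seq1 ?big_nil.
rewrite big_flatten big_map big_enum /=; apply: eq_bigr => k _.
rewrite big_allpairs_dep IH mulr_suml; apply: eq_bigr => c _.
by rewrite mulr_sumr.
Qed.

Lemma weight_le s n e f w : 0 <= s -> w \in words n e f ->
  weight s e w <= expR (- s * len (chain_prod rep e w)).
Proof.
move=> s0; elim: n e w => [|n IH] e w.
  rewrite /=; case: eqP => // _; rewrite inE => /eqP -> /=.
  by rewrite len1 mulr0 expR0.
case: w => [|[k c] w]; first by rewrite (negbTE (words_nil _ _ _)).
rewrite mem_words => /andP[hc hw] /=.
apply: (@le_trans _ _ (expR (- s * ell e k c) * expR (- s * len (chain_prod rep k w)))).
  by rewrite ler_wpM2l ?expR_ge0// IH.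
rewrite -expRD ler_expR.
have := lenM (rep e k c) (chain_prod rep k w); have := Phi_len hc.
nra.
Qed.

(** The weight of a word is at most that of its product because len is subadditive,
   and by chain_prod_inj no group element is the product of two of the words. *)
Lemma pathsum_le_poincare (s B : R) n e f : 0 <= s ->
  (forall r : seq G, uniq r -> \sum_(g <- r) expR (- s * len g) <= B) ->
  pathsum (fun e f => \sum_(c <- Phi e f) expR (- s * ell e f c)) n e f <= B.
Proof.
move=> s0 HB; rewrite pathsum_words.
apply: le_trans (HB [seq chain_prod rep e w | w <- words n e f] _).
  rewrite big_map big_seq [leRHS]big_seq; apply: ler_sum => w hw.
  exact: weight_le hw.
rewrite map_inj_in_uniq ?words_uniq// => w w' /words_chain[h1 h2] /words_chain[h3 h4].
by apply: (chain_prod_inj h1 h3); rewrite h2 h4.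
Qed.

End Words.

(** * The blocks at the critical exponent *)

Section OrbitLength.
Context {R : realType} {X : metricType R} {G : groupType}.
Variables (act : G -> X -> X) (x : X).
Hypothesis act_isom : isometry_group act.

Definition olen (g : G) : R := mdist x (act g x).

Lemma isomM a b z : act (a * b)%g z = act a (act b z).
Proof. by case: act_isom => -[_ ->]. Qed.

Lemma isom1 z : act 1%g z = z.
Proof. by case: act_isom => -[]. Qed.

Lemma isomd a y z : mdist (act a y) (act a z) = mdist y z.
Proof. by case: act_isom. Qed.

Lemma isomV a y z : mdist (act a y) z = mdist y (act a^-1%g z).
Proof. by rewrite -(isomd a y) -isomM mulgV isom1. Qed.

Lemma isomdE a b : mdist (act a x) (act b x) = olen (a^-1 * b)%g.
Proof. by rewrite /olen isomM isomV. Qed.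

Lemma olen1 : olen 1%g = 0.
Proof. by rewrite /olen isom1 mdistxx. Qed.

Lemma olenM g h : olen (g * h)%g <= olen g + olen h.
Proof.
rewrite /olen isomM; apply: le_trans (metric_triangle _ (act g x) _) _.
by rewrite isomd.
Qed.

Lemma olenV g : olen g^-1%g = olen g.
Proof. by rewrite /olen -isomV metric_sym. Qed.

Lemma olen_ge0 g : 0 <= olen g.
Proof. exact: mdist_ge0. Qed.

Definition summable_at (s B : R) : Prop :=
  forall r : seq G, uniq r -> \sum_(g <- r) expR (- s * olen g) <= B.

Lemma critical_exponent_lt (s : R) : (critical_exponent act x < s%:E)%E ->
  exists s' B, [/\ 0 < s', s' < s, (critical_exponent act x <= s'%:E)%E & summable_at s' B].
Proof.
move=> /ereal_inf_lt[_ [s' [s'0 hs'] <-]] ss'.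
have s'S : (critical_exponent act x <= s'%:E)%E.
  by apply: ereal_inf_lbound; exists s'.
exists s', (fine (\esum_(g in [set: G]) (expR (- s' * olen g))%:E)); split=> //.
move=> r ur; rewrite -lee_fin fineK; first exact: esum_lb.
by rewrite ge0_fin_numE//; apply: esum_ge0 => g _; rewrite lee_fin expR_ge0.
Qed.

Lemma critical_exponent_ge (s : R) : 0 < s -> (s%:E < critical_exponent act x)%E ->
  forall B, ~ summable_at s B.
Proof.
move=> s0 sd B H; move: sd; apply/negP; rewrite -leNgt.
apply: ereal_inf_lbound; exists s => //; split=> //.
apply: (@le_lt_trans _ _ B%:E); last exact: ltry.
by apply: esum_ub => r ur _; exact: H.
Qed.

End OrbitLength.

Lemma ler_sum_seq_sub {R : realType} {I : choiceType} (F : I -> R) (r r' : seq I) :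
  (forall i, 0 <= F i) -> uniq r -> uniq r' -> {subset r <= r'} ->
  \sum_(i <- r) F i <= \sum_(i <- r') F i.
Proof.
move=> F0 ur ur' rr'; rewrite [leRHS](bigID (mem r))/=.
have -> : \sum_(i <- r' | i \in r) F i = \sum_(i <- r) F i.
  rewrite -big_filter; apply: perm_big; apply: uniq_perm; rewrite ?filter_uniq// => i.
  by rewrite mem_filter; case: (boolP (i \in r)) => // /rr' ->.
by rewrite lerDl; apply: sumr_ge0.
Qed.

Section Blocks.
Context {R : realType} {X : metricType R} {G : groupType}.
Variables (act : G -> X -> X) (x : X).
Hypothesis act_isom : isometry_group act.
Context {T : gtree G} {Y : finite_quotient T}.
Variable D : lifts Y.
Implicit Types (e f : qedge Y) (c : set G) (s t : R).
Local Notation len := (olen act x).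
Local Notation ell := (coset_length act x D).

Lemma coset_length_ge0 f c : 0 <= ell f c.
Proof.
have [->|/set0P c0] := eqVneq c set0; first by rewrite /coset_length image_set0 inf0.
apply: lb_le_inf; first by case: c0 => g cg; exists (mdist x (act (g * tau D f)%g x)), g.
by move=> _ [g _ <-]; exact: mdist_ge0.
Qed.

(** The coset length is an infimum; approximating it up to eta makes no difference
   in the limit. *)
Lemma short_representatives (eta : R) : 0 < eta ->
  exists rep : qedge Y -> qedge Y -> set G -> G,
  forall e f c, allowed D e f c ->
    transition D rep e f c /\ len (rep e f c) <= ell f c + eta.
Proof.
move=> eta0.
have /choice[F HF] : forall p : qedge Y * set G, exists g, edge_coset D p.1 p.2 ->
    p.2 g /\ len (g * tau D p.1)%g <= ell p.1 p.2 + eta.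
  move=> [f c] /=; have [hc|] := pselect (edge_coset D f c); last by exists 1%g.
  have c0 : [set mdist x (act (g * tau D f)%g x) | g in c] !=set0.
    have [r _ ->] := hc; eexists; exists (r * 1)%g; last reflexivity.
    by exists 1%g => //; rewrite /egroup /stabilizer /= eact1.
  have cl : has_inf [set mdist x (act (g * tau D f)%g x) | g in c].
    by split=> //; exists 0 => _ [g _ <-]; exact: mdist_ge0.
  by have [_ [g cg <-] /ltW h] := inf_adherent eta0 cl; exists g.
exists (fun e f c => F (f, c) * tau D f)%g => e f c hal.
have [_ hc _] := hal; have [/= h1 h2] := HF (f, c) hc.
by split=> //; split=> //; rewrite mulgK.
Qed.

Variable delta : R.
Hypothesis delta_gt0 : 0 < delta.
Hypothesis deltaE : critical_exponent act x = delta%:E.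

Section FiniteFamily.
Variable Phi : qedge Y -> qedge Y -> seq (set G).
Hypothesis Phi_uniq : forall e f, uniq (Phi e f).
Hypothesis Phi_allowed : forall e f c, c \in Phi e f -> allowed D e f c.

Definition family_matrix s e f : R := \sum_(c <- Phi e f) expR (- s * ell f c).

Lemma family_matrix_ge0 s : nonneg (family_matrix s).
Proof. by move=> e f; apply: sumr_ge0 => c _; exact: expR_ge0. Qed.

(** Above the critical exponent the powers of the matrix are bounded by the
   Poincare series, hence have diagonal entries at most 1; the bound passes to
   the limit because the family is finite. *)
Lemma family_diag n e : pathsum (family_matrix delta) n e e <= 1.
Proof.
apply: pathsum_approx => [|t /andP[t0 t1]]; first exact: family_matrix_ge0.
pose Lm := \sum_e \sum_f \sum_(c <- Phi e f) ell f c.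
have Lmax e' f c : c \in Phi e' f -> ell f c <= Lm.
  move=> hc; rewrite /Lm (bigD1 e')//= (bigD1 f)//= (bigD1_seq c)//=.
  rewrite -!addrA lerDl; do ! apply: addr_ge0; do ? [apply: sumr_ge0 => ? _];
    do ? [apply: sumr_ge0 => ? _]; do ? [apply: sumr_ge0 => ? _]; exact: coset_length_ge0.
have Lm0 : 0 <= Lm.
  do 3! [apply: sumr_ge0 => ? _]; exact: coset_length_ge0.
pose th := - ln t.
have th0 : 0 < th by rewrite oppr_gt0 ln_lt0// t0.
(* With s within k of delta, and eta as below, the exponents s (L + eta) and
   delta L differ by at most th for every length L <= Lm of the family. *)
pose k := th / (2 * (Lm + 1)).
have k0 : 0 < k by rewrite divr_gt0// mulr_gt0//; lra.
have dk : (critical_exponent act x < (delta + k)%:E)%E.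
  by rewrite deltaE lte_fin ltrDl.
have [s [B [s0 sk ds HB]]] := critical_exponent_lt dk.
rewrite deltaE lee_fin in ds.
pose eta := th / (2 * s).
have eta0 : 0 < eta by rewrite divr_gt0// mulr_gt0.
have [rep Hrep] := short_representatives eta0.
pose b e f := \sum_(c <- Phi e f) expR (- s * (ell f c + eta)).
have b0 : nonneg b by move=> e' f'; apply: sumr_ge0 => ? _; exact: expR_ge0.
exists b; split.
  move=> e' f'; rewrite /family_matrix mulr_sumr big_seq [leRHS]big_seq.
  apply: ler_sum => c hc; rewrite -{1}(lnK (x := t)) ?posrE// -expRD ler_expR.
  have h1 := Lmax _ _ _ hc; have h2 := coset_length_ge0 f' c.
  have h3 : s * eta = th / 2 by rewrite /eta; field; rewrite gt_eqF.
  have h4 : k * (Lm + 1) = th / 2 by rewrite /k; field; rewrite gt_eqF//; lra.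
  have h5 : (s - delta) * ell f' c <= k * (Lm + 1).
    by apply: ler_pM => //; lra.
  by rewrite /th in h3 h4; lra.
apply: (@pathsum_diag _ _ _ _ B) => // m.
apply: (@pathsum_le_poincare _ _ _ _ D len (olen1 x act_isom) (olenM x act_isom) rep
  (fun e f c => ell f c + eta) Phi) => //.
- by move=> e' f' c /Phi_allowed/Hrep[].
- by move=> e' f' c /Phi_allowed/Hrep[].
- exact: ltW.
Qed.

End FiniteFamily.

Variable C : {set qedge Y}.
Hypothesis C_block : is_block act x D C.
Local Notation srel := (support_rel act x D).

Lemma block_connect e f : e \in C -> f \in C -> connect srel e f.
Proof.
have [[e0 _ CE] _] := C_block; rewrite !CE => /andP[_ h1] /andP[h2 _].
exact: connect_trans h1 h2.
Qed.

Lemma block_convex e f k : e \in C -> f \in C -> connect srel e k -> connect srel k f ->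
  k \in C.
Proof.
have [[e0 _ CE] _] := C_block; rewrite !CE => /andP[h1 _] /andP[_ h4] h2 h3.
by rewrite (connect_trans h1 h2) (connect_trans h3 h4).
Qed.

Lemma support_allowed e f : srel e f -> exists c, allowed D e f c.
Proof.
move=> /and3P[_ _ /asboolP/(_ 1 ltr01)/eqP h]; apply: contrapT => /forallNP hn.
by apply: h; rewrite /Kweight esum1// => c /hn.
Qed.

(** One coset for each pair in the support already witnesses that the block is
   strongly connected; the finite family is used to close up walks. *)
Lemma block_skeleton : exists Phi : qedge Y -> qedge Y -> seq (set G),
  [/\ forall e f, uniq (Phi e f),
      forall e f c, c \in Phi e f -> allowed D e f c,
      forall e f c, c \in Phi e f -> e \in C /\ f \in C &
      forall e f, e \in C -> f \in C ->
        exists m, 0 < pathsum (family_matrix Phi delta) m e f].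
Proof.
have /choice[F HF] : forall p : qedge Y * qedge Y, exists c, srel p.1 p.2 -> allowed D p.1 p.2 c.
  move=> [e f] /=; case: (boolP (srel e f)) => [/support_allowed[c hc]|_]; first by exists c.
  by exists set0.
pose Phi e f := if [&& e \in C, f \in C & srel e f] then [:: F (e, f)] else [::].
exists Phi; split.
- by move=> e f; rewrite /Phi; case: ifP.
- move=> e f c; rewrite /Phi; case: ifP => // /and3P[_ _ h]; rewrite inE => /eqP ->.
  exact: (HF (e, f)).
- by move=> e f c; rewrite /Phi; case: ifP => // /and3P[].
move=> e f eC fC; have /connectP[p] := block_connect eC fC.
elim: p e eC => [|k p IH] e eC /=; first by move=> _ ->; exists 0%N; rewrite /= eqxx.
move=> /andP[ek kp] fE.
have kC : k \in C.
  apply: (block_convex eC fC); first exact: connect1.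
  by apply/connectP; exists p.
have [m hm] := IH k kC kp fE; exists m.+1; rewrite /= (bigD1 k)//=.
apply: ltr_pwDl.
  by rewrite mulr_gt0// /family_matrix /Phi eC kC ek big_seq1 expR_gt0.
apply: sumr_ge0 => j _; rewrite mulr_ge0 ?family_matrix_ge0// pathsum_ge0//.
exact: family_matrix_ge0.
Qed.

(** A transition from e to f followed by a walk of weight w from f back to e is a
   closed walk, so that its weight times w is at most 1 by family_diag. *)
Lemma block_entry_bounded e f : e \in C -> f \in C ->
  exists B : R, (Kweight act x D delta e f <= B%:E)%E.
Proof.
move=> eC fC; have [Phi1 [u1 a1 _ P1]] := block_skeleton.
have [m] := P1 f e fC eC; set w := pathsum _ _ _ _ => w0.
exists w^-1; apply: esum_ub => r ur hr.
pose Phi e' f' := if (e' == e) && (f' == f) then undup (r ++ Phi1 e' f') else Phi1 e' f'.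
have uP e' f' : uniq (Phi e' f') by rewrite /Phi; case: ifP; rewrite ?undup_uniq.
have aP e' f' c : c \in Phi e' f' -> allowed D e' f' c.
  rewrite /Phi; case: ifP => [/andP[/eqP -> /eqP ->]|_]; last exact: a1.
  by rewrite mem_undup mem_cat => /orP[/hr|/a1].
have ex (c : set G) : 0 <= expR (- delta * ell f c) by exact: expR_ge0.
have P1P e' f' : family_matrix Phi1 delta e' f' <= family_matrix Phi delta e' f'.
  apply: ler_sum_seq_sub => // c hc.
  by rewrite /Phi; case: ifP => // _; rewrite mem_undup mem_cat hc orbT.
have h1 := family_diag uP aP m.+1 e.
rewrite -[X in _ <= X]mul1r ler_pdivlMr//.
apply: le_trans h1; rewrite -add1n.
apply: le_trans (pathsum_concat 1 m e f e (family_matrix_ge0 Phi delta)).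
rewrite pathsum1; apply: ler_pM => //; [exact: sumr_ge0|exact: ltW| |].
  apply: ler_sum_seq_sub => // c hc.
  by rewrite /Phi !eqxx mem_undup mem_cat hc.
by apply: le_pathsum => //; exact: family_matrix_ge0.
Qed.

Lemma Kweight_ge0 s e f : (0 <= Kweight act x D s e f)%E.
Proof. by apply: esum_ge0 => c _; rewrite lee_fin expR_ge0. Qed.

Lemma block_entry_fin e f : e \in C -> f \in C -> Kweight act x D delta e f \is a fin_num.
Proof.
move=> eC fC; have [B hB] := block_entry_bounded eC fC.
by rewrite ge0_fin_numE ?Kweight_ge0// (le_lt_trans hB)// ltry.
Qed.

Definition block_matrix e f : R :=
  if (e \in C) && (f \in C) then fine (Kweight act x D delta e f) else 0.

Lemma block_matrix_ge0 : nonneg block_matrix.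
Proof.
by move=> e f; rewrite /block_matrix; case: ifP => // _; rewrite fine_ge0// Kweight_ge0.
Qed.

Lemma block_matrix_ge e f (r : seq (set G)) : e \in C -> f \in C -> uniq r ->
  (forall c, c \in r -> allowed D e f c) ->
  \sum_(c <- r) expR (- delta * ell f c) <= block_matrix e f.
Proof.
move=> eC fC ur hr; rewrite /block_matrix eC fC -lee_fin fineK ?block_entry_fin//.
exact: esum_lb.
Qed.

Lemma block_matrix_approx t : 0 < t < 1 -> exists Phi : qedge Y -> qedge Y -> seq (set G),
  [/\ forall e f, uniq (Phi e f), forall e f c, c \in Phi e f -> allowed D e f c &
      forall e f, t * block_matrix e f <= family_matrix Phi delta e f].
Proof.
move=> /andP[t0 t1].
have /choice[F HF] : forall p : qedge Y * qedge Y, exists r : seq (set G),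
    [/\ uniq r, forall c, c \in r -> allowed D p.1 p.2 c &
      t * block_matrix p.1 p.2 <= \sum_(c <- r) expR (- delta * ell p.2 c)].
  move=> [e f] /=.
  have := block_matrix_ge0 e f; rewrite le_eqVlt => /orP[/eqP <-|k0].
    by exists [::]; rewrite big_nil mulr0.
  have /andP[eC fC] : (e \in C) && (f \in C).
    by move: k0; rewrite /block_matrix; case: ifP => //; rewrite ltxx.
  apply: contrapT => /forallNP hn.
  suff : (Kweight act x D delta e f <= (t * block_matrix e f)%:E)%E.
    rewrite -[X in (X <= _)%E]fineK ?block_entry_fin// lee_fin.
    rewrite /block_matrix eC fC /=; move: k0; rewrite /block_matrix eC fC /=.
    by move: (fine _) => k k0; rewrite -{1}(mul1r k) ler_pM2r// leNgt t1.
  apply: esum_ub => r ur hr; rewrite leNgt; apply/negP => /ltW h.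
  by apply: (hn r); split.
exists (fun e f => F (e, f)).
by split=> [e f|e f|e f]; have [h1 h2 h3] := HF (e, f).
Qed.

(** Finite subfamilies carry almost all of each entry, so the diagonal entries of the
   powers are at most 1; the other entries are bounded by closing up walks. *)
Lemma block_radius : spectral_radius (Kblock act x D C delta) <= 1.
Proof.
apply: spectral_radius_le => // l.
have KE : Kblock act x D C delta =
    \matrix_(i, j) block_matrix (enum_val i) (enum_val j).
  by apply/matrixP => i j; rewrite !mxE /block_matrix !enum_valP.
have diag n e : pathsum block_matrix n e e <= 1.
  apply: pathsum_approx => [|t t01]; first exact: block_matrix_ge0.
  have [Phi [u a h]] := block_matrix_approx t01.
  by exists (family_matrix Phi delta); split=> //; exact: family_diag.
have [Phi1 [u1 a1 c1 P1]] := block_skeleton.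
have P1K e f : family_matrix Phi1 delta e f <= block_matrix e f.
  case E: (Phi1 e f) => [|c r]; first by rewrite /family_matrix E big_nil block_matrix_ge0.
  have [eC fC] : e \in C /\ f \in C by apply: (c1 e f c); rewrite E mem_head.
  by apply: block_matrix_ge => // c'; exact: a1.
pose w e f := if (e \in C) && (f \in C) =P true is ReflectT h then
    xchoose (P1 f e (proj2 (andP h)) (proj1 (andP h))) else 0%N.
have wP e f : e \in C -> f \in C -> 0 < pathsum block_matrix (w e f) f e.
  move=> eC fC; rewrite /w; case: eqP => [h|]; last by rewrite eC fC.
  apply: lt_le_trans (xchooseP (P1 f e (proj2 (andP h)) (proj1 (andP h)))) _.
  by apply: le_pathsum => //; exact: family_matrix_ge0.
pose B := \sum_e \sum_f (pathsum block_matrix (w e f) f e)^-1.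
have off n e f : e \in C -> f \in C -> pathsum block_matrix n e f <= B.
  move=> eC fC; apply: (@le_trans _ _ (pathsum block_matrix (w e f) f e)^-1).
    rewrite -[X in _ <= X]mul1r ler_pdivlMr ?wP//.
    apply: le_trans (diag (n + w e f)%N e).
    exact: pathsum_concat block_matrix_ge0.
  rewrite /B (bigD1 e)//= (bigD1 f)//= -addrA lerDl addr_ge0//.
    by apply: sumr_ge0 => ? _; rewrite invr_ge0 pathsum_ge0//; exact: block_matrix_ge0.
  by do 2! [apply: sumr_ge0 => ? _]; rewrite invr_ge0 pathsum_ge0//; exact: block_matrix_ge0.
rewrite KE; apply: (@eigenvalue_le1 _ _ _ B) => [i j|m i j].
  by rewrite mxE block_matrix_ge0.
apply: le_trans (off m _ _ (enum_valP i) (enum_valP j)).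
apply: le_trans (pathsum_enum m i j block_matrix_ge0).
by apply: le_pathsum => i' j'; rewrite mxE// block_matrix_ge0.
Qed.

(** * Comparison matrices *)

Hypothesis X_cat : cat_minus_one X.

(** For s' < s, the comparison matrix at s is at most q times the comparison
   matrix at s', where q < 1 is governed by the shortest axis length; the powers
   of the latter are bounded when the Poincare series converges at s'. *)
Lemma critical_parameter_le (F : hyperbolic_choice act D C) :
  (critical_parameter x F <= critical_exponent act x)%E.
Proof.
rewrite deltaE; apply/lee_addgt0Pr => eps eps0; rewrite -EFinD.
have : (critical_exponent act x < (delta + eps)%:E)%E by rewrite deltaE lte_fin ltrDl.
move=> /critical_exponent_lt[s [B [s0 sk ds HB]]].
apply: ereal_inf_lbound; exists (delta + eps) => //; split; first by rewrite /= addr_gt0.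
set s' := delta + eps in sk *.
pose Phi e f : seq (set G) := if (e \in C) && (f \in C) then enum_fset (hfam F e f) else [::].
pose al e f c := axis_length x (act (helt F e f c)).
pose A t e f : R := \sum_(c <- Phi e f) expR (- t * al e f c).
have A0 t : nonneg (A t) by move=> ? ?; apply: sumr_ge0 => ? _; exact: expR_ge0.
have Pin e f c : c \in Phi e f -> [/\ e \in C, f \in C & c \in hfam F e f].
  by rewrite /Phi; case: ifP => // /andP[].
have alP e f c : c \in Phi e f -> 0 < al e f c.
  by move=> /Pin[h1 h2 h3]; apply: axis_length_gt0 => //; exact: helt_hyperbolic.
have Apow m e f : pathsum (A s) m e f <= B.
  apply: (@pathsum_le_poincare _ _ _ _ D len (olen1 x act_isom) (olenM x act_isom)
    (helt F) al Phi) => //; [| | |exact: ltW].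
  - by move=> e' f'; rewrite /Phi; case: ifP => // _; exact: fset_uniq.
  - move=> e' f' c /Pin[h1 h2 h3]; split; first exact: hfam_allowed h3.
    by have [g cg ->] := helt_coset h1 h2 h3; rewrite mulgK.
  - by move=> e' f' c /Pin[h1 h2 h3]; apply: axis_length_ge => //; exact: helt_hyperbolic.
have [a a0 aP] : exists2 a : R, 0 < a & forall e f c, c \in Phi e f -> a <= al e f c.
  have [r Hr] : exists r : seq R, forall y, y \in r <->
      exists e f c, c \in Phi e f /\ y = al e f c.
    exists (flatten [seq flatten [seq [seq al e f c | c <- Phi e f] | f <- enum (qedge Y)]
      | e <- enum (qedge Y)]) => y; split.
      by move=> /flatten_mapP[e _ /flatten_mapP[f _ /mapP[c hc ->]]]; exists e, f, c.
    move=> [e [f [c [hc ->]]]]; apply/flatten_mapP; exists e; rewrite ?mem_enum//.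
    by apply/flatten_mapP; exists f; rewrite ?mem_enum// map_f.
  have [a a0 ar] : exists2 a : R, 0 < a & forall y, y \in r -> a <= y.
    have : forall y, y \in r -> 0 < y by move=> y /Hr[e [f [c [/alP h ->]]]].
    elim: r {Hr} => [|y r IH] hr; first by exists 1.
    have [a a0 ha] := IH (fun z hz => hr z (mem_behead (s := y :: r) hz)).
    exists (Num.min a y); first by rewrite lt_min a0 hr// mem_head.
    by move=> z; rewrite inE ge_min => /orP[/eqP ->|/ha ->]; rewrite ?lexx ?orbT.
  by exists a => // e f c hc; apply: ar; apply/Hr; exists e, f, c.
pose q := expR (- (s' - s) * a).
have q1 : q < 1 by rewrite -expR0 ltr_expR; nra.
apply: le_lt_trans q1.
apply: spectral_radius_le; first exact: expR_ge0.
move=> l hl.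
pose M : 'M[R]_#|C| := \matrix_(i, j) (q^-1 * A s' (enum_val i) (enum_val j)).
have q0 : 0 < q := expR_gt0 _.
have MA i j : 0 <= M i j <= A s (enum_val i) (enum_val j).
  rewrite mxE mulr_ge0 ?invr_ge0 ?(ltW q0) ?A0//=.
  rewrite mulrC ler_pdivrMr// /A [X in _ <= X]mulr_suml big_seq [X in _ <= X]big_seq.
  apply: ler_sum => c hc; rewrite -expRD ler_expR.
  have := aP _ _ _ hc; nra.
have cM : comparison_matrix x F s' = q *: M.
  apply/matrixP => u v; rewrite !mxE mulrA mulfV ?gt_eqF// mul1r.
  by rewrite /A /Phi !enum_valP.
suff : ComplexField.Normc.normc ((real_complex R q)^-1 * l) <= 1.
  rewrite ComplexField.Normc.normcM ComplexField.Normc.normcV normc_real ?(ltW q0)//.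
  by rewrite mulrC ler_pdivrMr// mul1r.
apply: (@eigenvalue_le1 _ _ M B) => [i j|m i j|].
- by case/andP: (MA i j).
- apply: le_trans (Apow m (enum_val i) (enum_val j)).
  apply: le_trans (pathsum_enum m i j (A0 s)).
  by apply: le_pathsum => i' j'; case/andP: (MA i' j').
move/eigenvalueP: hl => [v vM v0]; apply/eigenvalueP; exists v => //.
have qc : real_complex R q != 0 by rewrite fmorph_eq0 gt_eqF.
apply: (scalerI qc); rewrite scalerA mulrA mulfV// mul1r -vM cM.
by rewrite map_mxZ scalemxAr.
Qed.

End Blocks.

(** * Rays and boundary points *)

Section Boundary.
Context {R : realType} {X : metricType R}.
Implicit Types (x y z p : X) (c : R -> X) (xi eta : boundary X).
Local Notation gp := gromov_product.

Lemma asymptotic_refl c : asymptotic c c.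
Proof. by exists 0 => t _; rewrite mdistxx. Qed.

Lemma asymptotic_sym c c' : asymptotic c c' -> asymptotic c' c.
Proof. by move=> [M h]; exists M => t /h; rewrite metric_sym. Qed.

Lemma asymptotic_trans c2 c1 c3 :
  asymptotic c1 c2 -> asymptotic c2 c3 -> asymptotic c1 c3.
Proof.
move=> [M h] [N k]; exists (M + N) => t t0.
by apply: le_trans (metric_triangle _ (c2 t) _) _; rewrite lerD ?h ?k.
Qed.

Lemma boundary_eq xi eta c c' :
  projT1 xi c -> projT1 eta c' -> asymptotic c c' -> xi = eta.
Proof.
case: xi eta => [S hS] [S' hS'] /= h h' cc'.
suff e : S = S' by subst S'; congr (exist _ S _); exact: Prop_irrelevance.
move: h h'; have [c0 _ ->] := hS; have [c1 _ ->] := hS' => -[_ h] [_ h'].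
have a01 : asymptotic c0 c1.
  exact: asymptotic_trans h (asymptotic_trans cc' (asymptotic_sym h')).
apply/seteqP; split=> c2 [r2 a2]; split=> //.
  exact: asymptotic_trans (asymptotic_sym a01) a2.
exact: asymptotic_trans a01 a2.
Qed.

Lemma ray_ofP xi : projT1 xi (ray_of xi) /\ is_ray (ray_of xi).
Proof.
rewrite /ray_of; case: (cid2 _) => c rc /= xiE.
by rewrite xiE; split=> //; split=> //; exact: asymptotic_refl.
Qed.

Definition ray_point c (rc : is_ray c) : boundary X :=
  exist _ (ray_class c) (ex_intro2 _ _ c rc erefl).

Lemma cvg_boundaryP x (y : nat -> X) xi :
  cvg_boundary x y xi <->
  forall c, projT1 xi c -> forall A : R, exists (n0 : nat) (t0 : R),
    forall n t, (n0 <= n)%N -> t0 <= t -> A <= gp x (y n) (c t).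
Proof.
split=> H c xc; last first.
  apply/cvgryPge => A; have [n0 [t0 h]] := H c xc A.
  exists ([set n | (n0 <= n)%N], [set t | t0 <= t]); last first.
    by move=> [n t] [/= h1 h2]; exact: h.
  split; first by exists n0.
  by exists t0; split; [exact: num_real|move=> t /ltW].
move=> A; have /cvgryPge/(_ A)[[P Q] [/= [n0 _ hP] [t0 [_ hQ]]] PQ] := H c xc.
exists n0, (t0 + 1) => n t nn0 tt0; apply: (PQ (n, t)); split => /=.
  exact: hP.
by apply: hQ; apply: lt_le_trans tt0; rewrite ltrDl.
Qed.

Lemma gp_perturb x y z z' : gp x y z - mdist z z' <= gp x y z'.
Proof.
rewrite /gp; have := metric_triangle x z' z; have := metric_triangle y z z'.
by rewrite (metric_sym z' z); lra.
Qed.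

Lemma ray_gp_monotone c x (T t : R) : is_ray c -> 0 <= T -> T <= t ->
  T - mdist x (c 0) <= gp x (c T) (c t).
Proof.
move=> rc T0 Tt; have t0 := le_trans T0 Tt.
have := rc 0 T (lexx 0) T0; have := rc 0 t (lexx 0) t0; have := rc T t T0 t0.
rewrite !sub0r !normrN distrC !ger0_norm ?subr_ge0// => h1 h2 h3.
have := metric_triangle (c 0) x (c T); have := metric_triangle (c 0) x (c t).
by rewrite h2 h3 /gp (metric_sym (c 0) x) h1; lra.
Qed.

Section GromovLimit.
Variables (x : X) (c1 c2 : R -> X).
Hypotheses (r1 : is_ray c1) (r2 : is_ray c2).

(** The Gromov product of c1 t and c2 t is the difference of t - d (c1 t, c2 t) / 2
   and of (2 t - d (x, c1 t) - d (x, c2 t)) / 2; both are nondecreasing in t, and the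
   second one is bounded. *)
Lemma ray_gp_cvg : exists l : \bar R, (-oo < l)%E /\
  (gp x (c1 t) (c2 t))%:E @[t --> +oo] --> l.
Proof.
pose m (t : R) := Num.max 0 t.
have m0 t : 0 <= m t by rewrite /m le_max lexx.
have mm s t : s <= t -> m s <= m t by move=> st; rewrite /m ge_max !le_max lexx st orbT.
pose g t := (m t - mdist (c1 (m t)) (c2 (m t)) / 2)%:E.
pose k t := ((m t - mdist x (c1 (m t)) + (m t - mdist x (c2 (m t)))) / 2)%:E.
have dr c s t : is_ray c -> s <= t -> mdist (c (m s)) (c (m t)) = m t - m s.
  by move=> rc st; rewrite rc// distrC ger0_norm// subr_ge0 mm.
have ng : nondecreasing_fun g.
  move=> s t st; rewrite lee_fin.
  have h1 := dr _ _ _ r1 st; have h2 := dr _ _ _ r2 st.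
  have := metric_triangle (c1 (m t)) (c1 (m s)) (c2 (m t)).
  have := metric_triangle (c1 (m s)) (c2 (m s)) (c2 (m t)).
  by rewrite (metric_sym (c1 (m t)) (c1 (m s))) h1 h2; lra.
have nk : nondecreasing_fun k.
  move=> s t st; rewrite lee_fin.
  have h1 := dr _ _ _ r1 st; have h2 := dr _ _ _ r2 st.
  have := metric_triangle x (c1 (m s)) (c1 (m t)).
  have := metric_triangle x (c2 (m s)) (c2 (m t)).
  by rewrite h1 h2; lra.
pose K := (mdist x (c1 0) + mdist x (c2 0)) / 2.
have kK t : (k t <= K%:E)%E.
  rewrite lee_fin.
  have := r1 (lexx 0) (m0 t); have := r2 (lexx 0) (m0 t).
  rewrite !sub0r !normrN !ger0_norm// => h1 h2.
  have := metric_triangle (c1 0) x (c1 (m t)); have := metric_triangle (c2 0) x (c2 (m t)).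
  by rewrite h1 h2 !(metric_sym _ x) /K; lra.
have cg := nondecreasing_cvge ng; have ck := nondecreasing_cvge nk.
set lg := ereal_sup _ in cg; set lk := ereal_sup _ in ck.
have lkf : lk \is a fin_num.
  rewrite fin_numE; apply/andP; split.
    rewrite gt_eqF//; apply: lt_le_trans (ltNyr _) _; last first.
      by apply: ereal_sup_ubound; exists 0.
  rewrite lt_eqF//; apply: (@le_lt_trans _ _ K%:E); last exact: ltry.
  by apply: ge_ereal_sup => _ [t _ <-].
have lgN : (-oo < lg)%E.
  apply: (@lt_le_trans _ _ (g 0)); first exact: ltNyr.
  by apply: ereal_sup_ubound; exists 0.
exists (lg - lk)%E; split.
  by move: lkf lgN; case: lk {ck} => [v| |] //; case: lg {cg} => [u| |] // _ _; exact: ltNyr.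
have adef : (lg +? - lk)%E by apply: fin_num_adde_defl; rewrite fin_numN.
apply: cvg_trans (cvgeB adef cg ck).
apply: near_eq_cvg; exists 0; split; first exact: num_real.
move=> t t0; rewrite /g /k /= -EFinB /gp; congr (_%:E).
by rewrite /m max_r ?ltW//; lra.
Qed.

End GromovLimit.

(** By ray_gp_cvg the boundary product is a genuine limit, so that a lower bound for
   it holds eventually along the rays, up to 1. *)
Lemma bourdon_le_gp x xi eta (t : R) : bourdon x xi eta <= expR (- t) ->
  exists u0, forall u, u0 <= u -> t - 1 <= gp x (ray_of xi u) (ray_of eta u).
Proof.
have [_ r1] := ray_ofP xi; have [_ r2] := ray_ofP eta.
have [l [lN cl]] := ray_gp_cvg x r1 r2.
rewrite /bourdon /boundary_product (cvg_lim _ cl)//.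
case: l lN cl => [l| |] // _ cl h.
  rewrite /= ler_expR lerN2 in h.
  have [_ cl'] := (fine_cvgP _ _).1 cl.
  have lt : t - 1 < l by lra.
  have [u0 [_ hu]] := cvgr_ge l cl' _ lt.
  by exists (u0 + 1) => u uu; apply: hu; lra.
have [u0 [_ hu]] := (cvgeyPge _).1 cl (t - 1).
by exists (u0 + 1) => u uu; rewrite -lee_fin; apply: hu; lra.
Qed.

Hypothesis cat : cat_minus_one X.
Hypothesis X_proper : proper_space X.

Lemma cvg_bourdon_gp x (y z : nat -> X) xi eta (t : R) :
  cvg_boundary x y xi -> cvg_boundary x z eta -> bourdon x xi eta <= expR (- t) ->
  exists n0, forall n m, (n0 <= n)%N -> (n0 <= m)%N -> t - 5 <= gp x (y n) (z m).
Proof.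
move=> /cvg_boundaryP hy /cvg_boundaryP hz /bourdon_le_gp[u0 hu].
have [n1 [t1 h1]] := hy _ (ray_ofP xi).1 (t - 1).
have [n2 [t2 h2]] := hz _ (ray_ofP eta).1 (t - 3).
exists (maxn n1 n2) => n m; rewrite !geq_max => /andP[n1n _] /andP[_ n2m].
pose u := Num.max u0 (Num.max t1 t2).
have [uu0 ut1 ut2] : [/\ u0 <= u, t1 <= u & t2 <= u].
  by rewrite /u; split; rewrite !le_max lexx ?orbT.
have h3 := four_point cat (h1 n u n1n ut1) (hu u uu0).
have h4 := h2 m u n2m ut2; rewrite gpC in h4.
have h5 : t - 3 <= gp x (y n) (ray_of eta u) by lra.
have := four_point cat h5 h4; lra.
Qed.

(** If the Gromov products of y and z are unbounded, then the four-point inequality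
   along c1 t, c1 u, y n, z m, c2 u, c2 t bounds the distance of c1 t and c2 t. *)
Lemma cvg_boundary_unique x (y z : nat -> X) xi eta :
  cvg_boundary x y xi -> cvg_boundary x z eta ->
  (forall (A : R) n0, exists n m, [/\ (n0 <= n)%N, (n0 <= m)%N & A <= gp x (y n) (z m)]) ->
  xi = eta.
Proof.
move=> /cvg_boundaryP hy /cvg_boundaryP hz H.
have [xi1 r1] := ray_ofP xi; have [eta1 r2] := ray_ofP eta.
apply: (boundary_eq xi1 eta1).
set c1 := ray_of xi in xi1 r1 *; set c2 := ray_of eta in eta1 r2 *.
pose a := mdist x (c1 0) + mdist x (c2 0).
exists (4 * a + 16) => t t0.
have [n1 [t1 h1]] := hy _ xi1 t; have [n2 [t2 h2]] := hz _ eta1 t.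
have [n [m [nn mm nm]]] := H t (maxn n1 n2).
move: nn mm; rewrite !geq_max => /andP[n1n _] /andP[_ n2m].
pose u := Num.max t (Num.max t1 t2).
have [ut ut1 ut2] : [/\ t <= u, t1 <= u & t2 <= u].
  by rewrite /u; split; rewrite !le_max lexx ?orbT.
have g1 := h1 n u n1n ut1; have g2 := h2 m u n2m ut2.
have b1 := ray_gp_monotone x r1 t0 ut; have b2 := ray_gp_monotone x r2 t0 ut.
have a1 : 0 <= mdist x (c1 0) := mdist_ge0 _ _.
have a2 : 0 <= mdist x (c2 0) := mdist_ge0 _ _.
rewrite gpC in g1; rewrite gpC in b2.
have a0 : 0 <= a by rewrite addr_ge0.
have l1 : t - a - 2 <= gp x (c1 t) (y n) by apply: (four_point cat (q := c1 u)); rewrite /a; lra.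
have l2 : t - a - 2 - 2 <= gp x (c1 t) (z m) by apply: (four_point cat l1); lra.
have l3 : t - a - 2 - 2 - 2 <= gp x (c1 t) (c2 u) by apply: (four_point cat l2); lra.
have l4 : t - a - 2 - 2 - 2 - 2 <= gp x (c1 t) (c2 t).
  by apply: (four_point cat l3); rewrite /a; lra.
have d1 : mdist x (c1 t) <= a + t.
  apply: le_trans (metric_triangle _ (c1 0) _) _.
  by rewrite r1// sub0r normrN ger0_norm// /a; lra.
have d2 : mdist x (c2 t) <= a + t.
  apply: le_trans (metric_triangle _ (c2 0) _) _.
  by rewrite r2// sub0r normrN ger0_norm// /a; lra.
by move: l4; rewrite {1}/gp; lra.
Qed.

(** Take the limit along an ultrafilter of the geodesics from x to the points y n;
   it exists pointwise because closed balls are compact. *)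
Lemma accumulation_ray x (y : nat -> X) :
  (forall A : R, exists n0, forall n, (n0 <= n)%N -> A <= mdist x (y n)) ->
  exists c, [/\ is_ray c, c 0 = x &
    forall (T : R) n0, 0 <= T -> exists2 n, (n0 <= n)%N & T - 1 <= gp x (y n) (c T)].
Proof.
move=> yoo.
have /choice[cn Hcn] : forall n, exists c, is_geodesic x (y n) c by move=> n; exact: cat.1.
have [F [FU Foo]] := ultraFilterLemma (F := \oo) _.
have big (A : R) : F [set n | A <= mdist x (y n)].
  by apply: Foo; have [n0 h] := yoo A; exists n0.
have dx n t : 0 <= t -> t <= mdist x (y n) -> mdist x (cn n t) = t.
  by move=> t0 tn; apply: geo_dist0 (Hcn n) _; rewrite t0.
have /choice[c Hc] : forall t : R, exists p, 0 <= t ->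
    forall e, 0 < e -> F [set n | mdist p (cn n t) < e].
  move=> t; have [t0|t0] := lerP 0 t; last by exists x.
  have Ft : fmap (cn^~ t) F [set z | mdist x z <= t].
    rewrite /fmap /=; apply: filterS (big t) => n tn.
    by have := dx n t t0 tn; rewrite /preimage /= => ->.
  have [p [_ Fp]] := @X_proper x t _ (fmap_proper_filter _ _) Ft.
  exists p => _ e e0.
  case: (in_ultra_setVsetC [set n | mdist p (cn n t) < e] FU) => // Fn.
  have [|z [/= h]] := Fp (~` [set z | mdist p z < e]) (ball p e) _ (nbhsx_ballx _ _ e0).
    exact: Fn.
  by rewrite ballEmdist.
have c_ray : is_ray c.
  move=> s t s0 t0; apply/eqP; rewrite eq_le; apply/andP.
  suff H e : 0 < e -> `|s - t| - e <= mdist (c s) (c t) <= `|s - t| + e.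
    by split; apply/ler_addgt0Pr => e /H; lra.
  move=> e0; have e2 : 0 < e / 2 by rewrite divr_gt0.
  have [n [[/= h1 h2] [h3 h4]]] := filter_ex (filterI
    (filterI (Hc s s0 _ e2) (Hc t t0 _ e2)) (filterI (big s) (big t))).
  have [_ _ hcn] := Hcn n.
  have h5 := hcn s t _ _; rewrite s0 h3 t0 h4 in h5; have {}h5 := h5 isT isT.
  have := metric_triangle (c s) (cn n s) (c t).
  have := metric_triangle (cn n s) (cn n t) (c t).
  have := metric_triangle (cn n s) (c s) (cn n t).
  have := metric_triangle (c s) (c t) (cn n t).
  by rewrite h5 (metric_sym (cn n t) (c t)) (metric_sym (cn n s) (c s)); lra.
have c0 : c 0 = x.
  apply: mdist_positivity; apply/eqP; rewrite eq_le mdist_ge0 andbT.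
  apply/ler_addgt0Pr => e e0; rewrite add0r.
  have [n h] := filter_ex (Hc 0 (lexx 0) e e0).
  by apply/ltW; move: h => /=; have [-> _ _] := Hcn n.
exists c; split=> // T n0 T0.
have Fn0 : F [set n | (n0 <= n)%N] by apply: Foo; exists n0.
have [n [[/= h1 h2] h3]] := filter_ex (filterI (filterI (Hc T T0 _ ltr01) (big T)) Fn0).
exists n => //; have := gp_perturb x (y n) (cn n T) (c T).
have Tn : 0 <= T <= mdist x (y n) by rewrite T0.
have := geo_dist1 (Hcn n) Tn; have := geo_dist0 (Hcn n) Tn.
rewrite {1}/gp (metric_sym (y n)) => -> ->.
by rewrite (metric_sym (cn n T)); lra.
Qed.

Lemma ray_class_cvg x (y : nat -> X) c (rc : is_ray c) : c 0 = x ->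
  (forall A : R, exists n0 t0, 0 <= t0 /\ A <= t0 /\
     forall n, (n0 <= n)%N -> A <= gp x (y n) (c t0)) ->
  cvg_boundary x y (ray_point rc).
Proof.
move=> c0 H; apply/cvg_boundaryP => c' [_ [M cc']] A.
have [n0 [t0 [t00 [At0 h]]]] := H (A + M + 2); exists n0, t0 => n t nn tt.
have := ray_gp_monotone x rc t00 tt; rewrite c0 mdistxx subr0 => h1.
have h2 := four_point cat (h n nn) (le_trans At0 h1).
have := gp_perturb x (y n) (c t) (c' t); have := cc' t (le_trans t00 tt).
by lra.
Qed.

Lemma gromov_sequence_cvg x (y : nat -> X) :
  (forall A : R, exists n0, forall n m, (n0 <= n)%N -> (n0 <= m)%N -> A <= gp x (y n) (y m)) ->
  exists xi, cvg_boundary x y xi.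
Proof.
move=> H; have [|c [rc c0 hc]] := @accumulation_ray x y.
  move=> A; have [n0 h] := H A; exists n0 => n nn.
  by apply: le_trans (h n n nn nn) _; exact: gp_lel.
exists (ray_point rc); apply: ray_class_cvg => // A.
have [n0 h] := H (A + 2); pose T := Num.max 0 (A + 3).
have [T0 TA] : 0 <= T /\ A + 3 <= T by rewrite /T; split; rewrite le_max lexx ?orbT.
have [m nm hm] := hc T n0 T0.
exists n0, T; split=> //; split; first by lra.
move=> n nn; suff : A + 2 - 2 <= gp x (y n) (c T) by lra.
by apply: (four_point cat (h n m nn nm)); lra.
Qed.

Lemma unbounded_subsequence_cvg x (y : nat -> X) :
  (forall A : R, exists n0, forall n, (n0 <= n)%N -> A <= mdist x (y n)) ->
  exists s xi, cvg_boundary x (y \o s) xi.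
Proof.
move=> yoo; have [c [rc c0 hc]] := accumulation_ray yoo.
have /choice[s Hs] : forall k : nat, exists n, k%:R - 1 <= gp x (y n) (c k%:R).
  by move=> k; have [n _ h] := hc k%:R 0%N (ler0n _ _); exists n.
exists s, (ray_point rc); apply: ray_class_cvg => // A.
pose k := (Num.truncn (Num.max 0 (A + 3))).+1.
have kA : A + 3 <= k%:R.
  apply: le_trans (ltW (truncnS_gt _)); by rewrite le_max lexx orbT.
exists k, k%:R; split; first exact: ler0n.
split; first by lra.
move=> n kn; have nk : k%:R <= n%:R :> R by rewrite ler_nat.
have := ray_gp_monotone x rc (ler0n _ k) nk; rewrite c0 mdistxx subr0 gpC => h1.
suff : A + 2 - 2 <= gp x (y (s n)) (c k%:R) by lra.
by apply: (four_point cat (q := c n%:R)); have := Hs n; lra.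
Qed.

End Boundary.

(** * Moving directions apart in a non-elementary group *)

Definition often (P : nat -> Prop) : Prop := forall N, exists2 n, (N <= n)%N & P n.

Lemma often_pigeonhole (V : eqType) (F : nat -> V) (l : seq V) (P : nat -> Prop) :
  often P -> (forall n, P n -> F n \in l) -> exists w, often (fun n => P n /\ F n = w).
Proof.
elim: l P => [|v l IH] P oP hP; first by have [n _ /hP] := oP 0%N.
have [h|] := pselect (often (fun n => P n /\ F n = v)); first by exists v.
move=> /existsNP[N hN].
have [||w hw] := IH (fun n => P n /\ F n != v).
- move=> n; have [m hm Pm] := oP (maxn N n); exists m.
    by rewrite (leq_trans _ hm)// leq_maxr.
  split=> //; apply/eqP => Fm; apply: hN; exists m => //.
  by rewrite (leq_trans _ hm)// leq_maxl.
- by move=> n [/hP]; rewrite inE => /orP[/eqP ->|//]; rewrite eqxx.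
exists w => n; have [m nm [[Pm _] Fm]] := hw n.
by exists m.
Qed.

Section NonElementary.
Context {R : realType} {X : metricType R} {G : groupType}.
Variables (act : G -> X -> X) (x : X).
Hypothesis act_isom : isometry_group act.
Hypothesis cat : cat_minus_one X.
Hypothesis X_proper : proper_space X.
Local Notation len := (olen act x).
Local Notation gp := gromov_product.

Definition gpg (a b : G) : R := gp x (act a x) (act b x).

Lemma gpg_four a b c (m : R) : m <= gpg a b -> m <= gpg b c -> m - 2 <= gpg a c.
Proof. exact: four_point. Qed.

Lemma gpgC a b : gpg a b = gpg b a.
Proof. exact: gpC. Qed.

Lemma gpg_le a b : gpg a b <= len a.
Proof. exact: gp_lel. Qed.

Lemma gpgE a b : gpg a b = (len a + len b - len (a^-1 * b)%g) / 2.
Proof. by rewrite /gpg /gp (isomdE x act_isom). Qed.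

Lemma gpgM k a b : gpg a b - len k <= gpg (k * a)%g (k * b)%g.
Proof.
rewrite !gpgE invgM -mulgA (mulgA k^-1%g) mulVg mul1g.
have := olenM x act_isom k^-1%g (k * a)%g; have := olenM x act_isom k^-1%g (k * b)%g.
by rewrite !mulgA mulVg !mul1g (olenV x act_isom); lra.
Qed.

(** The left-hand side is the sum of the Gromov products at the two ends of the side
   [x, a x] of the triangle with third vertex (a * b) x. *)
Lemma gpg_split a b : gpg a (a * b)%g + gpg a^-1%g b = len a.
Proof.
rewrite !gpgE mulgA mulVg mul1g invgK (olenV x act_isom); lra.
Qed.

Lemma olen_sub a b : len a - len b <= len (b^-1 * a)%g.
Proof.
have := olenM x act_isom b (b^-1 * a)%g.
by rewrite mulgA mulgV mul1g; lra.
Qed.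

Hypothesis fg : finitely_generated G.
Hypothesis non_elem : non_elementary act x.
Variables (s0 B0 : R).
Hypothesis s0_gt0 : 0 < s0.
Hypothesis s0_summable : summable_at act x s0 B0.
Hypothesis delta_gt0 : (0 < critical_exponent act x)%E.
Hypothesis delta_fin : (critical_exponent act x < +oo)%E.

Lemma size_le_sum (I : eqType) (F : I -> R) (l : seq I) (v : R) :
  (forall i, i \in l -> v <= F i) -> (size l)%:R * v <= \sum_(i <- l) F i.
Proof.
elim: l => [|i l IH] h; first by rewrite mul0r big_nil.
rewrite big_cons /= -natr1 mulrDl mul1r addrC lerD ?h ?mem_head//.
by apply: IH => k kl; rewrite h// inE kl orbT.
Qed.

(** Each element of the ball contributes at least exp (- s0 r) to the Poincare
   series. *)
Lemma ball_size (r : R) : exists N, forall l : seq G, uniq l ->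
  (forall g, g \in l -> len g <= r) -> (size l <= N)%N.
Proof.
exists (Num.truncn (B0 * expR (s0 * r))) => l ul hl.
rewrite -ltnS -(ltr_nat R); apply: le_lt_trans (truncnS_gt _).
rewrite -ler_pdivrMr ?expR_gt0// -expRN; apply: le_trans (s0_summable ul).
apply: size_le_sum => g /hl h; rewrite ler_expR.
by rewrite mulNr lerN2 ler_pM2l.
Qed.

Lemma ball_finite (r : R) : exists l : seq G, forall g, len g <= r -> g \in l.
Proof.
have [N hN] := ball_size r.
pose P n := `[< exists l : seq G, [/\ uniq l, forall g, g \in l -> len g <= r & size l = n] >].
have exP : exists n, P n by exists 0%N; apply/asboolP; exists [::].
have leP n : P n -> (n <= N)%N by move=> /asboolP[l [ul hl <-]]; exact: hN.
case: (ex_maxnP exP leP) => n /asboolP[l [ul hl sl]] nmax.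
exists l => g gr; apply/negPn/negP => gl.
suff : (n.+1 <= n)%N by rewrite ltnn.
apply: nmax; apply/asboolP; exists (g :: l); split; rewrite /= ?gl ?sl//.
by move=> h; rewrite inE => /orP[/eqP ->|/hl].
Qed.

Lemma long_elements (r : R) : exists g, r < len g.
Proof.
apply: contrapT => /forallNP hn.
have hr g : len g <= r by rewrite leNgt; apply/negP/hn.
have [N hN] := ball_size r.
have dE : critical_exponent act x = (fine (critical_exponent act x))%:E.
  by rewrite fineK// fin_numE gt_eqF ?lt_eqF// (lt_trans _ delta_gt0).
have d0 : 0 < fine (critical_exponent act x) by rewrite -lte_fin -dE.
move: dE d0; set d := fine _ => dE d0.
have d2 : 0 < d / 2 by rewrite divr_gt0.
apply: (critical_exponent_ge (act := act) (x := x) d2 _ (B := N%:R)).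
  by rewrite dE lte_fin; lra.
move=> l ul; apply: (@le_trans _ _ (\sum_(g <- l) 1)).
  apply: ler_sum => g _; rewrite expR_le1.
  by rewrite mulNr oppr_le0 mulr_ge0 ?(ltW d2)//; exact: olen_ge0.
rewrite big_const_seq count_predT iter_addr_0 ler_nat; exact: hN.
Qed.

Lemma cvg_olen (g : nat -> G) xi : cvg_boundary x (fun n => act (g n) x) xi ->
  forall A : R, exists n0, forall n, (n0 <= n)%N -> A <= len (g n).
Proof.
move=> /cvg_boundaryP h A; have [n0 [t0 h']] := h _ (ray_ofP xi).1 A.
by exists n0 => n nn; apply: le_trans (h' n t0 nn (lexx _)) _; exact: gp_lel.
Qed.

(** A non-elementary group has three limit points, and sequences converging to
   different limit points have bounded Gromov products, up to finitely many terms. *)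
Lemma three_limits : exists (u : 'I_3 -> nat -> G) (B : R),
  (forall i (A : R), exists n0, forall n, (n0 <= n)%N -> A <= len (u i n)) /\
  (forall i j n m, i != j -> gpg (u i n) (u j m) <= B).
Proof.
have /choice[g hg] : forall n : nat, exists g, n%:R < len g by move=> n; exact: long_elements.
have [s [z0 cz0]] : exists s xi, cvg_boundary x ((fun n => act (g n) x) \o s) xi.
  apply: (unbounded_subsequence_cvg cat X_proper) => A.
  exists (Num.truncn A).+1 => n nA; apply: le_trans (ltW (hg n)).
  by apply: le_trans (ltW (truncnS_gt A)) _; rewrite ler_nat.
have l0 : limit_set act x z0 by exists (g \o s).
have out (xi eta : boundary X) : exists z, [/\ limit_set act x z, z <> xi & z <> eta].
  apply: contrapT => /forallNP h; apply: (non_elem (xi := xi) (eta := eta)) => z lz.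
  apply: contrapT => /not_orP[h1 h2]; exact: (h z).
have [z1 [l1 z10 _]] := out z0 z0; have [z2 [l2 z20 z21]] := out z0 z1.
pose z (i : 'I_3) := if val i == 0%N then z0 else if val i == 1%N then z1 else z2.
have lz i : limit_set act x (z i) by rewrite /z; case: ifP => // _; case: ifP.
have zinj i j : z i = z j -> i = j.
  rewrite /z; case: i => -[|[|[|//]]] ?; case: j => -[|[|[|//]]] ? //= h;
    try (by apply: val_inj); by [case: z10|case: z20|case: z21|case: z10; rewrite h
      |case: z20; rewrite h|case: z21; rewrite h].
have /choice[f hf] : forall i, exists f : nat -> G, cvg_boundary x (fun n => act (f n) x) (z i).
  by move=> i; have [f h] := lz i; exists f.
have /choice[p hp] : forall ij : 'I_3 * 'I_3, exists p : R * nat, ij.1 != ij.2 ->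
    forall n m, (p.2 <= n)%N -> (p.2 <= m)%N -> gpg (f ij.1 n) (f ij.2 m) <= p.1.
  move=> [i j] /=; have [->|ij] := eqVneq i j; first by exists (0, 0%N).
  apply: contrapT => /forallNP h; move/eqP: ij; apply; apply: zinj.
  apply: (cvg_boundary_unique cat (hf i) (hf j)) => A n0.
  apply: contrapT => h'; apply: (h (A, n0)) => _ n m /= nn mm.
  by rewrite leNgt; apply/negP => /ltW hA; apply: h'; exists n, m.
pose B := \sum_ij `|(p ij).1|; pose N := (\sum_ij (p ij).2)%N.
have hB ij : (p ij).1 <= B.
  rewrite /B (bigD1 ij)//=; apply: le_trans (ler_norm _) _.
  by rewrite lerDl; apply: sumr_ge0.
have hN ij : ((p ij).2 <= N)%N by rewrite /N (bigD1 ij)//= leq_addr.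
exists (fun i n => f i (n + N)%N), B; split.
  move=> i A; have [n0 h] := cvg_olen (hf i) A; exists n0 => n nn.
  by apply: h; rewrite (leq_trans nn)// leq_addr.
move=> i j n m ij; apply: le_trans (hB (i, j)).
by apply: (hp (i, j) ij); rewrite (leq_trans (hN (i, j)))// leq_addl.
Qed.

(** Every limit at infinity of such a sequence is fixed by the whole group. *)
Definition quasi_fixed (b : nat -> G) : Prop := forall h (A : R),
  exists n0, forall n, (n0 <= n)%N -> A <= gpg (b n) (h * b n)%g.

Lemma quasi_fixed_sub b s : (forall n, (n <= s n)%N) -> quasi_fixed b -> quasi_fixed (b \o s).
Proof.
move=> hs qb h A; have [n0 hn] := qb h A; exists n0 => n nn.
by apply: hn; rewrite (leq_trans nn).
Qed.

(** In gpg_split the point (g * b n) x may be replaced with b n x at the corner x,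
   because b n and g * b n are close as seen from x. *)
Lemma quasi_fixed_split b g : quasi_fixed b -> exists n0, forall n, (n0 <= n)%N ->
  len g - 2 <= gpg g (b n) + gpg g^-1%g (b n).
Proof.
move=> qb; have [n0 hn] := qb g (len g); exists n0 => n nn.
have h1 := gpg_split g (b n); have h2 := gpg_le g (g * b n)%g.
have h3 := hn n nn; rewrite gpgC in h3.
have := gpg_four (lexx (gpg g (g * b n)%g)) (le_trans h2 h3).
by lra.
Qed.

Section ThreeSequences.
Variables (u : 'I_3 -> nat -> G) (B : R).
Hypothesis u_oo : forall i (A : R), exists n0, forall n, (n0 <= n)%N -> A <= len (u i n).
Hypothesis uB : forall i j n m, i != j -> gpg (u i n) (u j m) <= B.

(** By the four-point inequality b n is close to at most one of the three sequences;
   i0 is one that is exceptional for infinitely many n. *)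
Lemma quasi_fixed_avoid b : exists (s : nat -> nat) i0, (forall n, (n <= s n)%N) /\
  forall n j m, j != i0 -> gpg (u j m) (b (s n)) <= B + 3.
Proof.
have /choice[F hF] : forall n, exists i, forall j m, j != i -> gpg (u j m) (b n) <= B + 3.
  move=> n; have [[i [m h]]|h] := pselect (exists i m, B + 3 < gpg (u i m) (b n)).
    exists i => j k ji; rewrite leNgt; apply/negP => h'.
    have h'' := ltW h; rewrite gpgC in h''.
    have := gpg_four (ltW h') h''; have := uB k m ji; lra.
  exists ord0 => j m _; rewrite leNgt; apply/negP => h'; apply: h.
  by exists j, m.
have [||i0 h] := @often_pigeonhole _ F (enum 'I_3) (fun=> True).
- by move=> n; exists n.
- by move=> n _; rewrite mem_enum.
have /choice[s hs] : forall n, exists m, (n <= m)%N /\ F m = i0.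
  by move=> n; have [m nm [_ Fm]] := h n; exists m.
exists s, i0; split=> [n|n j m ji]; first by have [] := hs n.
by have [_ e] := hs n; apply: hF; rewrite e.
Qed.

Lemma avoid_inverse b j m : quasi_fixed b ->
  (forall n, gpg (u j m) (b n) <= B + 3) ->
  exists n0, forall n, (n0 <= n)%N -> len (u j m) - (B + 5) <= gpg (u j m)^-1%g (b n).
Proof.
move=> qb h; have [n0 hn] := quasi_fixed_split (u j m) qb; exists n0 => n nn.
by have := hn n nn; have := h n; lra.
Qed.

(** The inverses of the u j m all lie near the quasi-fixed direction, where an
   element k displaces points by a bounded amount. *)
Lemma conjugates_bounded b j k : quasi_fixed b ->
  (forall m n, gpg (u j m) (b n) <= B + 3) ->
  forall m, len (u j m * k * (u j m)^-1)%g <= 3 * len k + 2 * B + 18.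
Proof.
move=> qb h m; set v := u j m.
have [n0 h0] := avoid_inverse qb (h m); have [n1 h1] := qb k (len v).
set n := maxn n0 n1.
have a1 := h0 n (leq_maxl _ _); have a2 := h1 n (leq_maxr _ _).
have a3 := gpgM k v^-1%g (b n).
rewrite -/v in a1; rewrite gpgC in a2.
have lk : 0 <= len k := olen_ge0 act x k.
have B0' : - 5 <= B.
  have i1 : (ord0 : 'I_3) != ord_max by [].
  have := uB 0 0 i1; have := gp_ge0 x (act (u ord0 0%N) x) (act (u ord_max 0%N) x).
  by rewrite -/(gpg _ _); lra.
have a4 : len v - (B + 5) - len k - 2 <= gpg (k * v^-1)%g (b n).
  by apply: (gpg_four (b := (k * b n)%g)); lra.
rewrite gpgC in a4.
have a5 := gpg_four (m := len v - (B + 5) - len k - 2) _ a4.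
have {}a5 : len v - (B + 5) - len k - 2 - 2 <= gpg v^-1%g (k * v^-1)%g by apply: a5; lra.
move: a5; rewrite gpgE invgK mulgA (olenV x act_isom).
have := olenM x act_isom k v^-1%g; rewrite (olenV x act_isom); lra.
Qed.

(** Conjugates with bounded displacement repeat, and since the group is finitely
   generated this makes some quotient of the u j m commute with all generators. *)
Lemma central_quotients b j : quasi_fixed b ->
  (forall m n, gpg (u j m) (b n) <= B + 3) ->
  exists (m0 : nat) (s : nat -> nat), (forall n, (n <= s n)%N) /\
    forall n h, (h * ((u j m0)^-1 * u j (s n)) = (u j m0)^-1 * u j (s n) * h)%g.
Proof.
move=> qb hj; have [S finS gS] := fg.
have [l hl] : exists l : seq G, S `<=` [set` l].
  by exists (fset_set S) => g gS'; rewrite /= in_fset_set// inE.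
have [P [oP hP]] : exists P, often P /\ forall m m' k, P m -> P m' -> k \in l ->
    (u j m * k * (u j m)^-1 = u j m' * k * (u j m')^-1)%g.
  elim: (l) => [|k l' [P [oP hP]]]; first by exists (fun=> True); split=> // n; exists n.
  have [r hr] := ball_finite (3 * len k + 2 * B + 18).
  have [|w hw] := @often_pigeonhole _ (fun m => (u j m * k * (u j m)^-1)%g) r P oP.
    by move=> n _; apply: hr; exact: conjugates_bounded qb hj _.
  exists (fun m => P m /\ (u j m * k * (u j m)^-1)%g = w); split=> // m m' k' [Pm h] [Pm' h'].
  by rewrite inE => /orP[/eqP ->|kl]; [rewrite h h'|exact: hP].
have [m0 _ Pm0] := oP 0%N.
have /choice[s hs] : forall n, exists m, (n <= m)%N /\ P m.
  by move=> n; have [m nm Pm] := oP n; exists m.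
exists m0, s; split=> [n|n h]; first by have [] := hs n.
have [_ Psn] := hs n.
have sub (w : G) : is_subgroup [set h | (h * w = w * h)%g].
  split=> /=; first by rewrite mulg1 mul1g.
    by move=> a c ha hc; rewrite -mulgA hc mulgA ha mulgA.
  by move=> a ha; apply: (mulgI a); rewrite !mulgA mulgV mul1g ha -!mulgA mulgV mulg1.
set z := (_^-1 * _)%g.
suff : [set h | (h * z = z * h)%g] h by [].
rewrite (gS _ (sub z))//.
move=> k /hl /= kl; have := hP _ _ _ Pm0 Psn kl; rewrite /z => e.
apply: (mulgI (u j m0)); rewrite !mulgA mulgV mul1g.
by apply: (mulIg (u j (s n))^-1%g); rewrite -!mulgA mulgV mulg1 !mulgA.
Qed.

(** The central elements z n obtained from one sequence form a second quasi-fixed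
   sequence, at bounded Gromov product with b.  A further sequence avoids both of
   them, so its inverses have to approach both directions: a contradiction. *)
Lemma no_quasi_fixed b : ~ quasi_fixed b.
Proof.
move=> qb0; have [s [i0 [hs hav]]] := quasi_fixed_avoid b.
have qb := quasi_fixed_sub hs qb0; set b' := b \o s in qb.
have [j ji0] : exists j, j != i0.
  exists (if i0 == ord0 then ord_max else ord0).
  by case: (eqVneq i0 ord0) => [->|]; rewrite // eq_sym.
have hj m n : gpg (u j m) (b' n) <= B + 3 by exact: hav.
have [m0 [s' [hs' hz]]] := central_quotients qb hj.
set v0 := u j m0 in hz; pose z n := (v0^-1 * u j (s' n))%g.
have lz n : len (u j (s' n)) - len v0 <= len (z n) by exact: olen_sub.
have qz : quasi_fixed z.
  move=> h A; have [n0 hn] := u_oo j (A + len v0 + len h); exists n0 => n nn.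
  have := hn (s' n) (leq_trans nn (hs' n)); have := lz n.
  rewrite gpgE; have -> : ((z n)^-1 * (h * z n) = h)%g.
    by rewrite (hz n h : (h * z n = z n * h)%g) mulKg.
  by have := olenM x act_isom h^-1%g (h * z n)%g; rewrite mulKg (olenV x act_isom); lra.
have [K0 hK0] := qb v0 (B + 6).
have zb n K : (K0 <= K)%N -> gpg (z n) (b' K) <= B + 6 + len v0.
  move=> KK; rewrite leNgt; apply/negP => hgt.
  have := gpgM v0 (z n) (b' K); rewrite {2}/z mulgA mulgV mul1g => h1.
  have h2 := hK0 K KK; rewrite gpgC in h2.
  have := gpg_four (m := B + 6) _ h2; move=> /(_ (u j (s' n)) ltac:(lra)).
  by have := hj (s' n) K; lra.
have [t [i1 [ht hav']]] := quasi_fixed_avoid z.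
have qz' := quasi_fixed_sub ht qz.
have [l /andP[li0 li1]] : exists l, (l != i0) && (l != i1).
  apply/existsP; apply: contraT; rewrite negb_exists => /forallP h.
  have : (#|[set: 'I_3]%SET| <= #|[set i0; i1]%SET|)%N.
    apply/subset_leq_card/fintype.subsetP => i _.
    by have := h i; rewrite !inE negb_and !negbK.
  by rewrite cardsT card_ord cards2; case: (_ != _).
have [m hm] := u_oo l (2 * B + 14 + len v0).
have {}hm := hm m (leqnn m).
have [n1 h1] := avoid_inverse qb (fun n => hav n l m li0).
have [n2 h2] := avoid_inverse qz' (fun n => hav' n l m li1).
have K := h1 (maxn n1 K0) (leq_maxl _ _); have Z := h2 n2 (leqnn _).
have zbb := zb (t n2) (maxn n1 K0) (leq_maxr _ _).
rewrite gpgC in Z; have := gpg_four Z K.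
by lra.
Qed.

End ThreeSequences.

(** Otherwise there are a n and b n whose translates h * b n all stay close to a n
   for h in larger and larger balls, and b is quasi-fixed. *)
Lemma connecting_elements : exists M : R, 0 <= M /\
  forall a b, exists2 h, len h <= M & gpg a (h * b)%g <= M.
Proof.
have [u [B [uoo uB]]] := three_limits.
apply: contrapT => /forallNP hn.
have /choice[p hp] : forall n : nat, exists p : G * G, forall h, len h <= n%:R ->
    n%:R < gpg p.1 (h * p.2)%g.
  move=> n; apply: contrapT => /forallNP hp; apply: (hn n%:R); split; first exact: ler0n.
  move=> a b; apply: contrapT => /forall2NP hh; apply: (hp (a, b)) => h hl /=.
  by have [//|/negP] := hh h; rewrite -ltNge.
apply: (@no_quasi_fixed u B uoo uB (fun n => (p n).2)) => h A.
exists (Num.truncn (Num.max (A + 2) (len h))).+1 => n nn.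
have nA : Num.max (A + 2) (len h) <= n%:R.
  by apply: le_trans (ltW (truncnS_gt _)) _; rewrite ler_nat.
move: nA; rewrite ge_max => /andP[nA nh].
have h1 := hp n 1%g; rewrite (olen1 x act_isom) mul1g in h1.
have h2 := hp n h nh; have {}h1 := h1 (ler0n _ _).
rewrite gpgC in h1.
by have := gpg_four (ltW h1) (ltW h2); lra.
Qed.

End NonElementary.

(** * Broken geodesics *)

Section BrokenGeodesics.
Context {R : realType} {X : metricType R}.
Hypothesis cat : cat_minus_one X.
Local Notation gp := gromov_product.
Variables (p : nat -> X) (K : R).
Hypothesis turn : forall i, gp (p i.+1) (p i) (p i.+2) <= K.
Hypothesis step : forall i, 2 * K + 7 <= mdist (p i) (p i.+1).

Lemma gp_swap (a b c : X) : gp a b c + gp b a c = mdist a b.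
Proof. by rewrite /gp (metric_sym b a); lra. Qed.

(** At a corner, the direction of the previous vertex and that of the vertex p i are
   close, since the last side is longer than the turn allows. *)
Lemma turn_from i d : gp (p (i + d).+1) (p i) (p (i + d).+2) <= K + 2.
Proof.
elim: d => [|d IH]; first by rewrite addn0; have := turn i; lra.
rewrite addnS; set j := (i + d).+1 in IH *; rewrite leNgt; apply/negP => h.
have h1 := gp_swap (p j) (p j.+1) (p i); rewrite gpC in h1.
have h2 := step j.
pose e := Num.min 1 (gp (p j.+1) (p i) (p j.+2) - (K + 2)).
have e0 : 0 < e by rewrite lt_min ltr01 subr_gt0.
have e1 : e <= 1 by rewrite ge_min lexx.
have e2 : e <= gp (p j.+1) (p i) (p j.+2) - (K + 2) by rewrite ge_min lexx orbT.
have h4 : K + 2 + e <= gp (p j.+1) (p j) (p i) by lra.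
have h5 : K + 2 + e <= gp (p j.+1) (p i) (p j.+2) by lra.
have := four_point cat h4 h5; have := turn j; lra.
Qed.

Lemma turn_to i d : gp (p i.+1) (p i) (p (i + d).+2) <= K + 2.
Proof.
elim: d i => [|d IH] i; first by rewrite addn0; have := turn i; lra.
rewrite addnS leNgt; apply/negP => h.
have := IH i.+1; rewrite addSn => h0.
have h1 := gp_swap (p i.+1) (p i.+2) (p (i + d).+3).
have h2 := step i.+1; have h3 := turn i; rewrite gpC in h3.
pose e := Num.min 1 (gp (p i.+1) (p i) (p (i + d).+3) - (K + 2)).
have e0 : 0 < e by rewrite lt_min ltr01 subr_gt0.
have e1 : e <= 1 by rewrite ge_min lexx.
have e2 : e <= gp (p i.+1) (p i) (p (i + d).+3) - (K + 2) by rewrite ge_min lexx orbT.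
have h4 : K + 2 + e <= gp (p i.+1) (p i.+2) (p (i + d).+3) by lra.
have h5 : K + 2 + e <= gp (p i.+1) (p (i + d).+3) (p i) by rewrite gpC; lra.
have := four_point cat h4 h5; lra.
Qed.

(** At p j, both p i and p k are seen in the directions of the adjacent vertices, up
   to the constants of the four-point inequality. *)
Lemma broken_geodesic i j k : (i <= j)%N -> (j <= k)%N -> 0 <= K ->
  gp (p j) (p i) (p k) <= K + 4.
Proof.
move=> ij jk K0.
have triv (a b : X) : gp a a b = 0 by rewrite /gp mdistxx; lra.
move: ij; rewrite leq_eqVlt => /orP[/eqP <-|ij]; first by rewrite triv; lra.
move: jk; rewrite leq_eqVlt => /orP[/eqP <-|jk]; first by rewrite gpC triv; lra.
have [d jE] : exists d, j = (i + d).+1 by exists (j - i.+1)%N; rewrite -addSn subnKC.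
have h1 := turn_from i d; rewrite -jE in h1.
move: jk; rewrite leq_eqVlt => /orP[/eqP <-|jk]; first by lra.
have [d' kE] : exists d', k = (j + d').+2 by exists (k - j.+2)%N; rewrite -!addSn subnKC.
have h2 := turn_to j d'; rewrite -kE in h2.
have h3 := gp_swap (p j) (p j.+1) (p k); have h4 := step j.
rewrite leNgt; apply/negP => h5.
pose e := Num.min 1 (gp (p j) (p i) (p k) - (K + 4)).
have e0 : 0 < e by rewrite lt_min ltr01 subr_gt0.
have e1 : e <= 1 by rewrite ge_min lexx.
have e2 : e <= gp (p j) (p i) (p k) - (K + 4) by rewrite ge_min lexx orbT.
have h6 : K + 4 + e <= gp (p j) (p i) (p k) by lra.
have h7 : K + 4 + e <= gp (p j) (p k) (p j.+1) by rewrite gpC; lra.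
have := four_point cat h6 h7; lra.
Qed.

Lemma broken_growth i d : d%:R <= mdist (p i) (p (i + d)%N).
Proof.
elim: d => [|d IH]; first exact: mdist_ge0.
case: d IH => [|d] IH; rewrite addnS.
  rewrite addn0; have := step i; have := gp_ge0 (p i.+1) (p i) (p i.+2).
  have := turn i; lra.
rewrite -[d.+2]addn1 natrD; rewrite !addnS in IH *.
have := turn_from i d; have := step (i + d).+1.
have := gp_swap (p (i + d).+1) (p i) (p (i + d).+2).
have h1 : gp (p (i + d).+1) (p i) (p (i + d).+2) =
  (mdist (p i) (p (i + d).+1) + mdist (p (i + d).+1) (p (i + d).+2)
   - mdist (p i) (p (i + d).+2)) / 2 by rewrite /gp (metric_sym (p (i + d).+1) (p i)).
by rewrite h1; lra.
Qed.

End BrokenGeodesics.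

(** * Choosing the letters *)

(** Choose greedily: each chosen element discards at most N others. *)
Lemma separated_subset (V : choiceType) (close : V -> V -> Prop) (N : nat) (E : seq V) :
  (forall g, close g g) -> (forall g h, close g h -> close h g) ->
  (forall g l, uniq l -> (forall h, h \in l -> close g h) -> (size l <= N)%N) ->
  uniq E -> exists S : seq V, [/\ uniq S, {subset S <= E}, (size E <= N * size S)%N &
    forall g h, g \in S -> h \in S -> g != h -> ~ close g h].
Proof.
move=> crefl csym cN; elim: {E}(size E) {-2}E (leqnn (size E)) => [|n IH] [|g E] //= sE uE;
  try by exists [::]; split.
have [gE uE'] := andP uE.
pose E1 := [seq h <- E | ~~ `[< close g h >]].
have [||S [uS SE sS sep]] := IH E1.
- by rewrite size_filter (leq_trans (count_size _ _)).
- exact: filter_uniq.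
have S1 h : h \in S -> h \in E /\ ~ close g h.
  by move=> /SE; rewrite mem_filter => /andP[/asboolPn ? ?].
exists (g :: S); split.
- by rewrite /= uS andbT; apply/negP => /S1[_]; apply; exact: crefl.
- by move=> h; rewrite !inE => /orP[/eqP ->|/S1[->]]; rewrite ?eqxx ?orbT.
- rewrite /= mulnS.
  have -> : (size E).+1 = (size (g :: [seq h <- E | `[< close g h >]]) + size E1)%N.
    by rewrite /= !size_filter -(count_predC (fun h => `[< close g h >]) E).
  apply: leq_add => //; apply: (cN g).
    by rewrite /= mem_filter (negbTE gE) andbF filter_uniq.
  by move=> h; rewrite inE => /orP[/eqP -> //|]; rewrite mem_filter => /andP[/asboolP].
move=> h k; rewrite !inE => /orP[/eqP ->|hS] /orP[/eqP ->|kS]; rewrite ?eqxx// => hk.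
- by have [] := S1 _ kS.
- by move=> /csym; have [] := S1 _ hS.
- exact: sep.
Qed.

Lemma geometric_sum_le {R : realType} (q : R) n : 0 <= q -> q < 1 ->
  \sum_(i < n) q ^+ i <= (1 - q)^-1.
Proof.
move=> q0 q1; rewrite -[leRHS]mul1r ler_pdivlMr ?subr_gt0//.
suff -> : (\sum_(i < n) q ^+ i) * (1 - q) = 1 - q ^+ n by rewrite gerBl exprn_ge0.
elim: n => [|n IH]; first by rewrite big_ord0 mul0r expr0 subrr.
by rewrite big_ord_recr /= mulrDl IH exprS; ring.
Qed.

Lemma sum_le_size {R : realType} {I : eqType} (F : I -> R) (l : seq I) (v : R) :
  (forall i, i \in l -> F i <= v) -> \sum_(i <- l) F i <= (size l)%:R * v.
Proof.
elim: l => [|i l IH] h; first by rewrite mul0r big_nil.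
rewrite big_cons /= -natr1 mulrDl mul1r addrC lerD ?h ?mem_head//.
by apply: IH => k kl; rewrite h// inE kl orbT.
Qed.

Section Letters.
Context {R : realType} {X : metricType R} {G : groupType}.
Variables (act : G -> X -> X) (x : X).
Hypothesis act_isom : isometry_group act.
Local Notation len := (olen act x).
Variables (s0 B0 : R).
Hypothesis s0_gt0 : 0 < s0.
Hypothesis s0_summable : summable_at act x s0 B0.

(** If all the annuli n <= len g < n + 1 had at most B exp (s n) elements, the
   Poincare series would converge at every exponent greater than s. *)
Lemma annulus_growth (s s' B : R) n0 : 0 <= B -> 0 <= s' -> s < s' ->
  (forall C, ~ summable_at act x s' C) ->
  exists n l, [/\ (n0 <= n)%N, uniq l,
    forall g, g \in l -> n%:R <= len g <= n.+1%:R & B * expR (s * n%:R) < (size l)%:R].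
Proof.
move=> B0' s'0 ss' div; apply: contrapT => hn.
have hB n l : (n0 <= n)%N -> uniq l -> (forall g, g \in l -> n%:R <= len g <= n.+1%:R) ->
    (size l)%:R <= B * expR (s * n%:R).
  by move=> nn ul hl; rewrite leNgt; apply/negP => h; apply: hn; exists n, l.
have [N hN] := ball_size s0_gt0 s0_summable n0%:R.
pose q := expR (s - s'); have q1 : q < 1 by rewrite expR_lt1 subr_lt0.
apply: (div (B * (1 - q)^-1 + n0%:R * N%:R)) => r ur.
pose fl g := Num.truncn (len g).
pose m := (\max_(g <- r) fl g)%N.
have flP g : (fl g)%:R <= len g <= (fl g).+1%:R.
  have /andP[h1 h2] := truncn_itv (olen_ge0 act x g).
  by rewrite h1 ltW.
rewrite (partition_big (fun g => inord (fl g) : 'I_m.+1) xpredT)//=.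
apply: (@le_trans _ _ (\sum_(n < m.+1) (B * q ^+ n + (n < n0)%N%:R * N%:R))).
  apply: ler_sum => n _; rewrite -big_filter.
  set l := [seq _ <- r | _].
  have ul : uniq l by exact: filter_uniq.
  have ll g : g \in l -> n%:R <= len g <= n.+1%:R.
    rewrite mem_filter => /andP[/eqP e gr]; rewrite -e inordK//.
    by rewrite ltnS /m (bigD1_seq g)//= leq_maxl.
  apply: (@le_trans _ _ ((size l)%:R * expR (- s' * n%:R))).
    apply: sum_le_size => g /ll/andP[h _]; rewrite ler_expR.
    by rewrite !mulNr lerN2 ler_wpM2l.
  have E : expR (- s' * n%:R) <= 1 by rewrite expR_le1 mulNr oppr_le0 mulr_ge0.
  case: (ltnP n n0) => nn.
    rewrite mul1r; apply: (@le_trans _ _ N%:R).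
      apply: (@le_trans _ _ ((size l)%:R * 1)); first by rewrite ler_wpM2l.
      rewrite mulr1 ler_nat; apply: hN => // g /ll/andP[_ h].
      by apply: le_trans h _; rewrite ler_nat.
    by rewrite lerDr mulr_ge0// exprn_ge0// expR_ge0.
  rewrite mul0r addr0.
  apply: (@le_trans _ _ (B * expR (s * n%:R) * expR (- s' * n%:R))).
    by rewrite ler_wpM2r ?expR_ge0//; exact: hB.
  rewrite -mulrA -expRD /q -expRM_natr.
  by rewrite le_eqVlt; apply/orP; left; apply/eqP; congr (_ * expR _); ring.
rewrite big_split /= -mulr_sumr lerD//.
  by rewrite ler_wpM2l// geometric_sum_le// expR_ge0.
rewrite -mulr_suml ler_wpM2r// -natr_sum ler_nat.
rewrite -(big_mkord xpredT (fun n => (n < n0)%N : nat)).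
suff -> k : (\sum_(0 <= i < k) (i < n0) = minn k n0)%N by exact: geq_minr.
elim: k => [|k IH]; first by rewrite big_geq// min0n.
rewrite big_nat_recr//= IH; case: (ltnP k n0) => h.
  by rewrite (minn_idPl h) addn1.
by rewrite (minn_idPr (leqW h)) addn0.
Qed.

Variable delta : R.
Hypothesis deltaE : critical_exponent act x = delta%:E.

(** Thin out a well populated annulus to a separated subset.  An element has a
   bounded number N of neighbours, independently of the annulus, and annulus_growth
   makes up for the factor N and for the lengths M of the connecting elements. *)
Lemma letters (s M : R) : 0 < s -> s < delta -> 0 <= M ->
  exists (n : nat) (S : seq G), [/\ uniq S, 5 * M + 7 <= n%:R,
    forall g, g \in S -> n%:R <= len g <= n.+1%:R,
    1 <= \sum_(g <- S) expR (- s * (len g + M)) &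
    forall g h, g \in S -> h \in S -> g != h -> forall a b, len a <= M -> len b <= M ->
      8 * M + 14 < len ((a * g)^-1 * (b * h))%g].
Proof.
move=> s_gt0 sd M0.
have len1 := olen1 x act_isom; have lenV := olenV x act_isom.
pose Sep := 8 * M + 14.
pose close g h := exists a b, [/\ len a <= M, len b <= M & len ((a * g)^-1 * (b * h))%g <= Sep].
have crefl g : close g g.
  by exists 1%g, 1%g; rewrite mulVg len1; split=> //; rewrite /Sep; lra.
have csym g h : close g h -> close h g.
  by move=> [a [b [h1 h2 h3]]]; exists b, a; split=> //; rewrite -lenV invgM invgK.
have [bM hbM] := ball_finite s0_gt0 s0_summable M.
have [bS hbS] := ball_finite s0_gt0 s0_summable Sep.
pose nb g := [seq (p.1.1^-1 * (p.1.2 * g * p.2))%g |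
  p <- [seq (q, k) | q <- [seq (b, a) | b <- bM, a <- bM], k <- bS]].
pose N := (size bM * size bM * size bS)%N.
have cN g l : uniq l -> (forall h, h \in l -> close g h) -> (size l <= N)%N.
  move=> ul hl; have -> : N = size (nb g) by rewrite /nb size_map !size_allpairs.
  apply: uniq_leq_size => // h /hl[a [b [ha hb hk]]].
  apply/mapP; exists ((b, a), (a * g)^-1 * (b * h))%g.
    by rewrite !allpairs_f// ?hbM// hbS.
  by rewrite /= mulVKg mulKg.
pose s' := (s + delta) / 2.
have s's : s < s' by rewrite /s'; lra.
have div C : ~ summable_at act x s' C.
  by apply: critical_exponent_ge; rewrite ?deltaE ?lte_fin /s'; lra.
pose n0 := (Num.truncn (5 * M + 7)).+1.
have s'0 : 0 <= s' by lra.
have B1 : 0 <= N%:R * expR (s * (1 + M)) by rewrite mulr_ge0// expR_ge0.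
have [n [E [nn uE hE sE]]] := annulus_growth n0 B1 s'0 s's div.
have [S [uS SE sS sep]] := separated_subset crefl csym cN uE.
have hS g : g \in S -> n%:R <= len g <= n.+1%:R by move=> /SE /hE.
exists n, S; split=> //.
- by apply: le_trans (ltW (truncnS_gt _)) _; rewrite ler_nat.
- have h1 : (size S)%:R * expR (- s * (n.+1%:R + M)) <= \sum_(g <- S) expR (- s * (len g + M)).
    apply: size_le_sum => g /hS/andP[_ h]; rewrite ler_expR !mulNr lerN2.
    by rewrite ler_pM2l// lerD2r.
  apply: le_trans h1; rewrite mulNr expRN ler_pdivlMr ?expR_gt0// mul1r.
  have h2 : (size E)%:R <= N%:R * (size S)%:R :> R by rewrite -natrM ler_nat.
  have h3 := lt_le_trans sE h2.
  rewrite -mulrA -expRD in h3.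
  have N0 : 0 < N%:R :> R.
    rewrite lt_neqAle ler0n andbT eq_sym; apply/eqP => N0; move: h3.
    by rewrite N0 !mul0r ltxx.
  rewrite ltr_pM2l// in h3.
  apply: le_trans (ltW h3); rewrite ler_expR -natr1 le_eqVlt; apply/orP; left; apply/eqP; ring.
- move=> g h gS hS' gh a b la lb; rewrite ltNge; apply/negP => hle.
  by apply: (sep g h gS hS' gh); exists a, b.
Qed.

End Letters.

(** * Words *)

Section WordPoints.
Context {R : realType} {X : metricType R} {G : groupType}.
Variables (act : G -> X -> X) (x : X).
Hypothesis act_isom : isometry_group act.
Hypothesis cat : cat_minus_one X.
Local Notation len := (olen act x).
Local Notation gp := gromov_product.
Local Notation gpg := (gpg act x).

Variables (M : R) (conn : G -> G -> G) (n : nat) (S : seq G).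
Hypothesis M0 : 0 <= M.
Hypothesis conn_len : forall a b, len (conn a b) <= M.
Hypothesis conn_gp : forall a b, gpg a (conn a b * b)%g <= M.
Hypothesis n_large : 5 * M + 7 <= n%:R.
Hypothesis S_len : forall g, g \in S -> n%:R <= len g <= n.+1%:R.
Hypothesis S_sep : forall g h, g \in S -> h \in S -> g != h ->
  forall a b, len a <= M -> len b <= M -> 8 * M + 14 < len ((a * g)^-1 * (b * h))%g.

(** The connecting element depends on the previous letter; it keeps the turn at the
   corner between the two letters bounded. *)
Definition letter (sg : nat -> G) (k : nat) : G :=
  (conn (if k is k'.+1 then (sg k')^-1 else 1) (sg k) * sg k)%g.

Fixpoint word (sg : nat -> G) (k : nat) : G :=
  if k is k'.+1 then (word sg k' * letter sg k')%g else 1%g.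

Definition in_letters (sg : nat -> G) : Prop := forall i, sg i \in S.

Lemma word_ext sg sg' k : (forall i, (i < k)%N -> sg i = sg' i) -> word sg k = word sg' k.
Proof.
elim: k => //= k IH h; rewrite IH => [|i ik]; last by rewrite h// ltnS ltnW.
congr (_ * _)%g; rewrite /letter h//; case: k h {IH} => // k h.
by rewrite (h k).
Qed.

Lemma letter_len sg k : in_letters sg ->
  n%:R - M <= len (letter sg k) <= len (sg k) + M.
Proof.
move=> hs; rewrite /letter; set h := conn _ _.
have hM : len h <= M by exact: conn_len.
have /andP[h1 h2] := S_len (hs k).
have := olenM x act_isom h (sg k); have := olenM x act_isom h^-1%g (h * sg k)%g.
by rewrite mulKg (olenV x act_isom); lra.
Qed.

Definition wpt sg k := act (word sg k) x.

Lemma wpt_step sg k : mdist (wpt sg k) (wpt sg k.+1) = len (letter sg k).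
Proof. by rewrite /wpt (isomdE x act_isom) /= mulKg. Qed.

(** Removing the connecting element before sg k changes the Gromov product by at most
   M, and the rest is conn_gp. *)
Lemma wpt_turn sg k : gp (wpt sg k.+1) (wpt sg k) (wpt sg k.+2) <= 2 * M.
Proof.
set a := letter sg k; set b := letter sg k.+1.
have e1 : ((word sg k.+1)^-1 * word sg k = a^-1)%g.
  by rewrite /= invgM -mulgA mulVg mulg1.
have e2 : ((word sg k.+1)^-1 * word sg k.+2 = b)%g by rewrite /= mulKg.
have e3 : ((word sg k)^-1 * word sg k.+2 = a * b)%g by rewrite /= -mulgA mulKg.
rewrite /gp !(isomdE x act_isom) e1 e2 e3 (olenV x act_isom).
have := conn_gp (sg k)^-1%g (sg k.+1).
rewrite (gpgE _ act_isom) invgK (olenV x act_isom) -/(letter sg k.+1) -/b.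
have aE : a = (conn (if k is k'.+1 then (sg k')^-1 else 1) (sg k) * sg k)%g by [].
set h := conn (if k is _.+1 then _ else _) _ in aE.
have hM : len h <= M by exact: conn_len.
have h1 : len a <= len h + len (sg k) by rewrite aE; exact: olenM.
have h2 : len (sg k * b)%g <= len h + len (a * b)%g.
  have := olenM x act_isom h^-1%g (a * b)%g.
  by rewrite (olenV x act_isom) {1}aE -mulgA mulKg.
lra.
Qed.

Lemma wpt_long sg k : in_letters sg -> 2 * (2 * M) + 7 <= mdist (wpt sg k) (wpt sg k.+1).
Proof.
by move=> /(letter_len k)/andP[h _]; rewrite wpt_step; move: n_large h; lra.
Qed.

Lemma wpt_growth sg i d : in_letters sg -> d%:R <= mdist (wpt sg i) (wpt sg (i + d)).
Proof.
move=> hs; apply: (broken_growth cat (K := 2 * M)) => k; [exact: wpt_turn|exact: wpt_long].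
Qed.

Lemma wpt_broken sg i j k : in_letters sg -> (i <= j)%N -> (j <= k)%N ->
  gp (wpt sg j) (wpt sg i) (wpt sg k) <= 2 * M + 4.
Proof.
move=> hs ij jk; apply: (broken_geodesic cat (K := 2 * M)) => // [l|l|].
- exact: wpt_turn.
- exact: wpt_long.
- by rewrite mulr_ge0.
Qed.

Lemma word_gp sg j k : in_letters sg -> (j <= k)%N ->
  len (word sg j) - (2 * M + 4) <= gpg (word sg j) (word sg k).
Proof.
move=> hs jk; have := wpt_broken hs (leq0n j) jk.
have := gp_swap x (wpt sg j) (wpt sg k); rewrite /wpt /= (isom1 act_isom) -/(len _).
by rewrite -/(gpg _ _); lra.
Qed.

Lemma word_len_ge sg k : in_letters sg -> k%:R <= len (word sg k).
Proof.
by move=> hs; have := wpt_growth 0 k hs; rewrite /wpt add0n /= (isom1 act_isom).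
Qed.

Lemma word_len_step sg k : in_letters sg -> len (word sg k.+1) <= len (word sg k) + (n.+1%:R + M).
Proof.
move=> hs; have := olenM x act_isom (word sg k) (letter sg k).
have /andP[_ h] := letter_len k hs; have /andP[_ h'] := S_len (hs k).
by rewrite -/(word sg k.+1); lra.
Qed.

Lemma word_len_sum (sg : nat -> G) k :
  len (word sg k) <= \sum_(g <- mkseq sg k) (len g + M).
Proof.
elim: k => [|k IH]; first by rewrite big_nil /= (olen1 x act_isom).
rewrite mkseqS -cats1 big_cat big_seq1 /=.
apply: le_trans (olenM x act_isom _ _) _; rewrite lerD//.
rewrite /letter; apply: le_trans (olenM x act_isom _ _) _.
by rewrite addrC lerD2l.
Qed.

(** If later vertices met at a point, then by wpt_broken the vertices after the first
   different letter, k, would both lie near the geodesic to that point, at nearly the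
   same distance from the vertex before; S_sep keeps them further apart. *)
Lemma word_neq sg sg' k i j : in_letters sg -> in_letters sg' ->
  (forall m, (m < k)%N -> sg m = sg' m) -> sg k != sg' k ->
  (k < i)%N -> (k < j)%N -> word sg i <> word sg' j.
Proof.
move=> hs hs' eqk nek ki kj eqw.
have ok : word sg k = word sg' k by exact: word_ext.
have h1 := wpt_broken hs (leqnSn k) ki; have h2 := wpt_broken hs' (leqnSn k) kj.
have s1 := gp_swap (wpt sg k) (wpt sg k.+1) (wpt sg i).
have s2 := gp_swap (wpt sg' k) (wpt sg' k.+1) (wpt sg' j).
have l1 := letter_len k hs; have l2 := letter_len k hs'.
have := S_len (hs k); have := S_len (hs' k).
rewrite !wpt_step in s1 s2.
have oE : wpt sg' k = wpt sg k by rewrite /wpt ok.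
have pE : wpt sg' j = wpt sg i by rewrite /wpt eqw.
rewrite oE pE in h2 s2.
have g1 : n%:R - M - (2 * M + 4) <= gp (wpt sg k) (wpt sg k.+1) (wpt sg i) by lra.
have g2 : n%:R - M - (2 * M + 4) <= gp (wpt sg k) (wpt sg i) (wpt sg' k.+1).
  by rewrite gpC; lra.
have := four_point cat g1 g2.
rewrite /gp wpt_step -oE wpt_step {1}/wpt {1}/wpt (isomdE x act_isom) /= ok.
rewrite invgM -mulgA mulKg.
have := S_sep (hs k) (hs' k) nek
  (conn_len (if k is k'.+1 then (sg k')^-1 else 1)%g (sg k))
  (conn_len (if k is k'.+1 then (sg' k')^-1 else 1)%g (sg' k)).
rewrite -/(letter sg k) -/(letter sg' k) -[n.+1]addn1 natrD.
by lra.
Qed.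

(** A word and a proper prefix of it have different products by wpt_growth. *)
Lemma word_inj sg sg' i j : in_letters sg -> in_letters sg' ->
  word sg i = word sg' j -> mkseq sg i = mkseq sg' j.
Proof.
wlog ij : sg sg' i j / (i <= j)%N.
  move=> H hs hs' e; case/orP: (leq_total i j) => ij; first exact: H.
  by apply/esym; apply: H.
move=> hs hs' e.
have [ex|nex] := pselect (exists k, (k < i)%N && (sg k != sg' k)).
  case: (ex_minnP ex) => k /andP[ki nek] kmin.
  exfalso; apply: (word_neq hs hs' _ nek ki (leq_trans ki ij)) => // m mk.
  apply/eqP/negPn/negP => nem; have := kmin m.
  by rewrite (ltn_trans mk ki) nem /= leqNgt mk => /(_ isT).
have eqi k : (k < i)%N -> sg k = sg' k.
  by move=> ki; apply/eqP/negPn/negP => ne; apply: nex; exists k; rewrite ki.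
have ijE : i = j.
  have := wpt_growth i (j - i) hs'; rewrite subnKC// /wpt -e (word_ext eqi) mdistxx.
  rewrite lern0 subn_eq0 => ji; apply/eqP; by rewrite eqn_leq ij ji.
rewrite -ijE; apply/eq_in_map => k; rewrite mem_iota add0n => /andP[_ ki].
exact: eqi.
Qed.

End WordPoints.

(** * Hausdorff dimension of the limit set *)

(** If c < 1, then one letter after the other can be chosen such that the words of
   the bar extending the current word keep a relative weight smaller than 1, since
   the weights of the letters add up to at least 1.  A word with this property is not
   in the bar, and so the resulting infinite word misses the bar. *)
Lemma bar_weight {R : realType} {V : choiceType} (S : seq V) (a : V -> R)
    (bar : seq V -> Prop) (c : R) :
  uniq S -> (forall g, 0 <= a g) -> 1 <= \sum_(g <- S) a g ->
  (forall sg : nat -> V, (forall i, sg i \in S) -> exists k, bar (mkseq sg k)) ->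
  (forall r : seq (seq V), uniq r -> (forall l, l \in r -> bar l) ->
     \sum_(l <- r) \prod_(g <- l) a g <= c) ->
  1 <= c.
Proof.
move=> uS a0 a1 hbar hc; rewrite leNgt; apply/negP => c1.
pose small l := exists2 d, d < 1 & forall r : seq (seq V), uniq r ->
  (forall m, m \in r -> bar (l ++ m)) -> \sum_(m <- r) \prod_(g <- m) a g <= d.
have small0 : small [::] by exists c.
have small_bar l : small l -> ~ bar l.
  move=> [d d1 h] bl; have := h [:: [::]] isT.
  rewrite big_seq1 big_nil => hd; have {}hd : 1 <= d.
    by apply: hd => m; rewrite inE => /eqP ->; rewrite cats0.
  by move: d1; rewrite ltNge hd.
have /choice[f hf] : forall l, exists g, small l -> g \in S /\ small (rcons l g).
  move=> l; have [[d d1 h]|] := pselect (small l); last first.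
    by move=> ns; case: S uS a1 {hbar} => [|g S'] _; [rewrite big_nil ler10|exists g].
  apply: contrapT => /forallNP hn.
  have {}hn g : g \in S -> ~ small (rcons l g).
    by move=> gS sg; apply: (hn g) => _.
  pose d' := (1 + d) / 2.
  have d'1 : d' < 1 by rewrite /d'; lra.
  have dd' : d < d' by rewrite /d'; lra.
  have d0 : 0 <= d by have := h [::] isT; rewrite big_nil; apply.
  have /choice[F hF] : forall g, exists r : seq (seq V), g \in S ->
      [/\ uniq r, forall m, m \in r -> bar (rcons l g ++ m) &
          d' <= \sum_(m <- r) \prod_(k <- m) a k].
    move=> g; case: (boolP (g \in S)) => [gS|_]; last by exists [::].
    apply: contrapT => /forallNP h'; apply: (hn g gS); exists d' => // r ur hr.
    by rewrite leNgt; apply/negP => /ltW hlt; apply: (h' r).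
  have uW : uniq [seq g :: m | g <- S, m <- F g].
    apply: allpairs_uniq_dep => // [g gS|]; first by have [] := hF g gS.
    by move=> [g m] [g' m'] _ _ /= [-> ->].
  have hsum : \sum_(m <- [seq g :: m | g <- S, m <- F g]) \prod_(g <- m) a g <= d.
    apply: (h _ uW) => _ /allpairsPdep[g [m' [gS m'F ->]]].
    by have [_ hb _] := hF g gS; have := hb _ m'F; rewrite cat_rcons.
  rewrite big_allpairs_dep in hsum.
  have : \sum_(g <- S) a g * d' <= d.
    apply: le_trans hsum; rewrite [X in X <= _]big_seq [X in _ <= X]big_seq; apply: ler_sum => g gS.
    have [_ _ hd] := hF g gS.
    under eq_bigr do rewrite big_cons.
    by rewrite -mulr_sumr ler_wpM2l.
  rewrite -mulr_suml; nra.
pose w := fix w (k : nat) : seq V := if k is k'.+1 then rcons (w k') (f (w k')) else [::].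
have sw k : small (w k) by elim: k => //= k IH; have [] := hf _ IH.
pose sg k := f (w k).
have wE k : mkseq sg k = w k by elim: k => //= k IH; rewrite mkseqS IH.
have [|k hk] := hbar sg; first by move=> i; have [] := hf _ (sw i).
by apply: (small_bar (w k)); rewrite // -wE.
Qed.

Section DimensionLowerBound.
Context {R : realType} {X : metricType R} {G : groupType}.
Variables (act : G -> X -> X) (x : X).
Hypothesis act_isom : isometry_group act.
Hypothesis cat : cat_minus_one X.
Hypothesis X_proper : proper_space X.
Hypothesis fg : finitely_generated G.
Hypothesis non_elem : non_elementary act x.
Variable delta : R.
Hypothesis delta_gt0 : 0 < delta.
Hypothesis deltaE : critical_exponent act x = delta%:E.
Local Notation len := (olen act x).
Local Notation gpg := (gpg act x).

Section Cover.
Variables (s eta : R) (U : nat -> set (boundary X)).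
Hypothesis s_gt0 : 0 < s.
Hypothesis eta_gt0 : 0 < eta.
Hypothesis U_diam : forall i, (diameter (bourdon x) (U i) <= 1%:E)%E.
Hypothesis U_sum : (\sum_(i <oo) poweR (diameter (bourdon x) (U i)) s < eta%:E)%E.

Let diam i : R := fine (diameter (bourdon x) (U i)).

Let diamE i : diameter (bourdon x) (U i) = (diam i)%:E.
Proof.
rewrite /diam fineK// ge0_fin_numE; first by apply: le_lt_trans (U_diam i) _; exact: ltry.
by apply: ereal_sup_ubound; left.
Qed.

Let diam_ge0 i : 0 <= diam i.
Proof. by rewrite -lee_fin -diamE; apply: ereal_sup_ubound; left. Qed.

Let diam_ub i xi xi' : U i xi -> U i xi' -> bourdon x xi xi' <= diam i.
Proof.
move=> h h'; rewrite -lee_fin -diamE; apply: ereal_sup_ubound; right.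
by exists (xi, xi').
Qed.

(** Sets of diameter zero are given a positive size, at the expense of eta. *)
Definition cover_weight i : R := diam i `^ s + eta * 2^-1 ^+ i.+1.

Lemma cover_weight_gt0 i : 0 < cover_weight i.
Proof.
by rewrite /cover_weight ltr_wpDl ?powR_ge0// mulr_gt0// exprn_gt0// invr_gt0.
Qed.

Lemma cover_weight_sum N : \sum_(i < N) cover_weight i <= eta + eta.
Proof.
rewrite big_split /= lerD//.
  rewrite -lee_fin; apply: le_trans (ltW U_sum).
  rewrite -sumEFin.
  rewrite (eq_bigr (fun i : 'I_N => poweR (diameter (bourdon x) (U i)) s)); last first.
    by move=> i _; rewrite diamE poweR_EFin.
  rewrite -(big_mkord xpredT (fun i => poweR (diameter (bourdon x) (U i)) s)).
  by apply: nneseries_lim_ge => i _ _; exact: poweR_ge0.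
rewrite -mulr_sumr ger_pMr//.
under eq_bigr do rewrite exprS.
rewrite -mulr_sumr.
have := @geometric_sum_le R 2^-1 N; rewrite (_ : (1 - 2^-1)^-1 = 2); last by field.
by move=> /(_ ltac:(lra) ltac:(lra)); lra.
Qed.

(** The orbit length at which a word with limit in U i is cut. *)
Definition cover_depth i : R := - ln (cover_weight i) / s.

Lemma expR_cover_depth i : expR (- s * cover_depth i) = cover_weight i.
Proof.
rewrite /cover_depth (_ : - s * _ = ln (cover_weight i)); last first.
  by field; rewrite gt_eqF.
by rewrite lnK// posrE cover_weight_gt0.
Qed.

Lemma diam_le_depth i : diam i <= expR (- cover_depth i).
Proof.
have := diam_ge0 i; rewrite le_eqVlt => /orP[/eqP <-|d0]; first exact: expR_ge0.
rewrite -(lnK (x := diam i)) ?posrE// ler_expR /cover_depth.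
rewrite mulNr opprK ler_pdivlMr// -[X in _ <= X](expRK) .
rewrite lnK ?posrE ?cover_weight_gt0// mulrC -ln_powR ler_ln ?posrE ?powR_gt0 ?cover_weight_gt0//.
by rewrite lerDl mulr_ge0 ?(ltW eta_gt0)// exprn_ge0// invr_ge0.
Qed.

Lemma cover_bourdon i xi xi' : U i xi -> U i xi' -> bourdon x xi xi' <= expR (- cover_depth i).
Proof. by move=> h h'; apply: le_trans (diam_ub h h') (diam_le_depth i). Qed.

End Cover.

(** Given a cover with small s-sum, the bar consists of the words cut at the depth of
   a set of the cover that contains the limit.  Words cut by the same set end close
   to each other, because the Bourdon distance of their limits is small, so at most
   N of them exist. *)
Lemma Hausdorff_measure_neq0 s : 0 < s -> s < delta ->
  hausdorff_measure (bourdon x) s (limit_set act x) <> 0%E.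
Proof.
move=> s_gt0 sd H0.
have dpos : (0 < critical_exponent act x)%E by rewrite deltaE lte_fin.
have dfin : (critical_exponent act x < +oo)%E by rewrite deltaE ltry.
have [s1 [B1 [s1_gt0 _ _ sum1]]] : exists s' B, [/\ 0 < s', s' < delta + 1,
    (critical_exponent act x <= s'%:E)%E & summable_at act x s' B].
  by apply: critical_exponent_lt; rewrite deltaE lte_fin ltrDl.
have [M [M0 hM]] := connecting_elements act_isom cat X_proper fg non_elem s1_gt0 sum1 dpos dfin.
have /choice[cn hcn] : forall p : G * G, exists h, len h <= M /\ gpg p.1 (h * p.2)%g <= M.
  by move=> [a b]; have [h h1 h2] := hM a b; exists h.
pose conn a b := cn (a, b).
have conn_len a b : len (conn a b) <= M by have [] := hcn (a, b).
have conn_gp a b : gpg a (conn a b * b)%g <= M by have [] := hcn (a, b).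
have [n [S [uS n_large S_len S_sum S_sep]]] :=
  letters act_isom s1_gt0 sum1 deltaE s_gt0 sd M0.
pose step := n.+1%:R + M.
pose rr := 2 * step + 4 * M + 30.
have [N hN] := ball_size s1_gt0 sum1 rr.
pose eta := (4 * (N%:R + 1))^-1 : R.
have N1 : 0 <= N%:R :> R := ler0n _ _.
have eta_gt0 : 0 < eta by rewrite invr_gt0; lra.
(* The cover and the enlargement of its sets contribute eta each. *)
have eta_small : (eta + eta) * N%:R < 1.
  have : eta * (4 * (N%:R + 1)) = 1 by rewrite mulVf// gt_eqF//; lra.
  nra.
have eta_small2 : eta + eta < 1.
  have : eta * (4 * (N%:R + 1)) = 1 by rewrite mulVf// gt_eqF//; lra.
  nra.
have [U [Ucov U_diam] U_sum] : exists2 U : nat -> set (boundary X),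
    limit_set act x `<=` \bigcup_i U i /\ (forall i, diameter (bourdon x) (U i) <= 1%:E)%E &
    (\sum_(i <oo) poweR (diameter (bourdon x) (U i)) s < eta%:E)%E.
  have : (hausdorff_premeasure (bourdon x) s 1 (limit_set act x) < eta%:E)%E.
    apply: (@le_lt_trans _ _ 0%E); last by rewrite lte_fin.
    rewrite -H0 /hausdorff_measure; apply: ereal_sup_ubound.
    by exists 1; rewrite //=.
  by move=> /ereal_inf_lt[_ [U hU <-] hlt]; exists U.
pose W := cover_weight s eta U; pose D := cover_depth s eta U.
have W0 i : 0 < W i by exact: cover_weight_gt0.
pose wd := word conn; pose inS (sg : nat -> G) := in_letters S sg.
pose caught i (l : seq G) := exists sg k xi, [/\ inS sg, l = mkseq sg k,
  cvg_boundary x (fun n => act (wd sg n) x) xi, U i xi & D i <= len (wd sg k) <= D i + step].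
have D0 i : 0 <= D i.
  rewrite /D /cover_depth mulNr oppr_ge0 pmulr_lle0 ?invr_gt0// ln_le0//.
  have := cover_weight_sum eta_gt0 U_diam U_sum i.+1.
  rewrite big_ord_recr /=.
  have : 0 <= \sum_(j < i) cover_weight s eta U j.
    by apply: sumr_ge0 => j _; apply: ltW; exact: cover_weight_gt0.
  lra.
(* The cut is made at the first vertex of orbit length at least D i. *)
have catch sg : inS sg -> exists k, exists i, caught i (mkseq sg k).
  move=> hs.
  have [xi cxi] : exists xi, cvg_boundary x (fun n => act (wd sg n) x) xi.
    apply: (gromov_sequence_cvg cat X_proper) => A.
    pose n0 := (Num.truncn (A + (2 * M + 4))).+1.
    have hn m : (n0 <= m)%N -> A + (2 * M + 4) <= len (wd sg m).
      move=> nm; apply: (le_trans _ (word_len_ge act_isom cat conn_len conn_gp n_large S_len m hs)).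
      by apply: le_trans (ltW (truncnS_gt _)) _; rewrite ler_nat.
    exists n0 => a b na nb.
    have wg := word_gp act_isom cat M0 conn_len conn_gp n_large S_len hs.
    case/orP: (leq_total a b) => ab; last rewrite gpC.
      by apply: le_trans _ (wg _ _ ab); have := hn a na; rewrite /wd; lra.
    by apply: le_trans _ (wg _ _ ab); have := hn b nb; rewrite /wd; lra.
  have [i _ Ui] := Ucov xi (ex_intro _ (wd sg) cxi).
  have exk : exists k, D i <= len (wd sg k).
    exists (Num.truncn (D i)).+1.
    apply: (le_trans _ (word_len_ge act_isom cat conn_len conn_gp n_large S_len _ hs)).
    exact/ltW/truncnS_gt.
  case: (ex_minnP exk) => k hk kmin; exists k, i, sg, k, xi; split=> //.
  rewrite hk /=; case: k hk kmin => [|k] hk kmin.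
    rewrite /wd /= (olen1 x act_isom); have := D0 i; rewrite /step; have := ler0n R n.+1; lra.
  apply: le_trans (word_len_step act_isom conn_len S_len k hs) _.
  rewrite lerD2r; case: (lerP (len (word conn sg k)) (D i)) => // /ltW/kmin.
  by rewrite ltnn.
(* Both ends have orbit length about D i, and their Gromov product is at least
   D i - 2 M - 9. *)
have close i l l' : caught i l -> caught i l' -> exists sg k sg' k',
    [/\ inS sg /\ inS sg', l = mkseq sg k, l' = mkseq sg' k',
      D i <= len (wd sg k) & len ((wd sg k)^-1 * wd sg' k')%g <= rr].
  move=> [sg [k [xi [hs lE cxi Ui /andP[h1 h2]]]]].
  move=> [sg' [k' [xi' [hs' lE' cxi' Ui' /andP[h1' h2']]]]].
  exists sg, k, sg', k'; split=> //.
  have hb := cover_bourdon s_gt0 eta_gt0 U_diam Ui Ui'.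
  have [n0 hn0] := cvg_bourdon_gp cat cxi cxi' hb.
  pose m := maxn n0 (maxn k k').
  have [m0 mk mk'] : [/\ (n0 <= m)%N, (k <= m)%N & (k' <= m)%N].
    by rewrite /m; split; rewrite ?leq_maxl// !leq_max ?leqnn ?orbT.
  have wg sg0 := word_gp act_isom cat M0 conn_len conn_gp n_large S_len (sg := sg0).
  have g1 := wg sg k m hs mk; have g3 := wg sg' k' m hs' mk'.
  have g2 : D i - 5 <= gpg (wd sg m) (wd sg' m) by exact: hn0.
  rewrite gpgC in g3.
  have f1 : D i - (2 * M + 5) - 2 <= gpg (wd sg k) (wd sg' m).
    by apply: (gpg_four cat (b := wd sg m)); lra.
  have f2 : D i - (2 * M + 5) - 2 - 2 <= gpg (wd sg k) (wd sg' k').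
    by apply: (gpg_four cat f1); lra.
  by move: f2; rewrite (gpgE _ act_isom) /rr; lra.
have count i (r : seq (seq G)) : uniq r -> (forall l, l \in r -> caught i l) ->
    \sum_(l <- r) \prod_(g <- l) expR (- s * (len g + M)) <= N%:R * W i.
  move=> ur hr; apply: (@le_trans _ _ ((size r)%:R * W i)).
    apply: sum_le_size => l /hr hl.
    have [sg [k [_ [_ [_ lE _ Dk _]]]]] := close i l l hl hl.
    rewrite /W -(expR_cover_depth U s_gt0 eta_gt0).
    rewrite (_ : \prod_(g <- l) _ = expR (- s * \sum_(g <- l) (len g + M))); last first.
      elim: (l) => [|g l' IH]; first by rewrite !big_nil mulr0 expR0.
      by rewrite !big_cons IH -expRD -mulrDr.
    rewrite ler_expR !mulNr lerN2 ler_pM2l//; apply: le_trans Dk _.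
    by rewrite lE; exact: word_len_sum.
  rewrite ler_wpM2r ?(ltW (W0 i))// ler_nat.
  case: r ur hr => [|l0 r] ur hr //.
  have /choice[F hF] : forall l, exists g, l \in l0 :: r -> exists sg k,
      [/\ inS sg, l = mkseq sg k & g = wd sg k].
    move=> l; case: (boolP (l \in l0 :: r)) => [/hr hl|_]; last by exists 1%g.
    have [sg [k [_ [_ [[hs _] lE _ _ _]]]]] := close i l l hl hl.
    by exists (wd sg k) => _; exists sg, k.
  have FE l sg k : l \in l0 :: r -> inS sg -> l = mkseq sg k -> F l = wd sg k.
    move=> lr hs lE; have [sg' [k' [hs' lE' ->]]] := hF l lr.
    have kk : k' = k by rewrite -(size_mkseq sg' k') -lE' lE size_mkseq.
    rewrite kk in lE' *; apply: word_ext => j jk.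
    by rewrite -(nth_mkseq 1%g sg' jk) -lE' lE nth_mkseq.
  have Finj : {in l0 :: r &, injective F}.
    move=> l l' lr lr' e.
    have [sg [k [hs lE E]]] := hF l lr; have [sg' [k' [hs' lE' E']]] := hF l' lr'.
    rewrite lE lE'.
    apply: (word_inj act_isom cat M0 conn_len conn_gp n_large S_len S_sep hs hs').
    exact: etrans (esym E) (etrans e E').
  rewrite -(size_map (fun l => ((F l0)^-1 * F l)%g)); apply: hN.
    rewrite map_inj_in_uniq// => l l' lr lr' /mulgI; exact: Finj.
  move=> g /mapP[l lr ->].
  have [sg [k [sg' [k' [[hs hs'] lE lE' _ h]]]]] := close i l0 l (hr l0 (mem_head _ _)) (hr l lr).
  by rewrite (FE l0 sg k (mem_head _ _) hs lE) (FE l sg' k' lr hs' lE').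
pose a g := expR (- s * (len g + M)).
have : 1 <= (eta + eta) * N%:R.
  apply: (@bar_weight _ _ S a (fun l => exists i, caught i l)) => //.
  - by move=> g; exact: expR_ge0.
  move=> r ur hr.
  have /choice[I hI] : forall l, exists i, l \in r -> caught i l.
    move=> l; case: (boolP (l \in r)) => [lr|_]; last by exists 0%N.
    by have [i hi] := hr l lr; exists i.
  pose m := (\max_(l <- r) I l)%N.
  rewrite (partition_big (fun l => inord (I l) : 'I_m.+1) xpredT)//=.
  apply: (@le_trans _ _ (\sum_(j < m.+1) N%:R * W j)).
    apply: ler_sum => j _; rewrite -big_filter; apply: count; first exact: filter_uniq.
    move=> l; rewrite mem_filter => /andP[/eqP <- lr]; rewrite inordK; first exact: hI.
    by rewrite ltnS /m (bigD1_seq l)//= leq_maxl.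
  rewrite -mulr_sumr mulrC ler_wpM2r//.
  exact: (cover_weight_sum eta_gt0 U_diam U_sum).
by rewrite leNgt eta_small.
Qed.

Lemma Hausdorff_dim_ge : (critical_exponent act x <= hausdorff_dim (bourdon x) (limit_set act x))%E.
Proof.
rewrite deltaE; apply: le_ereal_inf_tmp => _ [s [s_gt0 H0] <-].
rewrite lee_fin leNgt; apply/negP => sd.
exact: (Hausdorff_measure_neq0 s_gt0 sd).
Qed.

End DimensionLowerBound.

Theorem theorem10p2 (R : realType) (X : metricType R) (Gamma : groupType)
  (act : Gamma -> X -> X) (x : X)
  (X_proper : proper_space X)
  (X_cat : cat_minus_one X)
  (act_isom : isometry_group act)
  (fg : finitely_generated Gamma)
  (non_elem : non_elementary act x)
  (discr : discrete_group act)
  (delta_gt0 : (0 < critical_exponent act x)%E)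
  (delta_fin : (critical_exponent act x < +oo)%E)
  (A P : set (set Gamma))
  (A_family : edge_group_family A)
  (P_family : forall H, P H -> is_subgroup H)
  (T : gtree Gamma) (T_jsj : jsj_tree A P T)
  (Y : finite_quotient T) (D : lifts Y)
  (C : {set qedge Y}) (C_block : is_block act x D C) :
  let delta := fine (critical_exponent act x) in
  [/\ forall e f, e \in C -> f \in C ->
        Kweight act x D delta e f \is a fin_num,
      spectral_radius (Kblock act x D C delta) <= 1,
      forall F : hyperbolic_choice act D C,
        (critical_parameter x F <= critical_exponent act x)%E
    & (critical_exponent act x < 1)%E \/ convex_cobounded act x ->
      forall F : hyperbolic_choice act D C,
        (critical_parameter x F <=
         hausdorff_dim (bourdon x) (limit_set act x))%E].
Proof.
move=> delta.
have deltaE : critical_exponent act x = delta%:E.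
  by rewrite /delta fineK// fin_numE gt_eqF ?lt_eqF// (lt_trans _ delta_gt0).
have d0 : 0 < delta by rewrite -lte_fin -deltaE.
have cp (F : hyperbolic_choice act D C) := critical_parameter_le act_isom d0 deltaE X_cat F.
split.
- by move=> e f eC fC; exact: (block_entry_fin act_isom deltaE C_block eC fC).
- exact: (block_radius act_isom deltaE C_block).
- by move=> F; exact: cp.
move=> _ F; apply: le_trans (cp F) _.
exact: (Hausdorff_dim_ge act_isom X_cat X_proper fg non_elem d0 deltaE).
Qed.
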